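(* Let $n\ge 1$ and $\varphi\in\mathcal F^2(\mathbb C^n)$. The integral operator $$S_\varphi F(z)=\int_{\mathbb C^n}F(w)\,e^{z\cdot\bar w}\,\varphi(z-\bar w)\,d\lambda(w),\qquad z\in\mathbb C^n,$$ is bounded on $\mathcal F^2(\mathbb C^n)$ if and only if there exists $m\in L^\infty(\mathbb R^n)$ such that $$\varphi(z)=\left(\frac{2}{\pi}\right)^{n/2}\int_{\mathbb R^n}m(x)\,e^{-2\left(x-\frac i2 z\right)^2}\,dx,\qquad z\in\mathbb C^n.$$ Moreover, in this case, $$\|S_\varphi\|_{\mathcal F^2(\mathbb C^n)\to\mathcal F^2(\mathbb C^n)}=\|m\|_{L^\infty(\mathbb R^n)}.$$
   Context: $d\lambda(z)=\pi^{-n}e^{-|z|^2}\,dz$ is the Gaussian measure on $\mathbb C^n$ ($dz$ is Lebesgue measure). The Fock space $\mathcal F^2(\mathbb C^n)$ is the Hilbert space of all entire functions $F$ on $\mathbb C^n$ with $\|F\|^2_{\mathcal F^2(\mathbb C^n)}=\int_{\mathbb C^n}|F(z)|^2\,d\lambda(z)<\infty$, with the inner product inherited from $L^2(\mathbb C^n,d\lambda)$. Notation: $z\cdot\bar w=\sum_{j=1}^n z_j\bar w_j$, $|z|^2=z\cdot\bar z$, and for a vector $a\in\mathbb C^n$, $a^2=\sum_{j=1}^n a_j^2$ (bilinear square, no conjugation). ''$S_\varphi$ is bounded on $\mathcal F^2(\mathbb C^n)$'' means that the integral formula defines a bounded linear operator from $\mathcal F^2(\mathbb C^n)$ to itself.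 *)

(* Defs.v *)
From HB Require Import structures.
From mathcomp Require Import all_boot all_order all_algebra.
From mathcomp Require Import all_classical all_reals all_analysis.
From mathcomp Require Import measurable_realfun ess_sup_inf.
From mathcomp.real_closed Require Import complex.

Set Implicit Arguments.
Unset Strict Implicit.
Unset Printing Implicit Defensive.

Import Order.TTheory GRing.Theory Num.Theory.
Import numFieldNormedType.Exports.
Import Normc.

Local Open Scope classical_set_scope.
Local Open Scope ring_scope.
Local Open Scope complex_scope.

(* Row vectors carry the product sigma-algebra, generated by the coordinate
   projections. *)
Definition rV_display : measure_display -> measure_display.
Proof. exact. Qed.

Section measurable_rV.
Context {d} {T : measurableType d} (n : nat).

Let coord (i : 'I_n) (v : 'rV[T]_n) : T := v ord0 i.

Let rV_set0 : g_sigma_preimage coord set0.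
Proof. exact: sigma_algebra0. Qed.

Let rV_setC A : g_sigma_preimage coord A -> g_sigma_preimage coord (~` A).
Proof. exact: sigma_algebraC. Qed.

Let rV_bigcup (F : _^nat) : (forall i, g_sigma_preimage coord (F i)) ->
  g_sigma_preimage coord (\bigcup_i F i).
Proof. exact: sigma_algebra_bigcup. Qed.

HB.instance Definition _ := @isMeasurable.Build (rV_display d)
  'rV[T]_n (g_sigma_preimage coord) rV_set0 rV_setC rV_bigcup.

End measurable_rV.

Lemma measurable_coord d (T : measurableType d) n (i : 'I_n) :
  measurable_fun [set: 'rV[T]_n] (fun v => v ord0 i).
Proof.
move=> _ Y mY; rewrite setTI; apply: sub_sigma_algebra => /=.
rewrite -bigcup_seq/=; exists i => /=; first by rewrite mem_index_enum.
by exists Y => //; rewrite setTI.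
Qed.

Lemma measurable_fun_rVP d d' (S : measurableType d) (T : measurableType d') n
    (f : S -> 'rV[T]_n) :
  measurable_fun [set: S] f <->
  forall i, measurable_fun [set: S] (fun x => f x ord0 i).
Proof.
split=> [mf i|mf].
  exact: (measurableT_comp (@measurable_coord _ T n i) mf).
have sub : g_sigma_preimage (fun (i : 'I_n) x => f x ord0 i) `<=` measurable.
  apply: smallest_sub; first exact: sigma_algebra_measurable.
  case: n => [|n] in f mf *; first by rewrite big_ord0.
  rewrite -bigcup_mkord_ord; apply: bigcup_sub => i Ii.
  by move=> A [B mB <-]; exact: mf.
move=> _ A mA; apply: sub.
rewrite (_ : (fun i x => f x ord0 i)
  = (fun i => (fun v : 'rV[T]_n => v ord0 i) \o f))//.
by rewrite g_sigma_preimage_comp; exists A.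
Qed.

(* R[i] carries the Borel sigma-algebra of R * R, transported along
   (x, y) |-> x + iy. *)
Definition complex_display : measure_display.
Proof. exact: default_measure_display. Qed.

Section measurable_complex.
Context {R : realType}.

Definition complex_of (p : R * R) : R[i] := p.1 +i* p.2.
Definition of_complex (z : R[i]) : R * R := (complex.Re z, complex.Im z).

Lemma complex_ofK : cancel complex_of of_complex.
Proof. by case. Qed.

Lemma of_complexK : cancel of_complex complex_of.
Proof. by case. Qed.

HB.instance Definition _ := Pointed.copy R[i] (R[i])^o.

Let measC : set (set R[i]) :=
  [set A | measurable (complex_of @^-1` A)].

Let measC0 : measC set0.
Proof. by rewrite /measC/= preimage_set0. Qed.

Let measCC A : measC A -> measC (~` A).
Proof. by move=> mA; rewrite /measC/= preimage_setC; exact: measurableC. Qed.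

Let measC_bigcup (F : _^nat) :
  (forall i, measC (F i)) -> measC (\bigcup_i F i).
Proof.
by move=> mF; rewrite /measC/= preimage_bigcup; exact: bigcupT_measurable.
Qed.

HB.instance Definition _ := @isMeasurable.Build complex_display
  R[i] measC measC0 measCC measC_bigcup.

Lemma measurable_complex_of : measurable_fun [set: R * R] complex_of.
Proof. by move=> _ A mA; rewrite setTI. Qed.

Lemma measurable_of_complex : measurable_fun [set: R[i]] of_complex.
Proof.
move=> _ A mA; rewrite setTI.
suff : measurable (complex_of @^-1` (of_complex @^-1` A)) by [].
by rewrite -comp_preimage (_ : _ \o _ = id)//; apply/funext => -[].
Qed.

Lemma measurable_Re : measurable_fun [set: R[i]] (@complex.Re R).
Proof.
exact: (measurableT_comp (@measurable_fst _ _ R R) measurable_of_complex).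
Qed.

Lemma measurable_Im : measurable_fun [set: R[i]] (@complex.Im R).
Proof.
exact: (measurableT_comp (@measurable_snd _ _ R R) measurable_of_complex).
Qed.

End measurable_complex.

(* [m1 \x m2] under a name of its own: the library's sigma-finite instance for
   [\x] is shadowed by the one for subprobabilities and cannot be inferred. *)
Section sigma_finite_prod.
Context d1 d2 (T1 : measurableType d1) (T2 : measurableType d2) (R : realType).
Variable m1 : {sigma_finite_measure set T1 -> \bar R}.
Variable m2 : {sigma_finite_measure set T2 -> \bar R}.

Definition sigma_finite_prod := (m1 \x m2)%E.

HB.instance Definition _ := Measure.copy sigma_finite_prod (m1 \x m2)%E.

Let prod_sigma_finite : sigma_finite [set: T1 * T2] sigma_finite_prod.
Proof.
have /sigma_finiteP[F [TF ndF Foo]] := sigma_finiteT m1.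
have /sigma_finiteP[G [TG ndG Goo]] := sigma_finiteT m2.
exists (fun n => F n `*` G n).
  rewrite -setXTT TF TG predeqE => -[x y]; split.
    move=> [/= [n _ Fnx] [k _ Gky]]; exists (maxn n k) => //; split.
    - by move: x Fnx; exact/subsetPset/ndF/leq_maxl.
    - by move: y Gky; exact/subsetPset/ndG/leq_maxr.
  by move=> [n _ []/= ? ?]; split; exists n.
move=> k; have [? ?] := Foo k; have [? ?] := Goo k.
split; first exact: measurableX.
rewrite /sigma_finite_prod product_measure1E//.
by rewrite lte_mul_pinfty// ge0_fin_numE.
Qed.

HB.instance Definition _ := Measure_isSigmaFinite.Build _ _ _
  sigma_finite_prod prod_sigma_finite.

End sigma_finite_prod.

(* The image of a sigma-finite measure under an injection [f] with measurable
   left inverse [g]. *)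
Section image_measure.
Context d d' (S : measurableType d) (T : measurableType d') (R : realType).
Variables (f : S -> T) (g : T -> S) (fK : cancel f g).
Hypotheses (mf : measurable_fun [set: S] f) (mg : measurable_fun [set: T] g).
Variable mu : {sigma_finite_measure set S -> \bar R}.

Definition image_measure of cancel f g & measurable_fun [set: S] f
  & measurable_fun [set: T] g := pushforward mu f.

Local Notation nu := (image_measure fK mf mg).

Let nu' : {measure set T -> \bar R} :=
  measure_function_pushforward__canonical__measure_function_Measure mu mf.

Let nu0 : nu set0 = 0%E. Proof. exact: (measure0 nu'). Qed.

Let nu_ge0 A : (0 <= nu A)%E. Proof. exact: (measure_ge0 nu'). Qed.

Let nu_sigma_additive : semi_sigma_additive nu.
Proof. exact: (@measure_semi_sigma_additive _ _ _ nu'). Qed.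

HB.instance Definition _ := isMeasure.Build _ _ _ nu
  nu0 nu_ge0 nu_sigma_additive.

Let nu_sigma_finite : sigma_finite [set: T] nu.
Proof.
have [F FT mF] := sigma_finiteT mu.
exists (fun k => g @^-1` F k); first by rewrite -preimage_bigcup -FT.
move=> k; have [mFk Fk] := mF k; split.
  by rewrite -[X in measurable X]setTI; exact: mg.
rewrite /image_measure /pushforward -comp_preimage.
by rewrite (_ : _ \o _ = id)//; apply/funext => x; exact: fK.
Qed.

HB.instance Definition _ := Measure_isSigmaFinite.Build _ _ _ nu
  nu_sigma_finite.

End image_measure.

(* The n-fold product mu \x ... \x mu on row vectors. *)
Section power_measure.
Context d (T : measurableType d) (R : realType).

Definition cons_rV n (p : T * 'rV[T]_n) : 'rV[T]_n.+1 :=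
  \row_j oapp (p.2 ord0) p.1 (unlift ord0 j).
Definition uncons_rV n (v : 'rV[T]_n.+1) : T * 'rV[T]_n :=
  (v ord0 ord0, \row_j v ord0 (lift ord0 j)).

Lemma cons_rVK n : cancel (@cons_rV n) (@uncons_rV n).
Proof.
move=> [x v]; rewrite /uncons_rV /cons_rV mxE unlift_none/=; congr pair.
by apply/rowP => j; rewrite !mxE liftK.
Qed.

Lemma uncons_rVK n : cancel (@uncons_rV n) (@cons_rV n).
Proof.
move=> v; apply/rowP => j; rewrite mxE.
by case: unliftP => [k|] -> //=; rewrite mxE.
Qed.

Lemma measurable_cons_rV n : measurable_fun [set: T * 'rV[T]_n] (@cons_rV n).
Proof.
apply/measurable_fun_rVP => j.
rewrite (_ : (fun _ => _) = fun p : T * 'rV[T]_n =>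
    oapp (p.2 ord0) p.1 (unlift ord0 j)); last by apply/funext => p; rewrite mxE.
case: (unlift ord0 j) => [k|] /=; last exact: measurable_fst.
exact: (measurableT_comp (@measurable_coord _ T n k)).
Qed.

Lemma measurable_uncons_rV n : measurable_fun [set: 'rV[T]_n.+1] (@uncons_rV n).
Proof.
apply/measurable_fun_pair => /=; first exact: measurable_coord.
apply/measurable_fun_rVP => j.
rewrite (_ : (fun _ => _) =
    fun v : 'rV[T]_n.+1 => v ord0 (lift ord0 j)); last by apply/funext => v; rewrite mxE.
exact: measurable_coord.
Qed.

Fixpoint power_measure (mu : {sigma_finite_measure set T -> \bar R}) n :
    {sigma_finite_measure set 'rV[T]_n -> \bar R} :=
  if n is n'.+1 then
    image_measure (sigma_finite_prod mu (power_measure mu n')) (@cons_rVK n')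
      (@measurable_cons_rV n') (@measurable_uncons_rV n')
  else \d_(point : 'rV[T]_0).

End power_measure.

Lemma power_measure_box d (T : measurableType d) (R : realType)
    (mu : {sigma_finite_measure set T -> \bar R}) n (A : 'I_n -> set T) :
  (forall i, measurable (A i)) ->
  (power_measure mu n [set v | forall i, A i (v ord0 i)]
   = \prod_i mu (A i))%E.
Proof.
elim: n A => [A _|n IH A mA].
  by rewrite big_ord0 /= diracE mem_set//= => -[].
  rewrite big_ord_recl.
pose B := [set v : 'rV[T]_n | forall i, A (lift ord0 i) (v ord0 i)].
have mB : measurable B.
  rewrite (_ : B = \bigcap_(i in [set: 'I_n]) ((fun v : 'rV[T]_n => v ord0 i) @^-1` A (lift ord0 i))).
    apply: fin_bigcap_measurable => // i _.
    rewrite -[X in measurable X]setTI; exact: measurable_coord.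
  by apply/seteqP; split => [v Bv i _|v Bv i]; [exact: Bv|exact: (Bv i)].
rewrite /= /image_measure /pushforward /sigma_finite_prod.
rewrite (_ : _ @^-1` _ = A ord0 `*` B).
  rewrite product_measure1E//; congr (_ * _)%E; exact: IH.
apply/seteqP; split => [[x v] /= H|[x v] /= [Ax Bv] i].
  split; first by have := H ord0; rewrite mxE unlift_none.
  by move=> i; have := H (lift ord0 i); rewrite mxE liftK.
by rewrite mxE; case: unliftP => [j ->|->] //=; exact: Bv.
Qed.

(* [lebesgue_measure] lives on the alias [measurableTypeR R]; this is the same
   function on the measurable type [R] itself. *)
Section lebesgue_R.
Variable R : realType.

Definition lebesgue_R : set R -> \bar R := @lebesgue_measure R.

Let lebesgue_R0 : lebesgue_R set0 = 0%E.
Proof. exact: (measure0 (@lebesgue_measure R)). Qed.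

Let lebesgue_R_ge0 A : (0 <= lebesgue_R A)%E.
Proof. exact: (measure_ge0 (@lebesgue_measure R)). Qed.

Let lebesgue_R_sigma_additive : semi_sigma_additive lebesgue_R.
Proof. exact: (@measure_semi_sigma_additive _ _ _ (@lebesgue_measure R)). Qed.

HB.instance Definition _ := isMeasure.Build _ _ _ lebesgue_R
  lebesgue_R0 lebesgue_R_ge0 lebesgue_R_sigma_additive.

Let lebesgue_R_sigma_finite : sigma_finite [set: R] lebesgue_R.
Proof. exact: (sigma_finiteT (@lebesgue_measure R)). Qed.

HB.instance Definition _ := Measure_isSigmaFinite.Build _ _ _ lebesgue_R
  lebesgue_R_sigma_finite.

End lebesgue_R.

Section lebesgue_Rn_Cn.
Variable R : realType.

Definition lebesgue_Rn n : {sigma_finite_measure set 'rV[R]_n -> \bar R} :=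
  power_measure (@lebesgue_R R) n.

Definition lebesgue_C : {sigma_finite_measure set R[i] -> \bar R} :=
  image_measure (sigma_finite_prod (@lebesgue_R R) (@lebesgue_R R))
    (@complex_ofK R) (@measurable_complex_of R) (@measurable_of_complex R).

Definition lebesgue_Cn n : {sigma_finite_measure set 'rV[R[i]]_n -> \bar R} :=
  power_measure lebesgue_C n.

End lebesgue_Rn_Cn.

Section complex_analysis.
Variable R : realType.
Implicit Types (z w : R[i]).

Definition cexp z : R[i] :=
  (expR (complex.Re z) * cos (complex.Im z))
  +i* (expR (complex.Re z) * sin (complex.Im z)).

Section complex_integral.
Context d (T : measurableType d) (mu : {measure set T -> \bar R}).
Implicit Type f : T -> R[i].

Definition cintegrable f :=
  mu.-integrable [set: T] (fun x => (complex.Re (f x))%:E) /\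
  mu.-integrable [set: T] (fun x => (complex.Im (f x))%:E).

Definition cintegral f : R[i] :=
  (\int[mu]_x complex.Re (f x)) +i* (\int[mu]_x complex.Im (f x)).

Definition cLnorm (p : \bar R) f : \bar R :=
  'N[mu]_p[(fun x => (normc (f x))%:E)].

Definition cLfun (p : \bar R) : set (T -> R[i]) :=
  [set f | measurable_fun [set: T] f /\ (cLnorm p f < +oo)%E].

End complex_integral.
End complex_analysis.

Section vectors.
Variables (R : realType) (n : nat).
Implicit Types z w a : 'rV[R[i]]_n.

Definition conjv z : 'rV[R[i]]_n := map_mx conjc z.

(* The bilinear product; z . \bar w is [dotv z (conjv w)]. *)
Definition dotv z w : R[i] := \sum_j z ord0 j * w ord0 j.

Definition sqnorm z : R := complex.Re (dotv z (conjv z)).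

Definition sqv a : R[i] := \sum_j a ord0 j ^+ 2.

Definition complexv (x : 'rV[R]_n) : 'rV[R[i]]_n := map_mx (real_complex R) x.

End vectors.

Section gauss_measure.
Variables (R : realType) (n : nat).

Definition gauss_pdf (z : 'rV[R[i]]_n) : R := pi ^- n * expR (- sqnorm z).

Lemma gauss_pdf_ge0 z : 0 <= gauss_pdf z.
Proof. by rewrite mulr_ge0 ?expR_ge0// invr_ge0 exprn_ge0// pi_ge0. Qed.

Lemma sqnormE (z : 'rV[R[i]]_n) :
  sqnorm z = \sum_j (complex.Re (z ord0 j) ^+ 2 + complex.Im (z ord0 j) ^+ 2).
Proof.
rewrite /sqnorm /dotv raddf_sum; apply: eq_bigr => j _.
by rewrite mxE; case: (z ord0 j) => a b /=; rewrite mulrN opprK !expr2.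
Qed.

Lemma measurable_gauss_pdf : measurable_fun [set: 'rV[R[i]]_n] gauss_pdf.
Proof.
apply: measurable_funM => //; apply: measurableT_comp => //.
apply: measurableT_comp => //.
rewrite (_ : @sqnorm R n = fun z => \sum_j
    (complex.Re (z ord0 j) ^+ 2 + complex.Im (z ord0 j) ^+ 2)); last first.
  by apply/funext => z; exact: sqnormE.
apply: measurable_sum => j; apply: measurable_funD; apply: measurable_funX.
- exact: (measurableT_comp measurable_Re (measurable_coord _)).
- exact: (measurableT_comp measurable_Im (measurable_coord _)).
Qed.

Definition gauss_measure (A : set 'rV[R[i]]_n) : \bar R :=
  (\int[lebesgue_Cn R n]_(z in A) (gauss_pdf z)%:E)%E.

Let gauss0 : gauss_measure set0 = 0%E.
Proof. by rewrite /gauss_measure integral_set0. Qed.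

Let gauss_ge0 A : (0 <= gauss_measure A)%E.
Proof. by apply: integral_ge0 => z _; rewrite lee_fin gauss_pdf_ge0. Qed.

Let gauss_sigma_additive : semi_sigma_additive gauss_measure.
Proof.
move=> F mF tF mUF; rewrite /gauss_measure ge0_integral_bigcup//.
- apply: is_cvg_ereal_nneg_natsum_cond => k _ _; exact: gauss_ge0.
- apply/measurable_EFinP; exact: (measurable_funTS measurable_gauss_pdf).
- by move=> z _; rewrite lee_fin gauss_pdf_ge0.
Qed.

HB.instance Definition _ := isMeasure.Build _ _ _ gauss_measure
  gauss0 gauss_ge0 gauss_sigma_additive.

End gauss_measure.

Section fock.
Variables (R : realType) (n : nat).
Local Notation Cn := 'rV[R[i]]_n.
Implicit Types (F G phi : Cn -> R[i]) (T : (Cn -> R[i]) -> (Cn -> R[i])).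

(* Differentiability is over R[i], i.e. F is holomorphic on the whole of C^n. *)
Definition entire F :=
  forall z, differentiable (F : 'rV[(R[i])^o]_n -> (R[i])^o) z.

Definition fock_norm F : \bar R := cLnorm (@gauss_measure R n) 2%:E F.

Definition fock : set (Cn -> R[i]) :=
  [set F | entire F /\ (fock_norm F < +oo)%E].

Definition bounded_linear_on_fock T :=
  [/\ forall F, fock F -> fock (T F),
      forall (a : R[i]) F G, fock F -> fock G ->
        forall z, T (fun w => a * F w + G w) z = a * T F z + T G z
    & exists M : R, forall F, fock F ->
        (fock_norm (T F) <= M%:E * fock_norm F)%E].

Definition fock_opnorm T : \bar R :=
  ereal_sup [set fock_norm (T F) | F in [set F | fock F /\ (fock_norm F <= 1)%E]].

Definition S_integrand phi F (z w : Cn) : R[i] :=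
  F w * cexp (dotv z (conjv w)) * phi (z - conjv w).

Definition S_op phi F (z : Cn) : R[i] :=
  cintegral (@gauss_measure R n) (S_integrand phi F z).

(* [cintegral] takes junk values on non-integrable functions, so convergence has
   to be part of the claim that the formula defines an operator. *)
Definition S_bounded phi :=
  (forall F, fock F ->
     forall z, cintegrable (@gauss_measure R n) (S_integrand phi F z)) /\
  bounded_linear_on_fock (S_op phi).

Definition Linfty : set ('rV[R]_n -> R[i]) := cLfun (lebesgue_Rn R n) +oo%E.

Definition Linfty_norm (m : 'rV[R]_n -> R[i]) : \bar R :=
  cLnorm (lebesgue_Rn R n) +oo%E m.

Definition gauss_transform (m : 'rV[R]_n -> R[i]) (z : Cn) : R[i] :=
  ((2 / pi) `^ (n%:R / 2))%:C *
  cintegral (lebesgue_Rn R n)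
    (fun x => m x * cexp (- 2 * sqv (complexv x - ('i%C / 2) *: z))).

End fock.

(* Main.v *)
(* Let mu be the probability measure on R^n with density (2/pi)^{n/2} e^{-2|x|^2} and
   E(x,z) = exp(2i x.z + z^2/2).  Expanding the square shows that the Gaussian transform of m
   is V m, where V f(z) = \int f(x) E(x,z) dmu(x) is a Bargmann transform.  V sends conj E(.,a)
   to the coherent state exp(z.conj a) and is isometric on trigonometric polynomials, hence, by
   density, on L^2(mu); the reproducing property of the Fock space makes it onto.

   If phi = V m, then exp(z.conj w) phi(z - conj w) = \int m E(.,z) conj E(.,w) dmu, so that for
   bounded m one gets S_phi (V g) = V (m g): S_phi is unitarily equivalent to multiplication by m,
   which gives sufficiency and |S_phi| <= |m|.  Conversely, for bounded S_phi put m = V^{-1} phi, a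
   priori only in L^2(mu).  The reproducing property computes S_phi on coherent states, whence
   S_phi (V p) = V (m p) and |m p| <= |S_phi| |p| in L^2(mu) for trigonometric polynomials p, then
   by density for indicators p, which forces |m| <= |S_phi| almost everywhere.

   Trigonometric polynomials are dense in the strong sense that every bounded measurable function
   is reached from them by iterated bounded pointwise limits. *)
Require Import Defs.
From HB Require Import structures.
From mathcomp Require Import all_boot all_order all_algebra.
From mathcomp Require Import all_classical all_reals all_analysis.
From mathcomp Require Import measurable_realfun ess_sup_inf.
From mathcomp.real_closed Require Import complex.
From mathcomp Require Import ring lra.

Set Implicit Arguments.
Unset Strict Implicit.
Unset Printing Implicit Defensive.

Import Order.TTheory GRing.Theory Num.Theory.
Import numFieldNormedType.Exports.
Import Normc.

Local Open Scope classical_set_scope.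
Local Open Scope ring_scope.
Local Open Scope complex_scope.

(** * Complex numbers and complex integrals *)

(** A single fact carries the complex analysis: an entire function of one variable that is
    integrable against a centred Gaussian of the plane has its value at 0 as mean. Since complex
    differentiability comes without continuity of the derivative, it is derived from Goursat's
    lemma. After a translation it yields the reproducing property; applied to exponentials it yields
    the Laplace transform of the Gaussian on the line, and hence the equality of the Gram matrices
    of conjugate kernels and of coherent states.

    The two directions differ in what is known of [m]. For bounded [m] every integral is an inner
    product, and the isometry evaluates it. In the converse [m] is only square integrable, [m * g]
    may leave L2, and the integrals exist by hypothesis alone. The test functions are therefore
    trigonometric polynomials: they are combinations of conjugate kernels at real points, where
    these kernels are bounded in [x]. The essential supremum for Lebesgue measure is the one for mu
    because the two measures have the same null sets. *)

Section complex_basics.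
Context {R : realType}.
Implicit Types z w : R[i].
Local Notation Re := (@complex.Re R).
Local Notation Im := (@complex.Im R).

Lemma complexP z w : Re z = Re w -> Im z = Im w -> z = w.
Proof. by case: z; case: w => ? ? ? ? /= -> ->. Qed.

Lemma ReD z w : Re (z + w) = Re z + Re w.
Proof. by case: z; case: w. Qed.
Lemma ImD z w : Im (z + w) = Im z + Im w.
Proof. by case: z; case: w. Qed.
Lemma ReN z : Re (- z) = - Re z. Proof. by case: z. Qed.
Lemma ImN z : Im (- z) = - Im z. Proof. by case: z. Qed.
Lemma ReM z w : Re (z * w) = Re z * Re w - Im z * Im w.
Proof. by case: z; case: w. Qed.
Lemma ImM z w : Im (z * w) = Re z * Im w + Im z * Re w.
Proof. by case: z; case: w. Qed.
Lemma ReJ z : Re (z^*)%C = Re z. Proof. by case: z. Qed.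
Lemma ImJ z : Im (z^*)%C = - Im z. Proof. by case: z. Qed.

Lemma normc_ge0 z : 0 <= normc z.
Proof. by case: z => a b; exact: sqrtr_ge0. Qed.

Lemma sqr_normc_ReIm z : normc z ^+ 2 = Re z ^+ 2 + Im z ^+ 2.
Proof. by case: z => a b /=; rewrite sqr_sqrtr// addr_ge0// sqr_ge0. Qed.

Lemma normr_Re_le z : `|Re z| <= normc z.
Proof.
rewrite -(@ler_pXn2r _ 2)// ?nnegrE ?normc_ge0// sqr_normc_ReIm real_normK ?num_real//.
by rewrite lerDl sqr_ge0.
Qed.

Lemma normr_Im_le z : `|Im z| <= normc z.
Proof.
rewrite -(@ler_pXn2r _ 2)// ?nnegrE ?normc_ge0// sqr_normc_ReIm real_normK ?num_real//.
by rewrite lerDr sqr_ge0.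
Qed.

Lemma normc_le_ReIm z : normc z <= `|Re z| + `|Im z|.
Proof.
rewrite -(@ler_pXn2r _ 2)// ?nnegrE ?normc_ge0 ?addr_ge0// sqr_normc_ReIm.
rewrite sqrrD !real_normK ?num_real// lerD2r lerDl mulrn_wge0// mulr_ge0//.
Qed.

Lemma normcJ z : normc (z^*)%C = normc z.
Proof. by case: z => a b /=; rewrite sqrrN. Qed.

Lemma normc_real (x : R) : normc x%:C = `|x|.
Proof. by rewrite /= expr0n addr0 sqrtr_sqr. Qed.

Lemma normcB z w : normc (z - w) = normc (w - z).
Proof. by rewrite -normcN opprB. Qed.

Lemma normc_eq0 z : (normc z == 0) = (z == 0).
Proof.
by apply/eqP/eqP => [/eq0_normc//|->]; exact: normc0.
Qed.

Lemma normcX z k : normc (z ^+ k) = normc z ^+ k.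
Proof. by elim: k => [|k IH]; rewrite ?expr0 ?normc1// !exprS normcM IH. Qed.

Lemma normc_sum I (s : seq I) (P : pred I) (F : I -> R[i]) :
  normc (\sum_(i <- s | P i) F i) <= \sum_(i <- s | P i) normc (F i).
Proof.
elim/big_rec2 : _ => [|i y x _ IH]; first by rewrite normc0.
by rewrite (le_trans (le_normcD _ _))// lerD2l.
Qed.

Lemma mulcJ z : z * (z^*)%C = (normc z ^+ 2)%:C.
Proof.
rewrite sqr_normc_ReIm; case: z => a b.
by apply: complexP; rewrite ?ReM ?ImM /=; ring.
Qed.

Lemma normc_cexp z : normc (cexp z) = expR (Re z).
Proof.
rewrite /cexp /= !exprMn -mulrDr cos2Dsin2 mulr1 sqrtr_sqr.
by rewrite ger0_norm// expR_ge0.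
Qed.

Lemma cexpD z w : cexp (z + w) = cexp z * cexp w.
Proof.
apply: complexP; rewrite ?ReM ?ImM /cexp /= ReD ImD expRD ?cosD ?sinD; ring.
Qed.

Lemma cexp0 : cexp 0 = 1 :> R[i].
Proof. by apply: complexP; rewrite /cexp /= expR0 ?cos0 ?sin0 mul1r. Qed.

Lemma cexpJ z : cexp (z^*)%C = ((cexp z)^*)%C.
Proof. by apply: complexP; rewrite ?ReJ ?ImJ /cexp /= ReJ ImJ ?cosN ?sinN ?mulrN. Qed.

Lemma cexp_real (x : R) : cexp x%:C = (expR x)%:C.
Proof. by apply: complexP; rewrite /cexp /= ?cos0 ?sin0 ?mulr1 ?mulr0. Qed.

Lemma cexp_sum I (s : seq I) (P : pred I) (F : I -> R[i]) :
  cexp (\sum_(i <- s | P i) F i) = \prod_(i <- s | P i) cexp (F i).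
Proof.
by elim/big_rec2 : _ => [|i x y _ <-]; rewrite ?cexp0 ?cexpD.
Qed.

End complex_basics.

Section complex_measurability.
Context {R : realType} {d} {T : measurableType d}.
Implicit Types f g : T -> R[i].
Local Notation Re := (@complex.Re R).
Local Notation Im := (@complex.Im R).

Lemma measurable_funCP f : measurable_fun [set: T] f <->
  measurable_fun [set: T] (Re \o f) /\ measurable_fun [set: T] (Im \o f).
Proof.
split=> [mf|[mr mi]].
  by split; apply: measurableT_comp => //; [exact: measurable_Re|exact: measurable_Im].
rewrite (_ : f = complex_of \o (fun x => (Re (f x), Im (f x)))).
  apply: measurableT_comp; first exact: measurable_complex_of.
  exact/measurable_fun_pair.
by apply/funext => x /=; case: (f x).
Qed.

Lemma measurable_funCD f g : measurable_fun [set: T] f ->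
  measurable_fun [set: T] g -> measurable_fun [set: T] (fun x => f x + g x).
Proof.
move=> /measurable_funCP[fr fi] /measurable_funCP[gr gi].
apply/measurable_funCP; split.
  by rewrite (_ : _ \o _ = (Re \o f) \+ (Re \o g)); [exact: measurable_funD|apply/funext => x /=; rewrite ReD].
by rewrite (_ : _ \o _ = (Im \o f) \+ (Im \o g)); [exact: measurable_funD|apply/funext => x /=; rewrite ImD].
Qed.

Lemma measurable_funCM f g : measurable_fun [set: T] f ->
  measurable_fun [set: T] g -> measurable_fun [set: T] (fun x => f x * g x).
Proof.
move=> /measurable_funCP[fr fi] /measurable_funCP[gr gi].
apply/measurable_funCP; split.
  rewrite (_ : _ \o _ = ((Re \o f) \* (Re \o g)) \- ((Im \o f) \* (Im \o g))).
    by apply: measurable_funB; exact: measurable_funM.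
  by apply/funext => x /=; rewrite ReM.
rewrite (_ : _ \o _ = ((Re \o f) \* (Im \o g)) \+ ((Im \o f) \* (Re \o g))).
  by apply: measurable_funD; exact: measurable_funM.
by apply/funext => x /=; rewrite ImM.
Qed.

Lemma measurable_funCJ f : measurable_fun [set: T] f ->
  measurable_fun [set: T] (fun x => ((f x)^*)%C).
Proof.
move=> /measurable_funCP[fr fi]; apply/measurable_funCP; split.
  by rewrite (_ : _ \o _ = Re \o f)//; apply/funext => x /=; rewrite ReJ.
rewrite (_ : _ \o _ = \- (Im \o f)); first exact: measurable_funN.
by apply/funext => x /=; rewrite ImJ.
Qed.

Lemma measurable_fun_real (f : T -> R) : measurable_fun [set: T] f ->
  measurable_fun [set: T] (fun x => (f x)%:C).
Proof.
move=> mf; apply/measurable_funCP; split; first exact: mf.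
by rewrite (_ : _ \o _ = cst 0).
Qed.

Lemma measurable_fun_cexp f : measurable_fun [set: T] f ->
  measurable_fun [set: T] (fun x => cexp (f x)).
Proof.
move=> /measurable_funCP[fr fi]; apply/measurable_funCP; split.
  apply: measurable_funM; first exact: measurableT_comp.
  by apply: measurableT_comp fi; apply: continuous_measurable_fun; exact: continuous_cos.
apply: measurable_funM; first exact: measurableT_comp.
by apply: measurableT_comp fi; apply: continuous_measurable_fun; exact: continuous_sin.
Qed.

Lemma measurable_fun_normc f : measurable_fun [set: T] f ->
  measurable_fun [set: T] (fun x => normc (f x)).
Proof.
move=> /measurable_funCP[fr fi].
rewrite (_ : (fun x => _) = fun x => Num.sqrt ((Re (f x)) ^+ 2 + (Im (f x)) ^+ 2)).
  apply: measurableT_comp => //.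
    by apply: continuous_measurable_fun; exact: sqrt_continuous.
  by apply: measurable_funD; exact: measurable_funX.
by apply/funext => x; case: (f x).
Qed.

Lemma measurable_fun_csum I (s : seq I) (F : I -> T -> R[i]) :
  (forall i, measurable_fun [set: T] (F i)) ->
  measurable_fun [set: T] (fun x => \sum_(i <- s) F i x).
Proof.
move=> mF; elim: s => [|i s IH].
  by under eq_fun do rewrite big_nil; exact: measurable_cst.
by under eq_fun do rewrite big_cons; exact: measurable_funCD.
Qed.

Lemma measurable_fun_cprod I (s : seq I) (F : I -> T -> R[i]) :
  (forall i, measurable_fun [set: T] (F i)) ->
  measurable_fun [set: T] (fun x => \prod_(i <- s) F i x).
Proof.
move=> mF; elim: s => [|i s IH].
  by under eq_fun do rewrite big_nil; exact: measurable_cst.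
by under eq_fun do rewrite big_cons; exact: measurable_funCM.
Qed.

End complex_measurability.

Section complex_integral.
Context {R : realType} {d} {T : measurableType d}.
Variable mu : {measure set T -> \bar R}.
Implicit Types f g : T -> R[i].
Local Notation Re := (@complex.Re R).
Local Notation Im := (@complex.Im R).

Lemma cintegrableP f : cintegrable mu f <->
  measurable_fun [set: T] f /\ (\int[mu]_x (normc (f x))%:E < +oo)%E.
Proof.
split=> [[ir ii]|[mf fi]].
  have mr := measurable_int _ ir; have mi := measurable_int _ ii.
  have mf : measurable_fun [set: T] f.
    by apply/measurable_funCP; split; exact/measurable_EFinP.
  split => //.
  have := integrableD measurableT (integrable_norm ir) (integrable_norm ii).
  move=> /integrableP[_]; apply: le_lt_trans.
  apply: ge0_le_integral => //.
  - by move=> x _; rewrite lee_fin normc_ge0.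
  - by apply/measurable_EFinP; exact: measurable_fun_normc.
  - apply: measurableT_comp => //; apply: emeasurable_funD;
      by apply/measurable_EFinP; apply: measurableT_comp => //; exact/measurable_EFinP.
  - by move=> x _ /=; rewrite lee_fin ger0_norm ?addr_ge0// normc_le_ReIm.
have mn : measurable_fun [set: T] (fun x => (normc (f x))%:E).
  by apply/measurable_EFinP; exact: measurable_fun_normc.
have int : mu.-integrable [set: T] (fun x => (normc (f x))%:E).
  apply/integrableP; split => //.
  by under eq_integral do rewrite /= ger0_norm ?normc_ge0//.
have [mr mi] := (measurable_funCP _).1 mf.
split; apply: le_integrable int => //; try exact/measurable_EFinP.
  by move=> x _ /=; rewrite lee_fin [leRHS]ger0_norm ?normc_ge0// normr_Re_le.
by move=> x _ /=; rewrite lee_fin [leRHS]ger0_norm ?normc_ge0// normr_Im_le.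
Qed.

Lemma cintegrable_measurable f : cintegrable mu f -> measurable_fun [set: T] f.
Proof. by move=> /cintegrableP[]. Qed.

Lemma integrable_normc f : cintegrable mu f ->
  mu.-integrable [set: T] (fun x => (normc (f x))%:E).
Proof.
move=> /cintegrableP[mf fi]; apply/integrableP; split.
  by apply/measurable_EFinP; exact: measurable_fun_normc.
by under eq_integral do rewrite /= ger0_norm ?normc_ge0//.
Qed.

Lemma cintegrable_le f (h : T -> R) : measurable_fun [set: T] f ->
  mu.-integrable [set: T] (EFin \o h) -> (forall x, normc (f x) <= h x) ->
  cintegrable mu f.
Proof.
move=> mf ih fh; apply/cintegrableP; split => //.
have /integrableP[mh] := ih; apply: le_lt_trans; apply: ge0_le_integral => //.
- by move=> x _; rewrite lee_fin normc_ge0.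
- by apply/measurable_EFinP; exact: measurable_fun_normc.
- exact: measurableT_comp.
- by move=> x _ /=; rewrite lee_fin (le_trans (fh x))// ler_norm.
Qed.

Lemma cintegrable_leC f g : measurable_fun [set: T] f -> cintegrable mu g ->
  (forall x, normc (f x) <= normc (g x)) -> cintegrable mu f.
Proof. by move=> mf /integrable_normc ig; exact: cintegrable_le. Qed.

Lemma cintegrableD f g : cintegrable mu f -> cintegrable mu g ->
  cintegrable mu (fun x => f x + g x).
Proof.
move=> [fr fi] [gr gi]; split.
  by under eq_fun do rewrite ReD EFinD; exact: integrableD.
by under eq_fun do rewrite ImD EFinD; exact: integrableD.
Qed.

Lemma cintegralD f g : cintegrable mu f -> cintegrable mu g ->
  cintegral mu (fun x => f x + g x) = cintegral mu f + cintegral mu g.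
Proof.
move=> [fr fi] [gr gi]; apply: complexP; rewrite ?ReD ?ImD /cintegral /=.
  by under eq_Rintegral do rewrite ReD; exact: RintegralD.
by under eq_Rintegral do rewrite ImD; exact: RintegralD.
Qed.

Lemma cintegrableM_bounded f g (M : R) : cintegrable mu f ->
  measurable_fun [set: T] g -> (forall x, normc (g x) <= M) ->
  cintegrable mu (fun x => f x * g x).
Proof.
move=> fi mg gM; apply: (@cintegrable_le _ (fun x => M * normc (f x))).
- apply: measurable_funCM => //; exact: cintegrable_measurable fi.
- by have := integrableZl measurableT M (integrable_normc fi).
- by move=> x; rewrite normcM mulrC ler_wpM2r ?normc_ge0.
Qed.

Lemma cintegrableZ c f : cintegrable mu f -> cintegrable mu (fun x => c * f x).
Proof.
move=> fi; under eq_fun do rewrite mulrC.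
exact: (cintegrableM_bounded fi (measurable_cst c) (fun=> lexx (normc c))).
Qed.

Lemma cintegralZ c f : cintegrable mu f ->
  cintegral mu (fun x => c * f x) = c * cintegral mu f.
Proof.
move=> [fr fi]; rewrite /cintegral; apply: complexP => /=; rewrite ?ReM ?ImM /=.
  under eq_Rintegral do rewrite ReM.
  rewrite RintegralB ?RintegralZl//.
    by have := integrableZl measurableT (Re c) fr.
  by have := integrableZl measurableT (Im c) fi.
under eq_Rintegral do rewrite ImM.
rewrite RintegralD ?RintegralZl//.
  by have := integrableZl measurableT (Re c) fi.
by have := integrableZl measurableT (Im c) fr.
Qed.

Lemma cintegrableJ f : cintegrable mu f -> cintegrable mu (fun x => ((f x)^*)%C).
Proof.
move=> fi; apply: (cintegrable_leC _ fi) => [|x]; last by rewrite normcJ.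
exact/measurable_funCJ/cintegrable_measurable.
Qed.

Lemma cintegralJ f : cintegrable mu f ->
  cintegral mu (fun x => ((f x)^*)%C) = ((cintegral mu f)^*)%C.
Proof.
move=> [fr fi]; apply: complexP; rewrite ?ReJ ?ImJ /=.
  by apply: eq_Rintegral => x _; rewrite ReJ.
under eq_Rintegral do rewrite ImJ -mulN1r.
by rewrite RintegralZl// mulN1r.
Qed.

Lemma eq_cintegral f g : f =1 g -> cintegral mu f = cintegral mu g.
Proof. by move=> /funext ->. Qed.

Lemma cintegral0 : cintegral mu (fun=> 0) = 0.
Proof.
apply: complexP => /=; under eq_Rintegral do rewrite /=;
by rewrite /Rintegral integral0_eq.
Qed.

Lemma cintegrable0 : cintegrable mu (fun=> 0 : R[i]).
Proof.
by split; exact: (@integrable0 _ _ R mu [set: T]).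
Qed.

Lemma cintegrableB f g : cintegrable mu f -> cintegrable mu g ->
  cintegrable mu (fun x => f x - g x).
Proof.
move=> fi gi; under eq_fun do rewrite -[X in _ + X]mulN1r.
by apply: cintegrableD => //; exact: cintegrableZ.
Qed.

Lemma cintegralB f g : cintegrable mu f -> cintegrable mu g ->
  cintegral mu (fun x => f x - g x) = cintegral mu f - cintegral mu g.
Proof.
move=> fi gi; under eq_cintegral do rewrite -[X in _ + X]mulN1r.
by rewrite cintegralD ?cintegralZ ?mulN1r//; exact: cintegrableZ.
Qed.

Lemma cintegrable_sum I (s : seq I) (F : I -> T -> R[i]) :
  (forall i, cintegrable mu (F i)) ->
  cintegrable mu (fun x => \sum_(i <- s) F i x).
Proof.
move=> mF; elim: s => [|i s IH].
  by under eq_fun do rewrite big_nil; exact: cintegrable0.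
by under eq_fun do rewrite big_cons; exact: cintegrableD.
Qed.

Lemma cintegral_sum I (s : seq I) (F : I -> T -> R[i]) :
  (forall i, cintegrable mu (F i)) ->
  cintegral mu (fun x => \sum_(i <- s) F i x) = \sum_(i <- s) cintegral mu (F i).
Proof.
move=> mF; elim: s => [|i s IH].
  by under eq_cintegral do rewrite big_nil; rewrite big_nil cintegral0.
under eq_cintegral do rewrite big_cons.
by rewrite big_cons cintegralD ?IH//; exact: cintegrable_sum.
Qed.

(* Rotating [cintegral mu f] onto the positive axis reduces to real parts. *)
Lemma normc_cintegral_le f : cintegrable mu f ->
  normc (cintegral mu f) <= \int[mu]_x normc (f x).
Proof.
move=> fi; set I := cintegral mu f.
have [I0|I0] := eqVneq (normc I) 0.
  by rewrite I0 Rintegral_ge0// => x _; exact: normc_ge0.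
pose c := (I^*)%C * ((normc I)^-1)%:C.
have nc : normc c = 1.
  by rewrite /c normcM normcJ normc_real ger0_norm ?invr_ge0 ?normc_ge0// mulfV.
have cI : c * I = (normc I)%:C.
  rewrite /c mulrAC (mulrC _ I) mulcJ -!rmorphM /= expr2 -mulrA mulfV// mulr1//.
have : Re (c * I) = \int[mu]_x Re (c * f x) by rewrite -cintegralZ.
rewrite cI /= => ->; apply: le_Rintegral => //.
- by have [] := cintegrableZ c fi.
- exact: integrable_normc.
- by move=> x _; rewrite (le_trans (ler_norm _))// (le_trans (normr_Re_le _))// normcM nc mul1r.
Qed.

Lemma cintegral_ae f g : cintegrable mu f -> measurable_fun [set: T] g ->
  (\forall x \ae mu, f x = g x) -> cintegrable mu g /\ cintegral mu f = cintegral mu g.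
Proof.
move=> fi mg fg.
have /measurable_funCP[mfr mfi] := cintegrable_measurable fi.
have /measurable_funCP[mgr mgi] := mg.
split.
  apply/cintegrableP; split => //; have /cintegrableP[mf] := fi.
  rewrite (ae_eq_integral (fun x => (normc (g x))%:E))//.
  - by apply/measurable_EFinP; exact: measurable_fun_normc.
  - by apply/measurable_EFinP; exact: measurable_fun_normc.
  - by apply: filterS fg => x /= -> _.
apply: complexP => /=; rewrite /Rintegral; congr fine; apply: ae_eq_integral => //;
  try exact/measurable_EFinP.
- by apply: filterS fg => x /= -> _.
- by apply: filterS fg => x /= -> _.
Qed.

Lemma integral_dominated_cvg0 (u : nat -> T -> R) (h : T -> R) :
  (forall k, measurable_fun [set: T] (u k)) ->
  mu.-integrable [set: T] (EFin \o h) -> (forall k x, 0 <= u k x <= h x) ->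
  (forall x, u k x @[k --> \oo] --> 0) ->
  (\int[mu]_x (u k x)%:E @[k --> \oo] --> 0)%E.
Proof.
move=> mu_ ih uh u0.
have [] := @dominated_convergence _ _ _ mu _ measurableT (fun k x => (u k x)%:E)
  (fun=> 0%E) (EFin \o h).
- by move=> k; exact/measurable_EFinP.
- exact: measurable_cst.
- by apply/aeW => x _; apply: cvg_EFin; [exact: nearW|exact: u0].
- exact: ih.
- by apply/aeW => x k _ /=; have /andP[u1 u2] := uh k x; rewrite lee_fin ger0_norm.
by move=> _ _; rewrite integral0_eq.
Qed.

End complex_integral.

(** * Convergence of complex sequences and dominated convergence *)

Section complex_convergence.
Context {R : realType}.
Implicit Types (u v : nat -> R[i]) (k l : R[i]).

(** Convergence is expressed by a real sequence tending to 0, so that limit arguments take place in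
    [R] and squeezing applies directly. *)
Definition ccvg u l := normc (u k - l) @[k --> \oo] --> (0 : R).

Lemma ccvg_cst l : ccvg (fun=> l) l.
Proof. by rewrite /ccvg subrr normc0; exact: cvg_cst. Qed.

Lemma ccvg_squeeze u l (e : nat -> R) : (forall n, normc (u n - l) <= e n) ->
  e n @[n --> \oo] --> 0 -> ccvg u l.
Proof.
move=> ue e0; apply: (squeeze_cvgr _ (cvg_cst 0) e0).
by apply: nearW => n; rewrite normc_ge0 ue.
Qed.

Lemma ccvg_normc u l : ccvg u l -> normc (u n) @[n --> \oo] --> normc l.
Proof.
move=> ul; apply/cvgrPdist_le => e e0.
have /cvgrPdist_le/(_ e e0) := ul; apply: filterS => n.
rewrite sub0r normrN ger0_norm ?normc_ge0// => /(le_trans _); apply.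
rewrite ler_norml; apply/andP; split.
  rewrite lerBrDl lerBlDr -[X in _ <= _ + X]normcN; have := le_normcD l (u n - l).
  by rewrite normcN addrC subrK (addrC (normc l)) addrC.
rewrite lerBlDr normcB; have := le_normcD (l - u n) (u n).
by rewrite subrK.
Qed.

Lemma ccvgD u v k l : ccvg u k -> ccvg v l -> ccvg (fun n => u n + v n) (k + l).
Proof.
move=> uk vl; apply: (@ccvg_squeeze _ _ (fun n => normc (u n - k) + normc (v n - l))).
  by move=> n; rewrite opprD addrACA le_normcD.
by rewrite -[X in _ --> X](addr0 0); exact: cvgD.
Qed.

Lemma ccvgM u v k l : ccvg u k -> ccvg v l -> ccvg (fun n => u n * v n) (k * l).
Proof.
move=> uk vl; apply: (@ccvg_squeeze _ _
  (fun n => normc (u n - k) * normc (v n) + normc k * normc (v n - l))).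
  move=> n; rewrite -!normcM; apply: le_trans (le_normcD _ _).
  by rewrite mulrBl mulrBr addrA subrK.
rewrite -[X in _ --> X](addr0 0) -[X in _ --> X + _](mul0r (normc l)) -[X in _ --> _ + X](mulr0 (normc k)).
apply: cvgD; first by apply: cvgM => //; exact: ccvg_normc.
by apply: cvgM => //; exact: cvg_cst.
Qed.

Lemma ccvg_real (u : nat -> R) (l : R) : u n @[n --> \oo] --> l -> ccvg (fun n => (u n)%:C) l%:C.
Proof.
move=> ul; rewrite /ccvg; under eq_cvg do rewrite -rmorphB normc_real.
by apply/norm_cvg0P; rewrite -(subrr l); apply: cvgB ul (cvg_cst _).
Qed.

Lemma ccvg_Re u l : ccvg u l -> complex.Re (u n) @[n --> \oo] --> complex.Re l.
Proof.
move=> ul; apply/cvgrPdist_le => e e0.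
have /cvgrPdist_le/(_ e e0) := ul; apply: filterS => n.
rewrite sub0r normrN ger0_norm ?normc_ge0// => /(le_trans _); apply.
by rewrite -ReN -ReD (le_trans (normr_Re_le _))// normcB.
Qed.

Lemma ccvg_Im u l : ccvg u l -> complex.Im (u n) @[n --> \oo] --> complex.Im l.
Proof.
move=> ul; apply/cvgrPdist_le => e e0.
have /cvgrPdist_le/(_ e e0) := ul; apply: filterS => n.
rewrite sub0r normrN ger0_norm ?normc_ge0// => /(le_trans _); apply.
by rewrite -ImN -ImD (le_trans (normr_Im_le _))// normcB.
Qed.

Lemma ccvgP u l : ccvg u l <-> complex.Re (u n) @[n --> \oo] --> complex.Re l /\
  complex.Im (u n) @[n --> \oo] --> complex.Im l.
Proof.
split=> [ul|[ur ui]]; first by split; [exact: ccvg_Re|exact: ccvg_Im].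
apply: (@ccvg_squeeze _ _ (fun n => `|complex.Re (u n) - complex.Re l| + `|complex.Im (u n) - complex.Im l|)).
  by move=> n; rewrite (le_trans (normc_le_ReIm _))// !ReD !ImD ReN ImN.
rewrite -[X in _ --> X](addr0 0); apply: cvgD; apply/norm_cvg0P.
  by rewrite -(subrr (complex.Re l)); apply: cvgB ur (cvg_cst _).
by rewrite -(subrr (complex.Im l)); apply: cvgB ui (cvg_cst _).
Qed.

Lemma ccvg_bounded u l (M : R) : (forall n, normc (u n) <= M) -> ccvg u l -> normc l <= M.
Proof. by move=> uM /ccvg_normc ul; apply: (cvgr_to_le ul); exact: nearW. Qed.

Lemma ccvg_sub_bounded u l (M : R) : (forall n, normc (u n) <= M) -> ccvg u l ->
  forall n, normc (u n - l) <= 2 * M.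
Proof.
move=> uM ul n; rewrite (le_trans (le_normcD _ _))// normcN mulrDl mul1r lerD//.
exact: ccvg_bounded ul.
Qed.

Lemma measurable_fun_ccvg d (T : measurableType d) (f_ : nat -> T -> R[i]) (f : T -> R[i]) :
  (forall n, measurable_fun [set: T] (f_ n)) -> (forall x, ccvg (f_^~ x) (f x)) ->
  measurable_fun [set: T] f.
Proof.
move=> mf cf; apply/measurable_funCP; split.
  apply: (@measurable_fun_cvg _ _ _ _ (fun (n : nat) x => complex.Re (f_ n x))) => //.
    by move=> k; have [] := (measurable_funCP _).1 (mf k).
  by move=> x _; exact: ccvg_Re.
apply: (@measurable_fun_cvg _ _ _ _ (fun (n : nat) x => complex.Im (f_ n x))) => //.
  by move=> k; have [] := (measurable_funCP _).1 (mf k).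
by move=> x _; exact: ccvg_Im.
Qed.

Lemma cintegral_dominated d (T : measurableType d) (mu : {measure set T -> \bar R})
    (f_ : nat -> T -> R[i]) f (h : T -> R) :
  (forall n, measurable_fun [set: T] (f_ n)) ->
  mu.-integrable [set: T] (EFin \o h) -> (forall n x, normc (f_ n x) <= h x) ->
  (forall x, ccvg (f_^~ x) (f x)) ->
  cintegrable mu f /\ ccvg (fun n => cintegral mu (f_ n)) (cintegral mu f).
Proof.
move=> mf_ ih fh cf; have mf := measurable_fun_ccvg mf_ cf.
have fi (k : nat) : cintegrable mu (f_ k) by exact: cintegrable_le ih (fh k).
have fi0 : cintegrable mu f.
  by apply: cintegrable_le ih _ => // x; exact: ccvg_bounded (cf x).
split => //.
have d0 : (\int[mu]_x (normc (f_ k x - f x))%:E @[k --> \oo] --> 0)%E.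
  apply: (@integral_dominated_cvg0 _ _ _ _ _ (fun x => 2 * h x)) => //.
  - move=> k; apply: measurable_fun_normc.
    by have /cintegrable_measurable := cintegrableB (fi k) fi0.
  - by have := integrableZl measurableT 2 ih.
  - by move=> k x; rewrite normc_ge0 (ccvg_sub_bounded _ (cf x)).
apply: (@ccvg_squeeze _ _ (fun n => fine (\int[mu]_x (normc (f_ n x - f x))%:E))).
  move=> k; rewrite -cintegralB//; exact/normc_cintegral_le/cintegrableB.
exact: (fine_cvg d0).
Qed.

End complex_convergence.

(** * Square-integrable functions and their inner product *)

Section square_integrable.
Context {R : realType} {d} {T : measurableType d}.
Variable mu : {measure set T -> \bar R}.
Implicit Types f g h : T -> R[i].
Local Notation Re := (@complex.Re R).
Local Notation Im := (@complex.Im R).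

(** The square of the L2 norm, left extended-valued so that comparison and Fatou's lemma are
    available before finiteness is known. *)
Definition nrm2 f : \bar R := (\int[mu]_x (normc (f x) ^+ 2)%:E)%E.

Definition l2 f := measurable_fun [set: T] f /\ (nrm2 f < +oo)%E.

Definition ip f g : R[i] := cintegral mu (fun x => f x * ((g x)^*)%C).

Lemma nrm2_ge0 f : (0 <= nrm2 f)%E.
Proof. by apply: integral_ge0 => x _; rewrite lee_fin sqr_ge0. Qed.

Lemma nrm2_fin_num f : l2 f -> nrm2 f \is a fin_num.
Proof. by move=> [_ fi]; rewrite ge0_fin_numE// nrm2_ge0. Qed.

Lemma measurable_sqr_normc f : measurable_fun [set: T] f ->
  measurable_fun [set: T] (fun x => normc (f x) ^+ 2).
Proof. by move=> mf; apply: measurable_funX; exact: measurable_fun_normc. Qed.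

Lemma eq_nrm2 f g : (forall x, normc (f x) = normc (g x)) -> nrm2 f = nrm2 g.
Proof. by move=> fg; apply: eq_integral => x _; rewrite fg. Qed.

Lemma le_nrm2 f g : measurable_fun [set: T] f -> measurable_fun [set: T] g ->
  (forall x, normc (f x) <= normc (g x)) -> (nrm2 f <= nrm2 g)%E.
Proof.
move=> mf mg fg; apply: ge0_le_integral => //.
- by move=> x _; rewrite lee_fin sqr_ge0.
- exact/measurable_EFinP/measurable_sqr_normc.
- exact/measurable_EFinP/measurable_sqr_normc.
- by move=> x _; rewrite lee_fin lerXn2r// nnegrE normc_ge0.
Qed.

Lemma integrable_sqr f : l2 f -> mu.-integrable [set: T] (fun x => (normc (f x) ^+ 2)%:E).
Proof.
move=> [mf fi]; apply/integrableP; split.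
  exact/measurable_EFinP/measurable_sqr_normc.
by under eq_integral do rewrite /= ger0_norm ?sqr_ge0//.
Qed.

Lemma l2_le f g : measurable_fun [set: T] f -> l2 g ->
  (forall x, normc (f x) <= normc (g x)) -> l2 f.
Proof.
move=> mf [mg gi] fg; split => //; exact: le_lt_trans (le_nrm2 _ _ fg) gi.
Qed.

Lemma l2_cintegrable_mul f g : l2 f -> l2 g -> cintegrable mu (fun x => f x * g x).
Proof.
move=> lf lg; apply: (@cintegrable_le _ _ _ _ _ (fun x => normc (f x) ^+ 2 + normc (g x) ^+ 2)).
- by apply: measurable_funCM; [case: lf|case: lg].
- by have := integrableD measurableT (integrable_sqr lf) (integrable_sqr lg).
- move=> x; rewrite normcM.
  have := sqr_ge0 (normc (f x) - normc (g x)).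
  have := normc_ge0 (f x); have := normc_ge0 (g x); nra.
Qed.

Lemma l2J f : l2 f -> l2 (fun x => ((f x)^*)%C).
Proof.
move=> [mf fi]; split; first exact: measurable_funCJ.
by rewrite (@eq_nrm2 _ f)// => x; rewrite normcJ.
Qed.

Lemma ip_cintegrable f g : l2 f -> l2 g -> cintegrable mu (fun x => f x * ((g x)^*)%C).
Proof. by move=> lf /l2J; exact: l2_cintegrable_mul. Qed.

Lemma nrm2Z c f : measurable_fun [set: T] f ->
  nrm2 (fun x => c * f x) = ((normc c ^+ 2)%:E * nrm2 f)%E.
Proof.
move=> mf; rewrite /nrm2; under eq_integral do rewrite normcM exprMn EFinM.
rewrite ge0_integralZl_EFin//; last 2 first.
- exact/measurable_EFinP/measurable_sqr_normc.
- by rewrite sqr_ge0.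
by move=> x _; rewrite lee_fin sqr_ge0.
Qed.

Lemma l2Z c f : l2 f -> l2 (fun x => c * f x).
Proof.
move=> lf; have [mf fi] := lf; split; first exact: measurable_funCM.
rewrite nrm2Z// -(fineK (nrm2_fin_num lf)) -EFinM ltry//.
Qed.

Lemma l2_mul_bounded f g (M : R) : l2 f -> measurable_fun [set: T] g ->
  (forall x, normc (g x) <= M) -> l2 (fun x => f x * g x).
Proof.
move=> lf mg gM; have [mf _] := lf; apply: (l2_le _ (l2Z M%:C lf)).
  exact: measurable_funCM.
move=> x; rewrite !normcM mulrC ler_wpM2r ?normc_ge0//.
by rewrite normc_real (le_trans (gM x))// ler_norm.
Qed.

(** Young's inequality [2ab <= e a^2 + b^2 / e] for the cross term. After integration it serves in
    place of the triangle inequality. *)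
Lemma normcD_sqr_le (e : R) (z w : R[i]) : 0 < e ->
  normc (z + w) ^+ 2 <= (1 + e) * normc z ^+ 2 + (1 + e^-1) * normc w ^+ 2.
Proof.
move=> e0; apply: (@le_trans _ _ ((normc z + normc w) ^+ 2)).
  by rewrite lerXn2r ?nnegrE ?addr_ge0 ?normc_ge0// le_normcD.
have ee : e * e^-1 = 1 by rewrite mulfV// gt_eqF.
have := sqr_ge0 (e * normc z - normc w).
move: (normc z) (normc w) => a b h.
have : 0 <= e^-1 * (e * a - b) ^+ 2 by rewrite mulr_ge0// invr_ge0 ltW.
have -> : e^-1 * (e * a - b) ^+ 2 = e * e^-1 * e * a ^+ 2 - 2 * (e * e^-1) * a * b + e^-1 * b ^+ 2 by ring.
rewrite ee; lra.
Qed.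

Lemma nrm2D_le (e : R) f g : 0 < e -> l2 f -> l2 g ->
  (nrm2 (fun x => f x + g x)%R <= (1 + e)%:E * nrm2 f + (1 + e^-1)%:E * nrm2 g)%E.
Proof.
move=> e0 lf lg; have [mf fi] := lf; have [mg gi] := lg.
have e1 : 0 <= 1 + e by lra.
have e2 : 0 <= 1 + e^-1 by rewrite addr_ge0// invr_ge0 ltW.
rewrite -!ge0_integralZl_EFin//;
  try (by move=> x _; rewrite lee_fin sqr_ge0);
  try exact/measurable_EFinP/measurable_sqr_normc.
rewrite -ge0_integralD//;
  try (by move=> x _; rewrite lee_fin mulr_ge0// sqr_ge0);
  try (by apply/measurable_EFinP/measurable_funM => //; exact: measurable_sqr_normc).
apply: ge0_le_integral => //.
- by move=> x _; rewrite lee_fin sqr_ge0.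
- by apply/measurable_EFinP/measurable_sqr_normc/measurable_funCD.
- by apply/measurable_EFinP/measurable_funD; apply/measurable_funM => //; exact: measurable_sqr_normc.
- by move=> x _; rewrite lee_fin normcD_sqr_le.
Qed.

Lemma l2D f g : l2 f -> l2 g -> l2 (fun x => f x + g x).
Proof.
move=> lf lg; split; first by apply: measurable_funCD; [case: lf|case: lg].
apply: le_lt_trans (nrm2D_le (@ltr01 R) lf lg) _.
by rewrite -(fineK (nrm2_fin_num lf)) -(fineK (nrm2_fin_num lg)) -!EFinM -EFinD ltry.
Qed.

Lemma l2B f g : l2 f -> l2 g -> l2 (fun x => f x - g x).
Proof.
move=> lf lg; under eq_fun do rewrite -[X in _ + X]mulN1r.
by apply: l2D => //; exact: l2Z.
Qed.

Lemma l2_0 : l2 (fun=> 0).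
Proof.
split; first exact: measurable_cst.
by rewrite /nrm2 integral0_eq ?ltry// => x _; rewrite normc0 expr0n.
Qed.

Lemma l2_sum I (s : seq I) (F : I -> T -> R[i]) :
  (forall i, l2 (F i)) -> l2 (fun x => \sum_(i <- s) F i x).
Proof.
move=> mF; elim: s => [|i s IH].
  by under eq_fun do rewrite big_nil; exact: l2_0.
by under eq_fun do rewrite big_cons; exact: l2D.
Qed.

Lemma ip_self f : l2 f -> ip f f = (fine (nrm2 f))%:C.
Proof.
move=> lf; apply: complexP => /=.
  by rewrite /Rintegral; congr fine; apply: eq_integral => x _; rewrite mulcJ.
by under eq_Rintegral do rewrite mulcJ/=; rewrite /Rintegral integral0_eq.
Qed.

Lemma ipDl f g h : l2 f -> l2 g -> l2 h ->
  ip (fun x => f x + g x) h = ip f h + ip g h.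
Proof.
move=> lf lg lh; rewrite /ip; under eq_cintegral do rewrite mulrDl.
by rewrite cintegralD//; exact: ip_cintegrable.
Qed.

Lemma ipZl c f h : l2 f -> l2 h -> ip (fun x => c * f x) h = c * ip f h.
Proof.
move=> lf lh; rewrite /ip; under eq_cintegral do rewrite -mulrA.
by rewrite cintegralZ//; exact: ip_cintegrable.
Qed.

Lemma ipC f g : l2 f -> l2 g -> ip g f = ((ip f g)^*)%C.
Proof.
move=> lf lg; rewrite -cintegralJ; last exact: ip_cintegrable.
by apply: eq_cintegral => x; rewrite rmorphM /= conjcK mulrC.
Qed.

Lemma ipDr f g h : l2 f -> l2 g -> l2 h ->
  ip h (fun x => f x + g x) = ip h f + ip h g.
Proof.
by move=> lf lg lh; rewrite (ipC (l2D lf lg) lh) ipDl// rmorphD (ipC lf lh) (ipC lg lh).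
Qed.

Lemma ipZr c f h : l2 f -> l2 h -> ip h (fun x => c * f x) = (c^*)%C * ip h f.
Proof.
by move=> lf lh; rewrite (ipC (l2Z c lf) lh) ipZl// rmorphM (ipC lf lh).
Qed.

Lemma nrm2D f g : l2 f -> l2 g ->
  fine (nrm2 (fun x => f x + g x)) = fine (nrm2 f) + fine (nrm2 g) + 2 * Re (ip f g).
Proof.
move=> lf lg; have lfg := l2D lf lg.
have := ip_self lfg; rewrite ipDl// !ipDr// !ip_self// (ipC lf lg) => /(congr1 Re).
by rewrite !ReD ReJ /=; lra.
Qed.

(** A weighted substitute for Cauchy-Schwarz: the pointwise bound [ab <= e a^2 + b^2 / e] is
    integrated, and the weight [e] can be adapted to whichever factor is small. *)
Lemma normc_ip_le (e : R) f g : 0 < e -> l2 f -> l2 g ->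
  normc (ip f g) <= e * fine (nrm2 f) + e^-1 * fine (nrm2 g).
Proof.
move=> e0 lf lg; apply: le_trans (normc_cintegral_le (ip_cintegrable lf lg)) _.
have i1 := integrableZl measurableT e (integrable_sqr lf).
have i2 := integrableZl measurableT e^-1 (integrable_sqr lg).
rewrite /nrm2 -!RintegralZl//; try exact: integrable_sqr.
rewrite -RintegralD//; apply: le_Rintegral => //.
- exact/integrable_normc/ip_cintegrable.
- by have := integrableD measurableT i1 i2.
move=> x _; rewrite normcM normcJ; move: (normc_ge0 (f x)) (normc_ge0 (g x)).
move: (normc (f x)) (normc (g x)) => a b a0 b0.
have ee : e * e^-1 = 1 by rewrite mulfV// gt_eqF.
have : 0 <= e^-1 * (e * a - b) ^+ 2 by rewrite mulr_ge0 ?sqr_ge0// invr_ge0 ltW.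
have -> : e^-1 * (e * a - b) ^+ 2 = e * e^-1 * e * a ^+ 2 - 2 * (e * e^-1) * a * b + e^-1 * b ^+ 2 by ring.
rewrite ee; nra.
Qed.

Lemma ip_cvg (f_ : nat -> T -> R[i]) f g : (forall k, l2 (f_ k)) -> l2 f -> l2 g ->
  (nrm2 (fun x => f_ k x - f x)%R @[k --> \oo] --> 0)%E ->
  ccvg (fun k => ip (f_ k) g) (ip f g).
Proof.
move=> lf_ lf lg f0; rewrite /ccvg.
have E k : ip (f_ k) g - ip f g = ip (fun x => f_ k x - f x) g.
  rewrite /ip -cintegralB; try exact: ip_cintegrable.
  by apply: eq_cintegral => x; rewrite mulrBl.
under eq_cvg do rewrite E.
have /fine_cvg /= f0' := f0.
set B := fine (nrm2 g); have B0 : 0 <= B by rewrite fine_ge0// nrm2_ge0.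
apply/cvgrPdist_le => e e0.
(* With this weight [a^-1 * B] is at most [e / 2], and the threshold [e / (2 * a)] makes [a] times
   the squared distance at most [e / 2]. The added 1 covers [B = 0]. *)
pose a := 2 * (B + 1) / e.
have a0 : 0 < a by rewrite divr_gt0// mulr_gt0// ltr_wpDl.
have ea : 0 < e / (2 * a) by rewrite divr_gt0// mulr_gt0.
have /cvgrPdist_le/(_ _ ea) := f0'; apply: filterS => k.
rewrite !sub0r !normrN => fk.
rewrite ger0_norm ?normc_ge0//.
apply: le_trans (normc_ip_le a0 (l2B (lf_ k) lf) lg) _.
rewrite -/B; move: fk; rewrite ger0_norm ?fine_ge0 ?nrm2_ge0//.
set u := fine _ => fk.
have : a * u <= e / 2.
  apply: le_trans (ler_wpM2l (ltW a0) fk) _.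
  rewrite [X in X <= _](_ : _ = e / 2)//.
  by field; rewrite !gt_eqF// ltr_wpDl.
have : a^-1 * B <= e / 2.
  rewrite /a invf_div mulrAC ler_pdivrMr ?mulr_gt0 ?ltr_wpDl//.
  rewrite [leRHS](_ : _ = e * (B + 1)); last by field.
  by rewrite ler_wpM2l ?ltW// ltrDl.
by move=> h1 h2; rewrite [leRHS]splitr lerD.
Qed.

(** Expanding [f_ k = (f_ k - f) + f] leaves a cross term with the fixed function [f], which
    vanishes in the limit by [ip_cvg]. *)
Lemma nrm2_cvg (f_ : nat -> T -> R[i]) f : (forall k, l2 (f_ k)) -> l2 f ->
  (nrm2 (fun x => f_ k x - f x)%R @[k --> \oo] --> 0)%E ->
  fine (nrm2 (f_ k)) @[k --> \oo] --> fine (nrm2 f).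
Proof.
move=> lf_ lf f0; have /fine_cvg /= f0' := f0.
have E k : fine (nrm2 (f_ k)) = fine (nrm2 (fun x => f_ k x - f x)) + fine (nrm2 f)
    + 2 * Re (ip (fun x => f_ k x - f x) f).
  rewrite -nrm2D//; last exact: l2B.
  by congr (fine (nrm2 _)); apply/funext => x; rewrite subrK.
have E' k : ip (fun x => f_ k x - f x) f = ip (f_ k) f - ip f f.
  rewrite /ip -cintegralB; try exact: ip_cintegrable.
  by apply: eq_cintegral => x; rewrite mulrBl.
have -> : (fun k => fine (nrm2 (f_ k))) =
    (fun k => (fine (nrm2 (fun x => f_ k x - f x)) + fine (nrm2 f)) +
      2 * (Re (ip (f_ k) f) - Re (ip f f))).
  by apply/funext => k; rewrite E E' ReD ReN.
rewrite [X in _ --> X](_ : _ = (0 + fine (nrm2 f)) + 2 * (Re (ip f f) - Re (ip f f))); last first.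
  by rewrite subrr mulr0 addr0 add0r.
apply: cvgD; first by apply: cvgD => //; exact: cvg_cst.
apply: cvgM; first exact: cvg_cst.
by apply: cvgB; [apply: ccvg_Re; exact: ip_cvg|exact: cvg_cst].
Qed.

(** Lower semicontinuity of the norm under pointwise convergence: it carries norm inequalities to a
    limit when the [f_ k] themselves are not dominated. *)
Lemma nrm2_fatou (f_ : nat -> T -> R[i]) f (c : nat -> \bar R) (l : \bar R) :
  (forall k, measurable_fun [set: T] (f_ k)) ->
  (forall x, ccvg (f_^~ x) (f x)) -> (forall k, nrm2 (f_ k) <= c k)%E ->
  c k @[k --> \oo] --> l -> (nrm2 f <= l)%E.
Proof.
move=> mf_ cf fc cl.
have cfE x : (normc (f_ k x) ^+ 2)%:E @[k --> \oo] --> (normc (f x) ^+ 2)%:E.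
  apply: cvg_EFin; first exact: nearW.
  by apply: (@cvgM _ _ _ _ (fun k => normc (f_ k x)) (fun k => normc (f_ k x))); exact: ccvg_normc.
have := @fatou _ _ _ mu _ measurableT (fun k x => (normc (f_ k x) ^+ 2)%:E).
have mk k : measurable_fun [set: T] (fun x => (normc (f_ k x) ^+ 2)%:E).
  exact/measurable_EFinP/measurable_sqr_normc.
have pk k x : [set: T] x -> (0 <= (normc (f_ k x) ^+ 2)%:E)%E.
  by rewrite lee_fin sqr_ge0.
move=> /(_ mk pk).
have liE x : limn_einf (fun k => (normc (f_ k x) ^+ 2)%:E) = (normc (f x) ^+ 2)%:E.
  by have [-> _] := cvg_limn_einf_sup (cfE x).
under eq_integral do rewrite liE.
move=> /le_trans; apply.
have [<- _] := cvg_limn_einf_sup cl.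
rewrite !limn_einf_lim; apply: lee_lim; [exact: is_cvg_einfs|exact: is_cvg_einfs|].
apply: nearW => k; apply: le_ereal_inf_tmp => _ [j /= kj <-].
by apply: le_trans (fc j); apply: ereal_inf_lbound; exists j.
Qed.

End square_integrable.

(** Polarization: the norm of a sum determines the real part of the inner product, and replacing [f]
    by [- 'i * f] turns imaginary parts into real parts. *)
Lemma isometry_ip {R : realType} d d' (T : measurableType d) (T' : measurableType d')
    (mu : {measure set T -> \bar R}) (nu : {measure set T' -> \bar R})
    (V : (T -> R[i]) -> T' -> R[i]) :
  (forall f, l2 mu f -> l2 nu (V f)) ->
  (forall f, l2 mu f -> nrm2 nu (V f) = nrm2 mu f) ->
  (forall f g, l2 mu f -> l2 mu g -> V (fun x => f x + g x) = (fun z => V f z + V g z)) ->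
  (forall c f, l2 mu f -> V (fun x => c * f x) = (fun z => c * V f z)) ->
  forall f g, l2 mu f -> l2 mu g -> ip nu (V f) (V g) = ip mu f g.
Proof.
move=> Vl2 Viso VD VZ.
have Re_ip f g : l2 mu f -> l2 mu g -> complex.Re (ip nu (V f) (V g)) = complex.Re (ip mu f g).
  move=> lf lg; have := nrm2D lf lg; rewrite -Viso ?VD//; last exact: l2D.
  rewrite nrm2D; [|exact: Vl2|exact: Vl2].
  by rewrite !Viso// => /addrI; apply: mulfI.
move=> f g lf lg; apply: complexP; first exact: Re_ip.
have := Re_ip (fun x => - 'i * f x) g (l2Z _ lf) lg.
by rewrite VZ// !ipZl//; [|exact: Vl2|exact: Vl2]; rewrite !ReM /= !(oppr0, mul0r, sub0r, mulN1r, opprK).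
Qed.

(** * Densities, products and the Gaussian measures *)

Section density.
Context {R : realType} {d} {T : measurableType d}.
Variables (mu : {sigma_finite_measure set T -> \bar R}) (rho : T -> R).
Hypotheses (mrho : measurable_fun [set: T] rho) (rho0 : forall x, 0 <= rho x)
  (rho1 : (\int[mu]_x (rho x)%:E = 1)%E).

(** The properties of [rho] are arguments so that the probability structure can be inferred from the
    term [density mrho rho0 rho1] itself. *)
Definition density of measurable_fun [set: T] rho & (forall x, 0 <= rho x)
  & (\int[mu]_x (rho x)%:E = 1)%E := fun A => (\int[mu]_(x in A) (rho x)%:E)%E.

Local Notation nu := (density mrho rho0 rho1).

Let nu0 : nu set0 = 0%E. Proof. exact: integral_set0. Qed.

Let nu_ge0 A : (0 <= nu A)%E.
Proof. by apply: integral_ge0 => x _; rewrite lee_fin. Qed.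

Let nu_sigma_additive : semi_sigma_additive nu.
Proof.
move=> F mF tF mUF; rewrite /density ge0_integral_bigcup//.
- by apply: is_cvg_ereal_nneg_natsum_cond => k _ _; exact: nu_ge0.
- by apply/measurable_EFinP; exact: (measurable_funTS mrho).
- by move=> x _; rewrite lee_fin.
Qed.

HB.instance Definition _ := isMeasure.Build _ _ _ nu nu0 nu_ge0 nu_sigma_additive.

Let nu_setT : nu [set: T] = 1%E. Proof. exact: rho1. Qed.

HB.instance Definition _ := @Measure_isProbability.Build _ _ R nu nu_setT.

Import HBNNSimple.

(** By monotone convergence both sides are limits along the same increasing simple functions, and
    for indicators the identity is the definition of [density]. *)
Lemma ge0_integral_density (f : T -> \bar R) : (forall x, 0 <= f x)%E ->
  measurable_fun [set: T] f -> (\int[nu]_x f x = \int[mu]_x (f x * (rho x)%:E))%E.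
Proof.
move=> f0 mf; pose h := nnsfun_approx measurableT mf.
have mg : measurable_fun [set: T] (EFin \o rho) by exact/measurable_EFinP.
have hf x : (h k x)%:E @[k --> \oo] --> f x by exact: cvg_nnsfun_approx.
have -> : (\int[nu]_x f x = limn (fun k => \int[nu]_x (h k x)%:E))%E.
  rewrite -monotone_convergence//.
  - by apply: eq_integral => x _; apply/esym/cvg_lim => //; exact: hf.
  - by move=> k; exact/measurable_EFinP.
  - by move=> k x _; rewrite lee_fin.
  - by move=> x _ a b ab; rewrite lee_fin; exact/lefP/nd_nnsfun_approx.
have -> : (\int[mu]_x (f x * (rho x)%:E) = limn (fun k => \int[mu]_x ((h k x)%:E * (rho x)%:E)))%E.
  rewrite -monotone_convergence//.
  - apply: eq_integral => x _; apply/esym/cvg_lim => //.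
    by apply: cvgeZr => //; exact: hf.
  - by move=> k; apply: emeasurable_funM => //; exact/measurable_EFinP.
  - by move=> k x _; rewrite mule_ge0// lee_fin.
  - by move=> x _ a b ab; rewrite lee_wpmul2r ?lee_fin//; exact/lefP/nd_nnsfun_approx.
congr (limn _); apply/funext => k.
under eq_integral do rewrite (fimfunE (h k)) -fsumEFin//.
under [RHS]eq_integral do rewrite (fimfunE (h k)) -fsumEFin//.
rewrite ge0_integral_fsum//; last 2 first.
- by move=> r; exact/measurable_EFinP/measurable_funM.
- by move=> r x _; exact: nnfun_muleindic_ge0.
under [RHS]eq_integral.
  move=> x _; rewrite ge0_mule_fsuml; last by move=> y; exact: nnfun_muleindic_ge0.
  over.
rewrite ge0_integral_fsum//; last 2 first.
- by move=> r; apply: emeasurable_funM => //; exact/measurable_EFinP/measurable_funM.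
- by move=> r x _; rewrite mule_ge0 ?lee_fin//; exact: nnfun_muleindic_ge0.
apply: eq_fsbigr => r rhn.
under eq_integral do rewrite EFinM.
rewrite integralZl_indic_nnsfun//= integral_indic// setIT.
under eq_integral do rewrite EFinM -muleA.
rewrite ge0_integralZl//.
- congr (_ * _)%E.
  transitivity (\int[mu]_(x in h k @^-1` [set r]) (rho x)%:E)%E; first by [].
  by rewrite [LHS]integral_mkcond; apply: eq_integral => x _; rewrite epatch_indic muleC.
- by apply: emeasurable_funM => //; exact/measurable_EFinP.
- by move=> x _; rewrite mule_ge0 ?lee_fin.
- by move: rhn; rewrite inE => -[t _ <-]; rewrite lee_fin.
Qed.

Lemma density_integrableP (f : T -> R) : measurable_fun [set: T] f ->
  nu.-integrable [set: T] (EFin \o f) <->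
  mu.-integrable [set: T] (EFin \o (fun x => f x * rho x)).
Proof.
move=> mf.
have E : (\int[nu]_x `|(f x)%:E| = \int[mu]_x `|(f x * rho x)%:E|)%E.
  rewrite ge0_integral_density//.
    by apply: eq_integral => x _; rewrite /= -EFinM normrM (ger0_norm (rho0 x)).
  by apply: measurableT_comp => //; exact/measurable_EFinP.
split=> /integrableP[_ fi]; apply/integrableP; split.
- by apply/measurable_EFinP; exact: measurable_funM.
- by rewrite -E.
- exact/measurable_EFinP.
- by rewrite /= E.
Qed.

Lemma integral_density (f : T -> R) : measurable_fun [set: T] f ->
  (\int[nu]_x (f x)%:E = \int[mu]_x (f x * rho x)%:E)%E.
Proof.
move=> mf; have mf' : measurable_fun [set: T] (EFin \o f) by exact/measurable_EFinP.
rewrite [LHS]integralE [RHS]integralE !ge0_integral_density//;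
  [|exact: measurable_funeneg|exact: measurable_funepos].
congr (_ - _)%E; apply: eq_integral => x _.
  rewrite !funeposE /= -!EFin_max -EFinM; congr EFin.
  by rewrite maxr_pMl// mul0r.
rewrite !funenegE /= -!EFin_max -EFinM; congr EFin.
by rewrite maxr_pMl// mul0r mulNr.
Qed.

Lemma cintegrable_density (f : T -> R[i]) : measurable_fun [set: T] f ->
  cintegrable nu f <-> cintegrable mu (fun x => f x * (rho x)%:C).
Proof.
move=> mf; have mf' : measurable_fun [set: T] (fun x => f x * (rho x)%:C).
  by apply: measurable_funCM => //; exact: measurable_fun_real.
have E : (\int[nu]_x (normc (f x))%:E = \int[mu]_x (normc (f x * (rho x)%:C))%:E)%E.
  rewrite integral_density; last exact: measurable_fun_normc.
  by apply: eq_integral => x _; rewrite normcM normc_real (ger0_norm (rho0 x)).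
by split=> /cintegrableP[_ fi]; apply/cintegrableP; split; rewrite ?E// -E.
Qed.

Lemma cintegral_density (f : T -> R[i]) : measurable_fun [set: T] f ->
  cintegral nu f = cintegral mu (fun x => f x * (rho x)%:C).
Proof.
move=> /measurable_funCP[mr mi]; apply: complexP => /=; rewrite /Rintegral.
  by rewrite integral_density//; congr fine; apply: eq_integral => x _; rewrite ReM /= mulr0 subr0.
by rewrite integral_density//; congr fine; apply: eq_integral => x _; rewrite ImM /= mulr0 add0r.
Qed.

End density.

Section fine_integrable.
Context {R : realType} {d} {T : measurableType d}.
Variable mu : {measure set T -> \bar R}.

(** Inner integrals in Fubini's theorem are extended-valued, whereas [cintegral] is built on
    real-valued functions. An integrable function is finite almost everywhere, so [fine] alters
    neither integrability nor the integral. *)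
Lemma integrable_fine (F : T -> \bar R) : mu.-integrable [set: T] F ->
  mu.-integrable [set: T] (fun x => (fine (F x))%:E) /\
  (\int[mu]_x (fine (F x))%:E = \int[mu]_x F x)%E.
Proof.
move=> iF; have mF := measurable_int _ iF.
have mf : measurable_fun [set: T] (fun x => (fine (F x))%:E).
  by apply/measurable_EFinP; exact: measurableT_comp.
split.
  apply: le_integrable iF => // x _.
  by case: (F x) => [r| |]//=; rewrite normr0 leey.
apply: ae_eq_integral => //.
have := integrable_ae measurableT iF.
by apply: filterS => x /= h _; rewrite fineK// h.
Qed.

End fine_integrable.

(** * Fubini's theorem for complex-valued functions *)

Section complex_fubini.
Context {R : realType} {d1 d2} {T1 : measurableType d1} {T2 : measurableType d2}.
Variables (m1 : {sigma_finite_measure set T1 -> \bar R})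
  (m2 : {sigma_finite_measure set T2 -> \bar R}).
Implicit Types f : T1 * T2 -> R[i].

Lemma integrable_fubini2 (f : T1 * T2 -> \bar R) :
  (m1 \x m2)%E.-integrable [set: T1 * T2] f ->
  m2.-integrable [set: T2] (fubini_G m1 f).
Proof.
move=> fi; have mf := measurable_int _ fi.
have mg : measurable_fun [set: T2] (fun y => \int[m1]_x `|f (x, y)|)%E.
  apply: (measurable_fun_fubini_tonelli_G (abse \o f)) => //=; exact: measurableT_comp.
apply/integrableP; split; first exact: measurable_fubini_G fi.
apply: le_lt_trans ((integrable21ltyP _ _ mf).1 fi).
apply: ge0_le_integral => //.
  by apply: measurableT_comp => //; exact: measurable_fubini_G fi.
move=> y _; apply: le_abse_integral => //.
exact: (measurableT_comp mf (measurable_pair2 y)).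
Qed.

Lemma cintegrable_prod12P f : measurable_fun [set: T1 * T2] f ->
  cintegrable (m1 \x m2)%E f <->
  (\int[m1]_x \int[m2]_y (normc (f (x, y)))%:E < +oo)%E.
Proof.
move=> mf.
have E : (\int[m1 \x m2]_z (normc (f z))%:E =
    \int[m1]_x \int[m2]_y (normc (f (x, y)))%:E)%E.
  rewrite (fubini_tonelli1 (fun z => (normc (f z))%:E))//.
    exact/measurable_EFinP/measurable_fun_normc.
  by move=> z; rewrite lee_fin normc_ge0.
split=> [/cintegrableP[_]|fi]; first by rewrite E.
by apply/cintegrableP; split => //; rewrite E.
Qed.

Lemma cfubini1 f : cintegrable (m1 \x m2)%E f ->
  [/\ {ae m1, forall x, cintegrable m2 (fun y => f (x, y))},
      cintegrable m1 (fun x => cintegral m2 (fun y => f (x, y))) &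
      cintegral m1 (fun x => cintegral m2 (fun y => f (x, y))) =
      cintegral (m1 \x m2)%E f].
Proof.
move=> [fr fi].
have [ir er] := integrable_fine (integrable_fubini_F fr).
have [ii ei] := integrable_fine (integrable_fubini_F fi).
split; last 2 first.
- by split.
- apply: complexP; rewrite /cintegral /=.
    by rewrite /Rintegral; congr fine; rewrite er integral12_prod_meas1.
  by rewrite /Rintegral; congr fine; rewrite ei integral12_prod_meas1.
- by apply: filterS2 (ae_integrable1 fr) (ae_integrable1 fi) => x /= *; split.
Qed.

Lemma cfubini2 f : cintegrable (m1 \x m2)%E f ->
  [/\ {ae m2, forall y, cintegrable m1 (fun x => f (x, y))},
      cintegrable m2 (fun y => cintegral m1 (fun x => f (x, y))) &
      cintegral m2 (fun y => cintegral m1 (fun x => f (x, y))) =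
      cintegral (m1 \x m2)%E f].
Proof.
move=> [fr fi].
have [ir er] := integrable_fine (integrable_fubini2 fr).
have [ii ei] := integrable_fine (integrable_fubini2 fi).
split; last 2 first.
- by split.
- apply: complexP; rewrite /cintegral /=.
    by rewrite /Rintegral; congr fine; rewrite er integral21_prod_meas1.
  by rewrite /Rintegral; congr fine; rewrite ei integral21_prod_meas1.
- by apply: filterS2 (ae_integrable2 fr) (ae_integrable2 fi) => x /= *; split.
Qed.

Lemma cfubini f : cintegrable (m1 \x m2)%E f ->
  cintegral m1 (fun x => cintegral m2 (fun y => f (x, y))) =
  cintegral m2 (fun y => cintegral m1 (fun x => f (x, y))).
Proof. by move=> fi; have [_ _ ->] := cfubini1 fi; have [_ _ ->] := cfubini2 fi. Qed.

Lemma cintegrable_prod_le f (h1 : T1 -> R) (h2 : T2 -> R) :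
  measurable_fun [set: T1 * T2] f ->
  m1.-integrable [set: T1] (EFin \o h1) -> m2.-integrable [set: T2] (EFin \o h2) ->
  (forall x, 0 <= h1 x) -> (forall y, 0 <= h2 y) ->
  (forall x y, normc (f (x, y)) <= h1 x * h2 y) -> cintegrable (m1 \x m2)%E f.
Proof.
move=> mf i1 i2 h10 h20 fh; apply/cintegrable_prod12P => //.
have mh1 := measurable_int _ i1; have mh2 := measurable_int _ i2.
apply: (@le_lt_trans _ _ (\int[m1]_x ((h1 x)%:E * \int[m2]_y (h2 y)%:E))%E).
  apply: ge0_le_integral => //.
  - by move=> x _; apply: integral_ge0 => y _; rewrite lee_fin normc_ge0.
  - apply: (@measurable_fun_fubini_tonelli_F _ _ _ _ _ m2 (fun z => (normc (f z))%:E)).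
      exact/measurable_EFinP/measurable_fun_normc.
    by move=> z; rewrite lee_fin normc_ge0.
  - by apply: emeasurable_funM => //; exact: measurable_cst.
  - move=> x _; rewrite -ge0_integralZl//; last 2 first.
      by move=> y _; rewrite lee_fin.
      by rewrite lee_fin.
    apply: ge0_le_integral => //.
    + by move=> y _; rewrite lee_fin normc_ge0.
    + by apply/measurable_EFinP/measurable_fun_normc/measurableT_comp.
    + by apply: emeasurable_funM => //; exact: measurable_cst.
    + by move=> y _; rewrite -EFinM lee_fin.
have fin1 := integrable_fin_num measurableT i1.
have fin2 := integrable_fin_num measurableT i2.
rewrite -(fineK fin2) ge0_integralZr//; last 2 first.
  by move=> x _; rewrite lee_fin.
  by rewrite lee_fin fine_ge0// integral_ge0// => y _; rewrite lee_fin.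
by rewrite -(fineK fin1) -EFinM ltry.
Qed.

End complex_fubini.

(** * Integration against power measures, one coordinate at a time *)

Section power_measure_theory.
Context {R : realType} {d} {T : measurableType d}.
Variable mu : {sigma_finite_measure set T -> \bar R}.

Lemma ge0_integral_powerS n (f : 'rV[T]_n.+1 -> \bar R) :
  measurable_fun [set: 'rV[T]_n.+1] f -> (forall v, 0 <= f v)%E ->
  (\int[power_measure mu n.+1]_v f v =
   \int[mu]_x \int[power_measure mu n]_v f (cons_rV (x, v)))%E.
Proof.
move=> mf f0.
have -> : (\int[power_measure mu n.+1]_v f v =
    \int[pushforward (mu \x power_measure mu n)%E (@cons_rV _ T n)]_v f v)%E by [].
rewrite (ge0_integral_pushforward (measurable_cons_rV (n := n)))//.
rewrite preimage_setT (fubini_tonelli1 (f \o @cons_rV _ T n))//.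
- exact: (measurableT_comp mf (measurable_cons_rV (n := n))).
- by move=> p /=; exact: f0.
Qed.

Lemma ge0_integral_power0 (f : 'rV[T]_0 -> \bar R) :
  measurable_fun [set: 'rV[T]_0] f ->
  (\int[power_measure mu 0]_v f v = f point)%E.
Proof.
move=> mf; have -> : (\int[power_measure mu 0]_v f v =
    \int[\d_(point : 'rV[T]_0)]_v f v)%E by [].
by rewrite integral_dirac// diracT mul1e.
Qed.

Lemma power_measure_setT n : mu [set: T] = 1%E -> power_measure mu n [set: 'rV[T]_n] = 1%E.
Proof.
move=> mu1; have := @power_measure_box _ _ _ mu n (fun=> [set: T]) (fun=> measurableT).
rewrite big1// => <-; congr (_ _).
by apply/seteqP.
Qed.

Lemma cintegrable_powerSP n (f : 'rV[T]_n.+1 -> R[i]) :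
  measurable_fun [set: 'rV[T]_n.+1] f ->
  cintegrable (power_measure mu n.+1) f <->
  cintegrable (mu \x power_measure mu n)%E (f \o @cons_rV _ T n).
Proof.
move=> mf.
have mfc : measurable_fun setT (f \o @cons_rV _ T n).
  exact: (measurableT_comp mf (measurable_cons_rV (n := n))).
rewrite cintegrable_prod12P//=.
have E := @ge0_integral_powerS n (fun v => (normc (f v))%:E).
split=> [/cintegrableP[_]|fi]; first rewrite E//.
- exact/measurable_EFinP/measurable_fun_normc.
- by move=> v; rewrite lee_fin normc_ge0.
apply/cintegrableP; split => //; rewrite E//.
- exact/measurable_EFinP/measurable_fun_normc.
- by move=> v; rewrite lee_fin normc_ge0.
Qed.

Lemma cintegral_powerS n (f : 'rV[T]_n.+1 -> R[i]) :
  cintegrable (power_measure mu n.+1) f ->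
  cintegral (power_measure mu n.+1) f =
  cintegral (mu \x power_measure mu n)%E (f \o @cons_rV _ T n).
Proof.
move=> fi; have mf := cintegrable_measurable fi.
have [ir ii] := (cintegrable_powerSP mf).1 fi.
have /measurable_funCP[mr mi] := mf.
apply: complexP => /=; rewrite /Rintegral; congr fine.
  have -> : (\int[power_measure mu n.+1]_v (complex.Re (f v))%:E =
    \int[pushforward (mu \x power_measure mu n)%E (@cons_rV _ T n)]_v (complex.Re (f v))%:E)%E by [].
  rewrite (integral_pushforward (measurable_cons_rV (n := n)))//; exact/measurable_EFinP.
have -> : (\int[power_measure mu n.+1]_v (complex.Im (f v))%:E =
  \int[pushforward (mu \x power_measure mu n)%E (@cons_rV _ T n)]_v (complex.Im (f v))%:E)%E by [].
rewrite (integral_pushforward (measurable_cons_rV (n := n)))//; exact/measurable_EFinP.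
Qed.

Lemma cintegral_power0 (f : 'rV[T]_0 -> R[i]) : measurable_fun [set: 'rV[T]_0] f ->
  cintegrable (power_measure mu 0) f /\ cintegral (power_measure mu 0) f = f point.
Proof.
move=> mf; have /measurable_funCP[mr mi] := mf; split.
  apply/cintegrableP; split => //; rewrite ge0_integral_power0 ?ltry//.
  exact/measurable_EFinP/measurable_fun_normc.
apply: complexP => /=; rewrite /Rintegral ge0_integral_power0//; exact/measurable_EFinP.
Qed.

Lemma prod_cons_rV n (h : 'I_n.+1 -> T -> R[i]) x (v : 'rV[T]_n) :
  \prod_j h j ((cons_rV (x, v)) ord0 j) =
  h ord0 x * \prod_j h (lift ord0 j) (v ord0 j).
Proof.
rewrite big_ord_recl; congr (_ * _); first by rewrite mxE unlift_none.
by apply: eq_bigr => j _; rewrite mxE liftK.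
Qed.

Lemma measurable_prod_coord n (h : 'I_n -> T -> R[i]) :
  (forall j, measurable_fun [set: T] (h j)) ->
  measurable_fun [set: 'rV[T]_n] (fun v => \prod_j h j (v ord0 j)).
Proof.
move=> mh; apply: measurable_fun_cprod => j.
exact: (measurableT_comp (mh j) (measurable_coord _)).
Qed.

Lemma cintegral_power_prod n (h : 'I_n -> T -> R[i]) :
  (forall j, cintegrable mu (h j)) ->
  cintegrable (power_measure mu n) (fun v => \prod_j h j (v ord0 j)) /\
  cintegral (power_measure mu n) (fun v => \prod_j h j (v ord0 j)) =
  \prod_j cintegral mu (h j).
Proof.
elim: n h => [|n IH] h hi.
  have [|ci ->] := @cintegral_power0 (fun v => \prod_j h j (v ord0 j)).
    by under eq_fun do rewrite big_ord0; exact: measurable_cst.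
  by split => //; rewrite !big_ord0.
have mh j : measurable_fun [set: T] (h j) by exact: cintegrable_measurable (hi j).
have [ti te] := IH (fun j => h (lift ord0 j)) (fun j => hi _).
have ci : cintegrable (power_measure mu n.+1) (fun v => \prod_j h j (v ord0 j)).
  apply/cintegrable_powerSP; first exact: measurable_prod_coord.
  apply: (@cintegrable_prod_le _ _ _ _ _ mu (power_measure mu n) _
    (fun x => normc (h ord0 x)) (fun v : 'rV[T]_n => normc (\prod_j h (lift ord0 j) (v ord0 j)))).
  - exact: (measurableT_comp (measurable_prod_coord mh) (measurable_cons_rV (n := n))).
  - exact: integrable_normc.
  - exact: integrable_normc.
  - by move=> x; exact: normc_ge0.
  - by move=> x; exact: normc_ge0.
  - by move=> x v; rewrite /= prod_cons_rV normcM.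
split => //; rewrite cintegral_powerS//.
have [_ _ <-] := cfubini1 ((cintegrable_powerSP (cintegrable_measurable ci)).1 ci).
rewrite big_ord_recl -te.
under eq_cintegral do (under eq_cintegral do rewrite /= prod_cons_rV; rewrite cintegralZ// mulrC).
by rewrite cintegralZ// mulrC.
Qed.

End power_measure_theory.

Section power_density.
Context {R : realType} {d} {T : measurableType d}.
Variables (mu : {sigma_finite_measure set T -> \bar R}) (rho : T -> R).
Hypotheses (mrho : measurable_fun [set: T] rho) (rho0 : forall x, 0 <= rho x)
  (rho1 : (\int[mu]_x (rho x)%:E = 1)%E).
Local Notation nu := (density mrho rho0 rho1).

Lemma measurable_prod_rho n :
  measurable_fun [set: 'rV[T]_n] (fun v => \prod_j rho (v ord0 j)).
Proof.
apply: measurable_prod => j _.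
exact: (measurableT_comp mrho (measurable_coord _)).
Qed.

Lemma prod_rho_cons n x (v : 'rV[T]_n) :
  \prod_j rho ((cons_rV (x, v)) ord0 j) = rho x * \prod_j rho (v ord0 j).
Proof.
rewrite big_ord_recl; congr (_ * _); first by rewrite mxE unlift_none.
by apply: eq_bigr => j _; rewrite mxE liftK.
Qed.

(** Induction on the number of coordinates. This is how a Gaussian density on the whole space is
    recognized as a product of Gaussian measures in the coordinates. *)
Lemma ge0_integral_power_density n (f : 'rV[T]_n -> \bar R) :
  measurable_fun [set: 'rV[T]_n] f -> (forall v, 0 <= f v)%E ->
  (\int[power_measure nu n]_v f v =
   \int[power_measure mu n]_v (f v * (\prod_j rho (v ord0 j))%:E))%E.
Proof.
elim: n f => [|n IH] f mf f0.
  rewrite !ge0_integral_power0//; last first.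
    by apply: emeasurable_funM => //; by apply/measurable_EFinP; exact: measurable_prod_rho.
  by rewrite big_ord0 mule1.
have mfr : measurable_fun [set: 'rV[T]_n.+1] (fun v => f v * (\prod_j rho (v ord0 j))%:E)%E.
  by apply: emeasurable_funM => //; by apply/measurable_EFinP; exact: measurable_prod_rho.
have p0 m (v : 'rV[T]_m) : 0 <= \prod_j rho (v ord0 j) by apply: prodr_ge0.
have fr0 v : (0 <= f v * (\prod_j rho (v ord0 j))%:E)%E.
  by rewrite mule_ge0// lee_fin.
rewrite !ge0_integral_powerS//.
have mfc : measurable_fun setT (f \o @cons_rV _ T n).
  exact: (measurableT_comp mf (measurable_cons_rV (n := n))).
rewrite ge0_integral_density//; last 2 first.
- by move=> x; apply: integral_ge0.
- by apply: (measurable_fun_fubini_tonelli_F (f \o @cons_rV _ T n)) => //= p; exact: f0.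
apply: eq_integral => x _.
have mx : measurable_fun setT (fun v => f (cons_rV (x, v))).
  exact: (measurableT_comp mfc (measurable_pair1 x)).
rewrite IH// muleC -ge0_integralZl//; last 3 first.
- by apply: emeasurable_funM => //; by apply/measurable_EFinP; exact: measurable_prod_rho.
- by move=> v _; rewrite mule_ge0// lee_fin.
- by rewrite lee_fin.
by apply: eq_integral => v _; rewrite prod_rho_cons EFinM muleCA.
Qed.

Lemma power_densityE n (A : set 'rV[T]_n) : measurable A ->
  (power_measure nu n A =
   \int[power_measure mu n]_(v in A) (\prod_j rho (v ord0 j))%:E)%E.
Proof.
move=> mA; have := @ge0_integral_power_density n (EFin \o \1_A).
rewrite integral_indic// setIT => ->//.
- rewrite [RHS]integral_mkcond; apply: eq_integral => v _.
  by rewrite epatch_indic muleC.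
- exact/measurable_EFinP.
- by move=> v; rewrite lee_fin.
Qed.

End power_density.

Section measure_preserving.
Context {R : realType} {d} {T : measurableType d}.
Variables (mu : {measure set T -> \bar R}) (tau : T -> T).
Hypotheses (mtau : measurable_fun [set: T] tau)
  (pres : forall A, measurable A -> mu (tau @^-1` A) = mu A).

Lemma integral_preserving_ge0 (f : T -> \bar R) : measurable_fun [set: T] f ->
  (forall x, 0 <= f x)%E -> (\int[mu]_x f (tau x) = \int[mu]_x f x)%E.
Proof.
move=> mf f0; transitivity (\int[pushforward mu tau]_x f x)%E.
  by rewrite ge0_integral_pushforward.
by apply: eq_measure_integral => A mA _; exact: pres.
Qed.

Lemma cintegrable_preserving (f : T -> R[i]) :
  cintegrable mu f -> cintegrable mu (f \o tau).
Proof.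
move=> /cintegrableP[mf fi]; apply/cintegrableP; split; first exact: measurableT_comp.
rewrite (integral_preserving_ge0 (f := fun x => (normc (f x))%:E))//.
- exact/measurable_EFinP/measurable_fun_normc.
- by move=> x; rewrite lee_fin normc_ge0.
Qed.

Lemma cintegral_preserving (f : T -> R[i]) : cintegrable mu f ->
  cintegral mu (f \o tau) = cintegral mu f.
Proof.
move=> fi; have [gr gi] := cintegrable_preserving fi.
have [fr fim] := fi.
have E (g : T -> R) : mu.-integrable setT (fun x => (g x)%:E) ->
    mu.-integrable setT (fun x => (g (tau x))%:E) ->
    (\int[mu]_x g (tau x) = \int[mu]_x g x)%R.
  move=> ig igt; rewrite /Rintegral; congr fine.
  transitivity (\int[pushforward mu tau]_x (g x)%:E)%E.
    by rewrite (integral_pushforward mtau)//; exact: measurable_int ig.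
  by apply: eq_measure_integral => A mA _; exact: pres.
by apply: complexP; rewrite /cintegral /=; apply: E.
Qed.

End measure_preserving.

(** * Translation and rotation invariance of Lebesgue measure *)

Section lebesgue_invariance.
Context {R : realType}.
Implicit Types f : R[i] -> \bar R.

(** The translated measure agrees with Lebesgue measure on the intervals []a, b]], and these
    determine it. *)
Lemma ge0_integral_shift (f : R -> \bar R) c : measurable_fun [set: R] f ->
  (forall x, 0 <= f x)%E ->
  (\int[@lebesgue_R R]_x f (x + c)%R = \int[@lebesgue_R R]_x f x)%E.
Proof.
move=> mf f0.
apply: (@integral_preserving_ge0 _ _ _ (@lebesgue_R R) (fun x => x + c)) => //.
  exact: measurable_funD.
move=> A mA.
suff : pushforward lebesgue_measure ((fun x => x + c) : _ -> measurableTypeR R) A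
    = lebesgue_measure A by [].
apply/esym/lebesgue_measure_unique => //=.
  by apply: measurable_funD.
move=> mc _ [[a b]] _ <-; rewrite /pushforward.
rewrite (_ : _ @^-1` _ = `](a - c), (b - c)]%classic); last first.
  by apply/seteqP; split => x /=; rewrite !in_itv /= ltrBlDr lerBrDr.
rewrite !lebesgue_measure_itv/= !lte_fin ltrD2r; case: ifP => // _.
by rewrite -!EFinB; congr EFin; ring.
Qed.

Lemma ge0_integral_lebesgue_C12 f : measurable_fun [set: R[i]] f ->
  (forall z, 0 <= f z)%E ->
  (\int[@lebesgue_C R]_z f z =
   \int[@lebesgue_R R]_x \int[@lebesgue_R R]_y f (x +i* y)%R)%E.
Proof.
move=> mf f0.
transitivity (\int[pushforward (@lebesgue_R R \x @lebesgue_R R)%E (@complex_of R)]_z f z)%E.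
  by [].
rewrite (ge0_integral_pushforward (@measurable_complex_of R))// preimage_setT.
by rewrite (fubini_tonelli1 (f \o @complex_of R)
  (measurableT_comp mf (@measurable_complex_of R)) (fun p => f0 _)).
Qed.

Lemma ge0_integral_lebesgue_C21 f : measurable_fun [set: R[i]] f ->
  (forall z, 0 <= f z)%E ->
  (\int[@lebesgue_C R]_z f z =
   \int[@lebesgue_R R]_y \int[@lebesgue_R R]_x f (x +i* y)%R)%E.
Proof.
move=> mf f0; rewrite (ge0_integral_lebesgue_C12 mf f0).
by rewrite (fubini_tonelli (f \o @complex_of R)
  (measurableT_comp mf (@measurable_complex_of R)) (fun p => f0 _)).
Qed.

Lemma measurable_Complex d (T : measurableType d) (a b : T -> R) :
  measurable_fun [set: T] a -> measurable_fun [set: T] b ->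
  measurable_fun [set: T] (fun x => a x +i* b x).
Proof. by move=> ma mb; apply/measurable_funCP. Qed.

(** For a fixed imaginary part a horizontal shear is a translation of the real part, so integrating
    first in [x] reduces it to [ge0_integral_shift]. *)
Lemma ge0_integral_shearx f t : measurable_fun [set: R[i]] f ->
  (forall z, 0 <= f z)%E ->
  (\int[@lebesgue_C R]_z f ((complex.Re z + t * complex.Im z) +i* complex.Im z)%R =
   \int[@lebesgue_C R]_z f z)%E.
Proof.
move=> mf f0; rewrite (ge0_integral_lebesgue_C21 mf f0).
rewrite ge0_integral_lebesgue_C21; [| |by move=> z; exact: f0]; last first.
  apply: (measurableT_comp mf); apply: measurable_Complex; last exact: measurable_Im.
  apply: measurable_funD; first exact: measurable_Re.
  by apply: measurable_funM => //; exact: measurable_Im.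
apply: eq_integral => y _ /=.
apply: (@ge0_integral_shift (fun x => f (x +i* y)) (t * y)) => //.
apply: (measurableT_comp mf); exact: measurable_Complex.
Qed.

Lemma ge0_integral_sheary f t : measurable_fun [set: R[i]] f ->
  (forall z, 0 <= f z)%E ->
  (\int[@lebesgue_C R]_z f (complex.Re z +i* (complex.Im z + t * complex.Re z))%R =
   \int[@lebesgue_C R]_z f z)%E.
Proof.
move=> mf f0; rewrite (ge0_integral_lebesgue_C12 mf f0).
rewrite ge0_integral_lebesgue_C12; [| |by move=> z; exact: f0]; last first.
  apply: (measurableT_comp mf); apply: measurable_Complex; first exact: measurable_Re.
  apply: measurable_funD; first exact: measurable_Im.
  by apply: measurable_funM => //; exact: measurable_Re.
apply: eq_integral => x _ /=.
apply: (@ge0_integral_shift (fun y => f (x +i* y)) (t * x)) => //.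
apply: (measurableT_comp mf); exact: measurable_Complex.
Qed.

Lemma measurable_mulCl (u : R[i]) : measurable_fun [set: R[i]] (fun z => u * z).
Proof. by apply: measurable_funCM => //; exact: measurable_id. Qed.

(* A rotation is a product of three shears. *)
Lemma ge0_integral_rotation f (u : R[i]) : normc u = 1 ->
  measurable_fun [set: R[i]] f -> (forall z, 0 <= f z)%E ->
  (\int[@lebesgue_C R]_z f (u * z)%R = \int[@lebesgue_C R]_z f z)%E.
Proof.
have rot g (p q : R) : p ^+ 2 + q ^+ 2 = 1 -> q != 0 ->
    measurable_fun [set: R[i]] g -> (forall z, 0 <= g z)%E ->
    (\int[@lebesgue_C R]_z g ((p +i* q) * z)%R = \int[@lebesgue_C R]_z g z)%E.
  move=> pq q0 mg g0.
  (* For [p + i q = e^{i theta}] this is [- tan (theta / 2)]: the rotation is the horizontal shear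
     by [a], then the vertical shear by [q], then the horizontal shear by [a] again. *)
  set a := (p - 1) / q.
  have aq : a * q = p - 1 by rewrite /a divfK.
  have ap : a * (1 + p) = - q.
    by apply: (mulIf q0); rewrite mulrAC aq; lra.
  pose s1 (z : R[i]) := (complex.Re z + a * complex.Im z) +i* complex.Im z.
  pose s2 (z : R[i]) := complex.Re z +i* (complex.Im z + q * complex.Re z).
  have ms1 : measurable_fun setT s1.
    apply: measurable_Complex; last exact: measurable_Im.
    apply: measurable_funD; first exact: measurable_Re.
    by apply: measurable_funM => //; exact: measurable_Im.
  have ms2 : measurable_fun setT s2.
    apply: measurable_Complex; first exact: measurable_Re.
    apply: measurable_funD; first exact: measurable_Im.
    by apply: measurable_funM => //; exact: measurable_Re.
  have E z : (p +i* q) * z = s1 (s2 (s1 z)).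
    case: z => x y; apply: complexP => /=.
      transitivity ((1 + a * q) * x + (a * (1 + (1 + a * q))) * y); last by ring.
      by rewrite aq (_ : 1 + (p - 1) = p) ?ap; ring.
    transitivity ((1 + a * q) * y + q * x); last by ring.
    by rewrite aq; ring.
  under eq_integral do rewrite E.
  have m1 : measurable_fun setT (g \o s1) by exact: measurableT_comp.
  have m2 : measurable_fun setT (g \o s1 \o s2) by exact: measurableT_comp.
  rewrite (@ge0_integral_shearx (g \o s1 \o s2))//; last by move=> z; exact: g0.
  rewrite (@ge0_integral_sheary (g \o s1))//; last by move=> z; exact: g0.
  by rewrite (@ge0_integral_shearx g).
case: u => p q /= /(congr1 (fun x => x ^+ 2)).
rewrite sqr_sqrtr ?addr_ge0 ?sqr_ge0// expr1n => pq mf f0.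
have [q0|q0] := eqVneq q 0; last exact: rot.
move: pq; rewrite q0 expr0n addr0 => /eqP; rewrite sqrf_eq1 => /orP[] /eqP ->.
  by apply: eq_integral => z _; congr f; case: z => x y; apply: complexP => /=; ring.
(* The shears require division by [q], so the rotation by [-1] is performed as two rotations by
   ['i], for which [q = 1]. *)
have ii (z : R[i]) : ((-1) +i* 0) * z = 'i * ('i * z).
  by case: z => x y; apply: complexP => /=; ring.
under eq_integral do rewrite ii.
have h : 0 ^+ 2 + 1 ^+ 2 = 1 :> R by rewrite expr0n add0r expr1n.
rewrite (@rot (fun z => f ('i * z)) 0 1)//; first by rewrite rot.
exact: measurableT_comp (measurable_mulCl _).
Qed.

Lemma ge0_integral_translation f (a : R[i]) : measurable_fun [set: R[i]] f ->
  (forall z, 0 <= f z)%E ->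
  (\int[@lebesgue_C R]_z f (z + a)%R = \int[@lebesgue_C R]_z f z)%E.
Proof.
case: a => p q mf f0; rewrite (ge0_integral_lebesgue_C12 mf f0).
rewrite ge0_integral_lebesgue_C12; [| |by move=> z; exact: f0]; last first.
  by apply: (measurableT_comp mf); apply: measurable_funCD.
rewrite -(@ge0_integral_shift (fun x => \int[@lebesgue_R R]_y f (x +i* y)%R)%E p); last 2 first.
- exact: (measurable_fun_fubini_tonelli_F (f \o @complex_of R)
    (measurableT_comp mf (@measurable_complex_of R)) (fun p => f0 _)).
- by move=> x; exact: integral_ge0.
apply: eq_integral => x _ /=.
apply: (@ge0_integral_shift (fun y => f ((x + p) +i* y)) q) => //.
by apply: (measurableT_comp mf); exact: measurable_Complex.
Qed.

End lebesgue_invariance.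

Section gaussian_measures.
Context {R : realType}.

(* [lebesgue_R] and [lebesgue_measure] live on measurable types with different displays. *)
Lemma ge0_integral_lebesgue_R (f : R -> \bar R) : measurable_fun [set: R] f ->
  (forall x, 0 <= f x)%E ->
  (\int[@lebesgue_R R]_x f x = \int[@lebesgue_measure R]_x f x)%E.
Proof.
move=> mf f0.
have mid : measurable_fun [set: measurableTypeR R] (idfun : measurableTypeR R -> R).
  by move=> _ Y mY; rewrite setTI.
have := @ge0_integral_pushforward _ _ (measurableTypeR R) R R _ mid (@lebesgue_measure R) setT f measurableT mf.
by rewrite preimage_setT /= => <-.
Qed.

Lemma lebesgue_C_translation (a : R[i]) A : measurable A ->
  @lebesgue_C R ((fun z => z + a) @^-1` A) = @lebesgue_C R A.
Proof.
move=> mA.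
have mt : measurable_fun [set: R[i]] (fun z => z + a).
  by apply: measurable_funCD => //; exact: measurable_id.
have E B : measurable B -> (\int[@lebesgue_C R]_z (\1_B z)%:E = @lebesgue_C R B)%E.
  by move=> mB; rewrite integral_indic// setIT.
rewrite -!E//; last by rewrite -[X in measurable X]setTI; exact: mt.
apply: (@ge0_integral_translation R (fun z => (\1_A z)%:E) a).
- exact/measurable_EFinP.
- by move=> z; rewrite lee_fin.
Qed.

End gaussian_measures.

(** * Gaussian probability measures on the line and on the plane *)

Section gaussian_densities.
Context {R : realType}.
Variables (k : R) (k0 : 0 < k).

(** The centred normal density of variance [1 / (2 k)]. On the line [k = 2] gives the factors of mu
    and [k = 1] a dominating density; on the plane [k = 1] gives the factors of the Fock measure,
    [k = 1 / 2] a dominating density, and [k = 2] the square of the measure on the line. *)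
Definition gaussR_pdf (x : R) : R := Num.sqrt (k / pi) * expR (- (k * x ^+ 2)).

Lemma gaussR_pdf_gt0 x : 0 < gaussR_pdf x.
Proof. by rewrite mulr_gt0 ?expR_gt0// sqrtr_gt0 divr_gt0// pi_gt0. Qed.

Lemma gaussR_pdf_ge0 x : 0 <= gaussR_pdf x.
Proof. exact/ltW/gaussR_pdf_gt0. Qed.

Lemma measurable_gaussR_pdf : measurable_fun [set: R] gaussR_pdf.
Proof.
apply: measurable_funM => //; apply: measurableT_comp => //.
apply: measurable_funN; apply: measurable_funM => //; exact: measurable_funX.
Qed.

Lemma integral_gaussR_pdf : (\int[@lebesgue_R R]_x (gaussR_pdf x)%:E = 1)%E.
Proof.
have k2 : 0 < 2 * k by rewrite mulr_gt0.
(* The standard deviation for which the normal density with mean 0 is [gaussR_pdf]. *)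
pose s := (Num.sqrt (2 * k))^-1.
have s0 : s != 0 by rewrite invr_neq0// gt_eqF// sqrtr_gt0.
have s2 : s ^+ 2 = (2 * k)^-1 by rewrite exprVn sqr_sqrtr// ltW.
rewrite -(@integral_normal_pdf R 0 s) ge0_integral_lebesgue_R; last 2 first.
- by apply/measurable_EFinP; exact: measurable_gaussR_pdf.
- by move=> x; rewrite lee_fin gaussR_pdf_ge0.
apply: eq_integral => x _; rewrite normal_pdfE//; congr EFin.
rewrite /gaussR_pdf /normal_peak /normal_fun subr0 -sqrtrV; last first.
  by rewrite mulrn_wge0// mulr_ge0 ?sqr_ge0// pi_ge0.
rewrite s2; congr (Num.sqrt _ * expR _).
  by rewrite (_ : _ *+ 2 = pi / k) ?invf_div//; field; rewrite gt_eqF.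
rewrite (_ : (2 * k)^-1 *+ 2 = k^-1); last by field; rewrite gt_eqF.
by rewrite invrK; ring.
Qed.

Definition gaussR := density measurable_gaussR_pdf gaussR_pdf_ge0 integral_gaussR_pdf.
HB.instance Definition _ := Probability.on gaussR.

Definition gaussC_pdf (z : R[i]) : R := k / pi * expR (- (k * normc z ^+ 2)).

Lemma gaussC_pdfE (x y : R) : gaussC_pdf (x +i* y) = gaussR_pdf x * gaussR_pdf y.
Proof.
rewrite /gaussC_pdf /gaussR_pdf sqr_normc_ReIm /= mulrACA -expr2 sqr_sqrtr.
  by rewrite -expRD mulrDr opprD.
by rewrite divr_ge0 ?ltW// pi_gt0.
Qed.

Lemma gaussC_pdf_ge0 z : 0 <= gaussC_pdf z.
Proof. by rewrite mulr_ge0 ?expR_ge0// divr_ge0 ?pi_ge0// ltW. Qed.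

Lemma measurable_gaussC_pdf : measurable_fun [set: R[i]] gaussC_pdf.
Proof.
apply: measurable_funM => //; apply: measurableT_comp => //.
apply: measurable_funN; apply: measurable_funM => //; apply: measurable_funX.
by apply: measurable_fun_normc; exact: measurable_id.
Qed.

Lemma integral_gaussC_pdf : (\int[@lebesgue_C R]_z (gaussC_pdf z)%:E = 1)%E.
Proof.
rewrite ge0_integral_lebesgue_C12; last 2 first.
- by apply/measurable_EFinP; exact: measurable_gaussC_pdf.
- by move=> z; rewrite lee_fin gaussC_pdf_ge0.
have mg : measurable_fun [set: R] (fun y : R => (gaussR_pdf y)%:E).
  by apply/measurable_EFinP; exact: measurable_gaussR_pdf.
have E x : (\int[@lebesgue_R R]_y (gaussC_pdf (x +i* y))%:E = (gaussR_pdf x)%:E)%E.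
  under eq_integral do rewrite gaussC_pdfE EFinM.
  rewrite ge0_integralZl//.
  - by rewrite integral_gaussR_pdf mule1.
  - by move=> y _; rewrite lee_fin gaussR_pdf_ge0.
  - by rewrite lee_fin gaussR_pdf_ge0.
by under eq_integral do rewrite E; exact: integral_gaussR_pdf.
Qed.

Definition gaussC := density measurable_gaussC_pdf gaussC_pdf_ge0 integral_gaussC_pdf.
HB.instance Definition _ := Probability.on gaussC.

Lemma gaussC_rotation (u : R[i]) : normc u = 1 ->
  forall A, measurable A -> gaussC ((fun z => u * z) @^-1` A) = gaussC A.
Proof.
move=> u1 A mA.
have gE B : measurable B -> gaussC B = (\int[@lebesgue_C R]_z ((\1_B z)%:E * (gaussC_pdf z)%:E))%E.
  move=> mB; transitivity (\int[gaussC]_z (\1_B z)%:E)%E.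
    by rewrite integral_indic// setIT.
  apply: (ge0_integral_density measurable_gaussC_pdf gaussC_pdf_ge0 integral_gaussC_pdf).
    by move=> z; rewrite lee_fin.
  exact/measurable_EFinP.
have mu_ := @measurable_mulCl R u.
rewrite !gE//; last by rewrite -[X in measurable X]setTI; exact: mu_.
rewrite -(@ge0_integral_rotation _ (fun z => (\1_A z)%:E * (gaussC_pdf z)%:E)%E u u1).
- by apply: eq_integral => z _; rewrite /gaussC_pdf normcM u1 mul1r !indicE.
- by apply: emeasurable_funM; [exact/measurable_EFinP|by apply/measurable_EFinP; exact: measurable_gaussC_pdf].
- by move=> z; rewrite mule_ge0// lee_fin// gaussC_pdf_ge0.
Qed.

Lemma cintegral_gaussC_rotation (u : R[i]) (F : R[i] -> R[i]) : normc u = 1 ->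
  cintegrable gaussC F ->
  cintegral gaussC (fun z => F (u * z)) = cintegral gaussC F.
Proof.
move=> u1 Fi; exact: (cintegral_preserving (measurable_mulCl u) (gaussC_rotation u1) Fi).
Qed.

End gaussian_densities.

(** * Goursat's lemma and the reproducing property *)

Section goursat.
Context {R : realType}.
Implicit Types f g : R -> R.

Definition itv_int f (a b : R) : R := \int[@lebesgue_measure R]_(x in `[a, b]) f x.

Lemma continuous_integrable_itv f a b : continuous f ->
  (@lebesgue_measure R).-integrable `[a, b] (EFin \o f).
Proof.
move=> cf; apply: continuous_compact_integrable; first exact: segment_compact.
exact: continuous_subspaceT.
Qed.

Lemma itv_int_chasles f a c b : continuous f -> a <= c <= b ->
  itv_int f a b = itv_int f a c + itv_int f c b.
Proof.
move=> cf /andP[ac cb]; rewrite /itv_int.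
have := @Rintegral_itvB R f (BLeft a) (BRight b) c (continuous_integrable_itv _ _ cf).
rewrite !bnd_simp => /(_ ac cb).
rewrite (@Rintegral_itv_obnd_cbnd R c (BRight b) f) => [<-|]; first by rewrite addrC subrK.
apply: integrableS (continuous_integrable_itv a b cf) => //.
by apply: subset_itv; rewrite bnd_simp.
Qed.

Lemma itv_intB f g a b : continuous f -> continuous g ->
  itv_int (fun x => f x - g x) a b = itv_int f a b - itv_int g a b.
Proof. by move=> cf cg; rewrite /itv_int RintegralB//; exact: continuous_integrable_itv. Qed.

Lemma itv_int_le f (a b c e : R) : continuous f -> a <= b ->
  (forall x, a <= x <= b -> `|f x - c| <= e) ->
  `|itv_int f a b - c * (b - a)| <= e * (b - a).
Proof.
move=> cf ab fc.
have E k : itv_int (fun=> k) a b = k * (b - a).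
  rewrite /itv_int Rintegral_cst//.
  have /= -> := @lebesgue_measure_itv R `[a, b]; rewrite lte_fin.
  by case: ltP => // ba; rewrite /= (_ : a = b) ?subrr//; apply/eqP; rewrite eq_le ab.
have ck (k : R) : continuous (fun _ : R => k) by exact: cst_continuous.
rewrite -!E -itv_intB//.
have cfc : continuous (fun x => f x - c).
  by move=> x; apply: cvgB; [exact: cf|exact: cvg_cst].
apply: le_trans (le_normr_Rintegral _ _) _ => //.
  exact: continuous_integrable_itv.
apply: le_Rintegral => //.
- apply: (@continuous_integrable_itv (fun x => `|f x - c|)) => x.
  by apply: cvg_norm; exact: cfc.
- exact: continuous_integrable_itv.
Qed.

Variables p q : R -> R -> R.

(* The shared coefficient [p1] encodes the Cauchy-Riemann equation [p_x = q_y]. *)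
Hypothesis pq_diff : forall x0 y0, exists p1 p2 q1 : R, forall e : R, 0 < e ->
  exists2 d : R, 0 < d & forall x y : R, `|x - x0| < d -> `|y - y0| < d ->
    `|p x y - p x0 y0 - (p1 * (x - x0) + p2 * (y - y0))| <= e * (`|x - x0| + `|y - y0|) /\
    `|q x y - q x0 y0 - (q1 * (x - x0) + p1 * (y - y0))| <= e * (`|x - x0| + `|y - y0|).

Let small_cont (f : R -> R) (x0 c : R) : (exists2 d : R, 0 < d & forall x, `|x - x0| < d ->
  `|f x - f x0| <= c * `|x - x0|) -> {for x0, continuous f}.
Proof.
move=> [d d0 fc]; apply/cvgrPdist_le => e e0.
have c1 : 0 < `|c| + 1 by rewrite ltr_wpDl.
apply/nbhs_ballP; exists (Num.min d (e / (`|c| + 1))).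
  by rewrite /= lt_min d0 divr_gt0.
move=> x /=; rewrite /ball /= lt_min distrC => /andP[xd xe].
rewrite distrC; apply: (le_trans (fc _ xd)).
apply: (@le_trans _ _ ((`|c| + 1) * `|x - x0|)).
  by rewrite ler_wpM2r// (le_trans (ler_norm _))// lerDl.
by rewrite mulrC -ler_pdivlMr// ltW.
Qed.

Let lin_bound (u a b X Y : R) : `|u - (a * X + b * Y)| <= 1 * (`|X| + `|Y|) ->
  Y = 0 \/ X = 0 -> `|u| <= (`|a| + `|b| + 1) * (`|X| + `|Y|).
Proof.
move=> h XY; rewrite -(subrK (a * X + b * Y) u).
rewrite (le_trans (ler_normD _ _))// (_ : (_ + _ + 1) * _ =
  1 * (`|X| + `|Y|) + (`|a| + `|b|) * (`|X| + `|Y|)); last by ring.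
rewrite lerD//; rewrite (le_trans (ler_normD _ _))// !normrM mulrDr !mulrDl.
rewrite -!addrA lerD2l; have := normr_ge0 a; have := normr_ge0 b.
have := normr_ge0 X; have := normr_ge0 Y; nra.
Qed.

Lemma goursat_cont :
  [/\ forall x, continuous (p x), forall y, continuous (p^~ y),
      forall x, continuous (q x) & forall y, continuous (q^~ y)].
Proof.
split=> [x y|y x|x y|y x];
  have [p1 [p2 [q1 /(_ 1 ltr01)[d d0 h]]]] := pq_diff x y.
- apply: (@small_cont _ _ (`|p1| + `|p2| + 1)); exists d => // y' yd.
  have [|h1 _] := h x y' _ yd; first by rewrite subrr normr0.
  have := lin_bound h1 (or_intror (subrr x)).
  by rewrite subrr normr0 add0r.
- apply: (@small_cont _ _ (`|p1| + `|p2| + 1)); exists d => // x' xd.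
  have [|h1 _] := h x' y xd; first by rewrite subrr normr0.
  have := lin_bound h1 (or_introl (subrr y)).
  by rewrite subrr normr0 addr0.
- apply: (@small_cont _ _ (`|q1| + `|p1| + 1)); exists d => // y' yd.
  have [|_ h1] := h x y' _ yd; first by rewrite subrr normr0.
  have := lin_bound h1 (or_intror (subrr x)).
  by rewrite subrr normr0 add0r.
- apply: (@small_cont _ _ (`|q1| + `|p1| + 1)); exists d => // x' xd.
  have [|_ h1] := h x' y xd; first by rewrite subrr normr0.
  have := lin_bound h1 (or_introl (subrr y)).
  by rewrite subrr normr0 addr0.
Qed.

(** The imaginary part of the contour integral of [p + i q], that is, the integral of [q dx + p dy]
    taken counterclockwise around the rectangle with lower left corner [(a, b)] and sides [s],
    [t]. *)
Definition bdry (a b s t : R) : R :=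
  itv_int (p (a + s)) b (b + t) - itv_int (p a) b (b + t)
  - (itv_int (q^~ (b + t)) a (a + s) - itv_int (q^~ b) a (a + s)).

(** Each inner side belongs to two quarters and is traversed in opposite directions, so its
    contributions cancel. *)
Lemma bdry_split (a b s t : R) : 0 <= s -> 0 <= t ->
  bdry a b s t = bdry a b (s / 2) (t / 2) + bdry (a + s / 2) b (s / 2) (t / 2)
    + bdry a (b + t / 2) (s / 2) (t / 2) + bdry (a + s / 2) (b + t / 2) (s / 2) (t / 2).
Proof.
move=> s0 t0; have [cp cp' cq cq'] := goursat_cont.
have E (a' s' : R) : 0 <= s' -> a' <= a' + s' / 2 <= a' + s'.
  by move=> ?; apply/andP; split; lra.
have D (a' s' : R) : a' + s' / 2 + s' / 2 = a' + s' by rewrite -addrA -splitr.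
rewrite /bdry !D.
rewrite !(itv_int_chasles (cp _) (E b t t0)) !(itv_int_chasles (cq' _) (E a s s0)).
ring.
Qed.

(** The affine parts contribute [p1 * s * t] along the vertical sides and [p1 * t * s] along the
    horizontal ones, which cancel by the Cauchy-Riemann equation. What remains is an error
    proportional to the size of the rectangle, integrated over sides of that size. *)
Lemma bdry_local (x0 y0 e : R) : 0 < e -> exists2 d : R, 0 < d & forall a b s t : R,
  0 <= s -> 0 <= t -> s + t < d -> a <= x0 <= a + s -> b <= y0 <= b + t ->
  `|bdry a b s t| <= e * (s + t) ^+ 2.
Proof.
move=> e0; have [p1 [p2 [q1 /(_ (e / 4))]]] := pq_diff x0 y0.
have e4 : 0 < e / 4 by lra.
move=> /(_ e4)[d d0 h]; exists d => // a b s t s0 t0 std /andP[ax xs] /andP[by_ yt].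
have [cp cp' cq cq'] := goursat_cont.
have near_ x y : a <= x <= a + s -> b <= y <= b + t ->
    `|p x y - p x0 y0 - (p1 * (x - x0) + p2 * (y - y0))| <= e / 4 * (s + t) /\
    `|q x y - q x0 y0 - (q1 * (x - x0) + p1 * (y - y0))| <= e / 4 * (s + t).
  move=> /andP[x1 x2] /andP[y1 y2].
  have xx : `|x - x0| <= s by rewrite ler_norml; apply/andP; split; lra.
  have yy : `|y - y0| <= t by rewrite ler_norml; apply/andP; split; lra.
  have [||h1 h2] := h x y; [lra|lra|].
  have ee : e / 4 * (`|x - x0| + `|y - y0|) <= e / 4 * (s + t).
    by apply: ler_wpM2l; [exact: ltW|exact: lerD].
  by split; [exact: le_trans h1 ee|exact: le_trans h2 ee].
have Ha : a <= a <= a + s by rewrite lexx lerDl.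
have Has : a <= a + s <= a + s by rewrite lexx lerDl s0.
have Hb : b <= b <= b + t by rewrite lexx lerDl.
have Hbt : b <= b + t <= b + t by rewrite lexx lerDl t0.
have P : `|itv_int (fun y => p (a + s) y - p a y) b (b + t) - (p1 * s) * (b + t - b)|
    <= e / 2 * (s + t) * (b + t - b).
  apply: itv_int_le.
  - by move=> y; apply: cvgB; exact: cp.
  - by rewrite lerDl.
  - move=> y yb; have [h1 _] := near_ _ _ Has yb; have [h2 _] := near_ _ _ Ha yb.
    move: h1 h2; rewrite !ler_norml => /andP[h1 h1'] /andP[h2 h2'].
    by apply/andP; split; lra.
have Q : `|itv_int (fun x => q x (b + t) - q x b) a (a + s) - (p1 * t) * (a + s - a)|
    <= e / 2 * (s + t) * (a + s - a).
  apply: itv_int_le.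
  - by move=> x; apply: cvgB; exact: cq'.
  - by rewrite lerDl.
  - move=> x xa; have [_ h1] := near_ _ _ xa Hbt; have [_ h2] := near_ _ _ xa Hb.
    move: h1 h2; rewrite !ler_norml => /andP[h1 h1'] /andP[h2 h2'].
    by apply/andP; split; lra.
move: P Q; rewrite !itv_intB// -/(bdry a b s t) => P Q.
rewrite (addrC b t) addrK in P; rewrite (addrC a s) addrK in Q.
rewrite (addrC t b) in P; rewrite (addrC s a) in Q.
rewrite /bdry; move: P Q; rewrite !ler_norml => /andP[P1 P2] /andP[Q1 Q2].
by apply/andP; split; nra.
Qed.

(** The last quarter is taken untested: if each of the first three carries less than a quarter of
    the boundary integral, the fourth carries at least a quarter of it. *)
Let step (s t : R) (c : R * R) : R * R :=
  let: (a, b) := c in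
  let ok c' := `|bdry a b s t| <= 4 * `|bdry c'.1 c'.2 (s / 2) (t / 2)| in
  if ok (a, b) then (a, b) else if ok (a + s / 2, b) then (a + s / 2, b)
  else if ok (a, b + t / 2) then (a, b + t / 2) else (a + s / 2, b + t / 2).

Let stepP (s t : R) (c : R * R) : 0 <= s -> 0 <= t ->
  `|bdry c.1 c.2 s t| <= 4 * `|bdry (step s t c).1 (step s t c).2 (s / 2) (t / 2)| /\
  c.1 <= (step s t c).1 <= c.1 + s / 2 /\ c.2 <= (step s t c).2 <= c.2 + t / 2.
Proof.
move=> s0 t0; case: c => a b /=.
have s2 : 0 <= s / 2 by lra.
have t2 : 0 <= t / 2 by lra.
case: ifPn => [h|/=]; first by rewrite !lexx !lerDl s2 t2.
rewrite -ltNge => h1; case: ifPn => [h|/=]; first by rewrite !lexx !lerDl s2 t2.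
rewrite -ltNge => h2; case: ifPn => [h|/=]; first by rewrite !lexx !lerDl s2 t2.
rewrite -ltNge => h3 /=; rewrite !lexx !lerDl s2 t2; split => //.
have := bdry_split a b s0 t0 => E.
have : `|bdry a b s t| <= `|bdry a b (s / 2) (t / 2)| + `|bdry (a + s / 2) b (s / 2) (t / 2)|
    + `|bdry a (b + t / 2) (s / 2) (t / 2)| + `|bdry (a + s / 2) (b + t / 2) (s / 2) (t / 2)|.
  rewrite E; do 3 (apply: le_trans (ler_normD _ _) _; rewrite lerD2r).
  exact: lexx.
move: h1 h2 h3; rewrite /=; lra.
Qed.

(* Goursat's argument: quarter the rectangle, keeping the part with the largest
   boundary integral, and use differentiability at the limit point. *)
Theorem bdry_eq0 (a b s t : R) : 0 <= s -> 0 <= t -> bdry a b s t = 0.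
Proof.
move=> s0 t0.
(* [u k] is the lower left corner of the k-th rectangle, whose sides are [s / 2 ^+ k] and
   [t / 2 ^+ k]. *)
pose u := fix u k := if k is k'.+1 then step (s / 2 ^+ k') (t / 2 ^+ k') (u k') else (a, b).
have sk0 k : 0 <= s / 2 ^+ k by rewrite divr_ge0// exprn_ge0.
have tk0 k : 0 <= t / 2 ^+ k by rewrite divr_ge0// exprn_ge0.
have half (x : R) k : x / 2 ^+ k.+1 = x / 2 ^+ k / 2 by rewrite exprSr invfM mulrA.
have uP k := stepP (u k) (sk0 k) (tk0 k).
have big k : `|bdry a b s t| <= 4 ^+ k * `|bdry (u k).1 (u k).2 (s / 2 ^+ k) (t / 2 ^+ k)|.
  elim: k => [|k IH]; first by rewrite !expr0 mul1r !divr1.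
  apply: le_trans IH _; rewrite exprSr -mulrA ler_wpM2l ?exprn_ge0//.
  by have [h _] := uP k; rewrite !half.
have lim (v : nat -> R) (w : R) : 0 <= w ->
    (forall k, v k <= v k.+1 <= v k + w / 2 ^+ k / 2) ->
    exists x, forall k, v k <= x <= v k + w / 2 ^+ k.
  move=> w0 vP.
  have nd : nondecreasing_seq v by apply/nondecreasing_seqP => k; have /andP[] := vP k.
  have ni : nonincreasing_seq (fun k => v k + w / 2 ^+ k).
    apply/nonincreasing_seqP => k; have /andP[_ h] := vP k; rewrite half.
    by rewrite [X in _ <= _ + X]splitr; lra.
  have cross k j : v k <= v j + w / 2 ^+ j.
    have wj i : 0 <= w / 2 ^+ i by rewrite divr_ge0// exprn_ge0.
    have [kj|/ltnW jk] := leqP k j.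
      by apply: (le_trans (nd _ _ kj)); rewrite lerDl.
    by apply: le_trans (ni _ _ jk); rewrite lerDl.
  have cv : cvgn v.
    by apply: nondecreasing_is_cvgn => //; exists (v 0 + w / 2 ^+ 0) => _ [k _ <-].
  exists (limn v) => k; apply/andP; split; first exact: nondecreasing_cvgn_le.
  by apply: limr_le => //; apply: nearW => j.
have [x0 x0P] := lim (fun k => (u k).1) s s0 (fun k => (uP k).2.1).
have [y0 y0P] := lim (fun k => (u k).2) t t0 (fun k => (uP k).2.2).
have small (e : R) : 0 < e -> `|bdry a b s t| <= e * (s + t) ^+ 2.
  move=> e0; have [d d0 h] := bdry_local x0 y0 e0.
  have [k kd] : exists k, (s + t) / 2 ^+ k < d.
    have : (s + t) / 2 ^+ k @[k --> \oo] --> (s + t) * 0.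
      apply: cvgM; first exact: cvg_cst.
      have -> : (fun k => (2 ^+ k)^-1 : R) = geometric 1 2^-1.
        by apply/funext => k; rewrite /= mul1r exprVn.
      by apply: cvg_geometric; rewrite ger0_norm ?invf_lt1 ?invr_ge0// ltr1n.
    rewrite mulr0 => /cvgrPdist_lt/(_ d d0)[k _ /(_ k (leqnn k))] /=.
    rewrite sub0r normrN ger0_norm ?divr_ge0 ?addr_ge0 ?exprn_ge0// => ?.
    by exists k.
  apply: le_trans (big k) _.
  have := h _ _ _ _ (sk0 k) (tk0 k) _ (x0P k) (y0P k).
  rewrite -mulrDl => /(_ kd) hk.
  apply: le_trans (ler_wpM2l _ hk) _; first by rewrite exprn_ge0.
  rewrite le_eqVlt; apply/orP; left; apply/eqP.
  have -> : (4 : R) ^+ k = (2 ^+ k) ^+ 2 by rewrite -exprM mulnC exprM; congr (_ ^+ k); ring.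
  by field; rewrite expf_neq0.
apply/eqP; rewrite -normr_le0; apply/ler_addgt0Pr => e e0; rewrite add0r.
have st : 0 < (s + t) ^+ 2 + 1 by rewrite ltr_wpDl// sqr_ge0.
apply: le_trans (small (e / ((s + t) ^+ 2 + 1)) _) _; first by rewrite divr_gt0.
by rewrite mulrAC ler_pdivrMr// ler_wpM2l ?ltW// ltrDl.
Qed.

End goursat.

(** * Second-order estimates for the complex exponential *)

Section elementary_bounds.
Context {R : realType}.
Implicit Types a b : R.

Lemma expR_sub1_le a : `|expR a - 1| <= `|a| * expR `|a|.
Proof.
have h1 := expR_ge1Dx a.
have h2 := expR_ge1Dx (- a).
have e0 := expR_gt0 a.
have h3 : expR a - 1 <= a * expR a.
  have : (1 - a) * expR a <= 1.
    by rewrite -[leRHS](expRxMexpNx_1 a) mulrC ler_wpM2l// ltW.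
  lra.
have ea : 1 <= expR `|a| by rewrite -expR0 ler_expR.
have eaa : expR a <= expR `|a| by rewrite ler_expR ler_norm.
have [a0|a0] := leP 0 a.
  by rewrite ger0_norm//; [rewrite ger0_norm in eaa *|lra].
rewrite ler0_norm; last by nra.
by have := ltr0_norm a0 => ->; rewrite ltr0_norm// in ea; nra.
Qed.

Lemma expR_sub1B_le a : `|expR a - 1 - a| <= a ^+ 2 * expR `|a|.
Proof.
have h1 := expR_ge1Dx a; have h2 := expR_ge1Dx (- a).
rewrite ger0_norm; last by lra.
have h3 : expR a - 1 - a <= a * (expR a - 1).
  have : (1 - a) * expR a <= 1.
    by rewrite -[leRHS](expRxMexpNx_1 a) mulrC ler_wpM2l// ltW// expR_gt0.
  lra.
apply: (le_trans h3); apply: le_trans (ler_norm _) _; rewrite normrM.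
by rewrite -real_normK ?num_real// expr2 -mulrA ler_wpM2l// expR_sub1_le.
Qed.

Lemma lipschitz_at0 (f df : R -> R) a (M : R) : (forall x : R, is_derive x 1 f (df x)) ->
  (forall x, `|x| <= `|a| -> `|df x| <= M) -> `|f a - f 0| <= M * `|a|.
Proof.
move=> fd fM.
have cf : continuous f.
  by move=> x; apply/differentiable_continuous/derivable1_diffP; have [] := fd x.
have [a0|a0] := leP 0 a.
  have [c] := MVT_segment a0 (fun x _ => fd x) (continuous_subspaceT cf).
  rewrite in_itv /= => /andP[c0 ca] ->; rewrite subr0 normrM ler_wpM2r// fM//.
  by rewrite !ger0_norm.
have [c] := MVT_segment (ltW a0) (fun x _ => fd x) (continuous_subspaceT cf).
rewrite in_itv /= => /andP[c0 ca]; rewrite distrC => ->; rewrite sub0r normrM normrN ler_wpM2r// fM//.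
by rewrite !ler0_norm ?lerN2// ltW.
Qed.

Lemma normr_sin_le b : `|sin b| <= `|b|.
Proof.
have := @lipschitz_at0 sin cos b 1 (fun x => is_derive_sin x) (fun x _ => cos_max x).
by rewrite sin0 subr0 mul1r.
Qed.

Lemma cos_sub1_le b : `|cos b - 1| <= b ^+ 2.
Proof.
have := @lipschitz_at0 cos (fun x => - sin x) b `|b| (fun x => is_derive_cos x).
rewrite cos0 -expr2 real_normK ?num_real//; apply => x xb.
by rewrite normrN (le_trans (normr_sin_le x)).
Qed.

Lemma sin_subid_le b : `|sin b - b| <= b ^+ 2.
Proof.
have D (x : R) : is_derive x 1 (fun y => sin y - y) (cos x - 1) by exact: is_deriveB.
have := @lipschitz_at0 (fun y => sin y - y) (fun x => cos x - 1) b `|b| D.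
rewrite sin0 !subr0 -expr2 real_normK ?num_real//; apply => x xb.
have := @lipschitz_at0 cos (fun x => - sin x) x 1 (fun x => is_derive_cos x).
by rewrite cos0 mul1r => h; rewrite (le_trans _ xb)// h// => y _; rewrite normrN sin_max.
Qed.

(** The constant 3 adds the bound with constant 1 for the real part to the bound with constant 2 for
    the imaginary part. *)
Lemma cexp_sub1B_le (z : R[i]) :
  normc (cexp z - 1 - z) <= 3 * normc z ^+ 2 * expR (normc z).
Proof.
have [za zb] := (normr_Re_le z, normr_Im_le z).
have := sqr_normc_ReIm z; have := normc_ge0 z; move: za zb.
rewrite (_ : cexp z - 1 - z = (expR (complex.Re z) * cos (complex.Im z) - 1 - complex.Re z)
   +i* (expR (complex.Re z) * sin (complex.Im z) - complex.Im z)); last first.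
  by case: z => a b; apply: complexP; rewrite /cexp /= ?oppr0 ?addr0.
move: (complex.Re z) (complex.Im z) (normc z) => a b n an bn n0 nE.
apply: le_trans (normc_le_ReIm _) _ => /=.
have e1 : expR `|a| <= expR n by rewrite ler_expR.
have e0 : expR a <= expR n by rewrite ler_expR (le_trans (ler_norm _)).
have ep := expR_gt0 a.
have en : 1 <= expR n by rewrite -expR0 ler_expR.
have A : `|expR a * cos b - 1 - a| <= n ^+ 2 * expR n.
  rewrite (_ : _ - 1 - a = (expR a - 1 - a) + expR a * (cos b - 1)); last by ring.
  apply: le_trans (ler_normD _ _) _; rewrite nE mulrDl lerD//.
    by apply: le_trans (expR_sub1B_le a) _; rewrite ler_wpM2l// sqr_ge0.
  rewrite normrM mulrC ler_pM ?cos_sub1_le//.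
  by rewrite ger0_norm// ltW.
have B : `|expR a * sin b - b| <= 2 * n ^+ 2 * expR n.
  rewrite (_ : _ - b = (expR a - 1) * sin b + (sin b - b)); last by ring.
  apply: le_trans (ler_normD _ _) _.
  rewrite (_ : 2 * n ^+ 2 * expR n = n * expR n * n + n ^+ 2 * expR n); last by ring.
  apply: lerD.
    rewrite normrM; apply: ler_pM => //; last by rewrite (le_trans (normr_sin_le b)).
    by apply: le_trans (expR_sub1_le a) _; rewrite ler_pM// expR_ge0.
  apply: le_trans (sin_subid_le b) _.
  apply: (@le_trans _ _ (n ^+ 2)); first by rewrite nE lerDr sqr_ge0.
  by rewrite ler_peMr// sqr_ge0.
rewrite (_ : 3 * n ^+ 2 * expR n = n ^+ 2 * expR n + 2 * n ^+ 2 * expR n); last by ring.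
exact: lerD.
Qed.

End elementary_bounds.

(** * Complex differentiability in one variable *)

Section complex_differentiability.
Context {R : realType}.
Implicit Types (F G : R[i] -> R[i]) (z : R[i]).

(** With [e] and [r] real, this form splits directly into the real expansions that Goursat's lemma
    takes as hypothesis. *)
Definition cdiff F z := exists d : R[i], forall e : R, 0 < e ->
  exists2 r : R, 0 < r &
    forall h, normc h < r -> normc (F (z + h) - F z - d * h) <= e * normc h.

Lemma cdiff_affine a b z : cdiff (fun w => a * w + b) z.
Proof.
exists a => e e0; exists 1 => // h _.
rewrite (_ : _ - _ = 0) ?normc0 ?mulr_ge0 ?normc_ge0 ?ltW//; ring.
Qed.

Lemma cdiff_cexp z : cdiff (@cexp R) z.
Proof.
exists (cexp z) => e e0.
pose K := normc (cexp z) * 3 * expR 1.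
have K0 : 0 <= K by rewrite !mulr_ge0 ?normc_ge0// expR_ge0.
exists (Num.min 1 (e / (K + 1))); first by rewrite lt_min ltr01 divr_gt0// ltr_wpDl.
move=> h; rewrite lt_min => /andP[h1 he].
rewrite (_ : _ - _ = cexp z * (cexp h - 1 - h)); last by rewrite cexpD; ring.
rewrite normcM; apply: (@le_trans _ _ (K * normc h * normc h)).
  rewrite /K -!mulrA ler_wpM2l ?normc_ge0//.
  apply: le_trans (cexp_sub1B_le h) _.
  rewrite -mulrA ler_wpM2l// mulrC expr2 ler_wpM2r ?mulr_ge0 ?normc_ge0//.
  by rewrite ler_expR ltW.
rewrite ler_wpM2r ?normc_ge0//.
apply: (@le_trans _ _ ((K + 1) * normc h)); first by rewrite ler_wpM2r ?normc_ge0// lerDl.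
by rewrite mulrC -ler_pdivlMr ?ltr_wpDl// ltW.
Qed.

Lemma cdiff_comp F G z : cdiff G z -> cdiff F (G z) -> cdiff (F \o G) z.
Proof.
move=> [g Gz] [f FGz]; exists (f * g) => e e0.
have ng := normc_ge0 g; have nf := normc_ge0 f.
pose e1 := e / (2 * (normc g + 1)).
pose e2 := Num.min 1 (e / (2 * (normc f + 1))).
have e10 : 0 < e1 by rewrite divr_gt0// mulr_gt0// ltr_wpDl.
have e20 : 0 < e2 by rewrite lt_min ltr01 divr_gt0// mulr_gt0// ltr_wpDl.
have [r1 r10 h1] := FGz _ e10; have [r2 r20 h2] := Gz _ e20.
exists (Num.min r2 (r1 / (normc g + 1))).
  by rewrite lt_min r20 divr_gt0// ltr_wpDl.
move=> h; rewrite lt_min => /andP[hr2 hr1].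
pose k := G (z + h) - G z.
have kE : normc (k - g * h) <= e2 * normc h by exact: h2.
have nh := normc_ge0 h.
have e21 : e2 <= 1 by rewrite ge_min lexx.
have e2f : e2 <= e / (2 * (normc f + 1)) by rewrite ge_min lexx orbT.
have kh : normc k <= (normc g + 1) * normc h.
  rewrite -(subrK (g * h) k); apply: le_trans (le_normcD _ _) _.
  rewrite normcM; nra.
have kr1 : normc k < r1.
  by apply: le_lt_trans kh _; rewrite mulrC -ltr_pdivlMr// ltr_wpDl.
have FE := h1 k kr1.
have Gk : G z + k = G (z + h) by rewrite /k addrC subrK.
rewrite Gk in FE.
rewrite /= (_ : _ - _ = (F (G (z + h)) - F (G z) - f * k) + f * (k - g * h)); last by ring.
apply: le_trans (le_normcD _ _) _; rewrite normcM.
have A : e1 * normc k <= e / 2 * normc h.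
  apply: le_trans (ler_wpM2l (ltW e10) kh) _; rewrite /e1.
  rewrite [leLHS](_ : _ = e / 2 * normc h)//; field.
  by rewrite gt_eqF// ltr_wpDl.
have B : normc f * (e2 * normc h) <= e / 2 * normc h.
  rewrite mulrA ler_wpM2r//.
  apply: le_trans (ler_wpM2l nf e2f) _.
  rewrite [leRHS](_ : _ = (normc f + 1) * (e / (2 * (normc f + 1)))); last first.
    by field; rewrite gt_eqF// ltr_wpDl.
  by rewrite ler_wpM2r ?lerDl// divr_ge0 ?ltW// mulr_gt0// ltr_wpDl.
have C : normc f * normc (k - g * h) <= normc f * (e2 * normc h) by rewrite ler_wpM2l.
move: FE A B C; lra.
Qed.

Lemma cdiffM F G z : cdiff F z -> cdiff G z -> cdiff (fun w => F w * G w) z.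
Proof.
move=> [a Fz] [b Gz]; exists (a * G z + F z * b) => e e0.
(* [K] adds the coefficients of the six terms into which the error of the product splits below; each
   term is at most [e1 * normc h] times its coefficient. *)
pose K := normc a * normc b + normc a + normc (G z) + normc b + 1 + normc (F z).
have [[[na nb] nG] nF] := (normc_ge0 a, normc_ge0 b, normc_ge0 (G z), normc_ge0 (F z)).
have K0 : 0 < K.
  rewrite /K; have := mulr_ge0 na nb; lra.
have [e1 [e10 e11 e1K]] : exists e1 : R, [/\ 0 < e1, e1 <= 1 & e1 * K <= e].
  exists (Num.min 1 (e / K)); split.
  - by rewrite lt_min ltr01 divr_gt0.
  - by rewrite ge_min lexx.
  - by rewrite -ler_pdivlMr// ge_min lexx orbT.
have [r1 r10 h1] := Fz _ e10; have [r2 r20 h2] := Gz _ e10.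
exists (Num.min e1 (Num.min r1 r2)); first by rewrite !lt_min e10 r10.
move=> h; rewrite !lt_min => /and3P[he /h1 + /h2]; have nh := normc_ge0 h.
set u := F (z + h) - F z - a * h; set v := G (z + h) - G z - b * h => ue ve.
rewrite (_ : _ - _ = a * h * (b * h) + (a * h * v + (u * G z + (u * (b * h) + (u * v + F z * v)))));
  last by rewrite /u /v; ring.
apply: (@le_trans _ _ (e1 * K * normc h)); last by rewrite ler_wpM2r.
have nu := normc_ge0 u; have nv := normc_ge0 v.
have h1' : normc h <= 1 by rewrite ltW// (lt_le_trans he).
have vh : normc v <= 1 * 1.
  by apply: (le_trans ve); rewrite ler_pM// ltW.
apply: le_trans (le_normcD _ _) _.
have T1 : normc (a * h * (b * h)) <= normc a * normc b * e1 * normc h.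
    rewrite !normcM (_ : _ * _ * _ = normc a * normc b * normc h * normc h); last by ring.
    by rewrite ler_wpM2r// ler_wpM2l ?mulr_ge0// ltW.
  rewrite (_ : e1 * K * normc h = normc a * normc b * e1 * normc h +
    (normc a * e1 * normc h + (e1 * normc h * normc (G z) + (e1 * normc h * normc b +
     (e1 * normc h + normc (F z) * (e1 * normc h)))))); last by rewrite /K; ring.
  apply: lerD => //; apply: le_trans (le_normcD _ _) _; apply: lerD.
    rewrite !normcM -!mulrA ler_wpM2l//.
    by apply: le_trans (ler_wpM2l nh ve) _; rewrite ler_piMl// mulr_ge0// ltW.
  apply: le_trans (le_normcD _ _) _; apply: lerD.
    by rewrite normcM ler_wpM2r.
  apply: le_trans (le_normcD _ _) _; apply: lerD.
    rewrite !normcM; apply: ler_pM => //; first by rewrite mulr_ge0.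
    by rewrite ler_piMr.
  apply: le_trans (le_normcD _ _) _; apply: lerD.
    by rewrite normcM (le_trans _ ue)// ler_piMr// (le_trans vh)// mulr1.
  by rewrite normcM ler_wpM2l.
Qed.

Lemma cdiff_conjJ F z : cdiff F (z^*)%C -> cdiff (fun w => ((F (w^*)%C)^*)%C) z.
Proof.
move=> [d Fz]; exists ((d^*)%C) => e e0; have [r r0 h] := Fz e e0.
exists r => // k kr; have := h (k^*)%C; rewrite !normcJ => /(_ kr).
rewrite (_ : _ - (d^*)%C * k = ((F ((z^*)%C + (k^*)%C) - F (z^*)%C - d * (k^*)%C)^*)%C) ?normcJ//.
by rewrite !rmorphB rmorphM /= conjcK rmorphD.
Qed.

Lemma cdiff_continuous F z : cdiff F z -> forall e : R, 0 < e ->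
  exists2 r : R, 0 < r & forall h, normc h < r -> normc (F (z + h) - F z) <= e.
Proof.
move=> [d Fz] e e0; have [r r0 h] := Fz 1 ltr01.
have nd := normc_ge0 d.
exists (Num.min r (e / (normc d + 1))); first by rewrite lt_min r0 divr_gt0// ltr_wpDl.
move=> k; rewrite lt_min => /andP[/h kr ke].
rewrite -(subrK (d * k) (F (z + k) - F z)); apply: le_trans (le_normcD _ _) _.
rewrite normcM; apply: (@le_trans _ _ ((normc d + 1) * normc k)).
  by rewrite mulrDl addrC lerD2l.
by rewrite mulrC -ler_pdivlMr ?ltr_wpDl// ltW.
Qed.

End complex_differentiability.

(** * The mean value property, on circles and against Gaussians *)

Section circle_mean.
Context {R : realType}.
Implicit Types (F : R[i] -> R[i]) (z w : R[i]).

Definition centire F := forall z, cdiff F z.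

(** Multiplication by the derivative [d] has the real matrix with rows [Re d, - Im d] and
    [Im d, Re d]; the repeated entry [Re d] is the shared coefficient [p1]. *)
Lemma cdiff_Re_Im F : centire F -> forall x0 y0 : R, exists p1 p2 q1 : R,
  forall e : R, 0 < e -> exists2 d : R, 0 < d & forall x y : R,
    `|x - x0| < d -> `|y - y0| < d ->
    `|complex.Re (F (x +i* y)) - complex.Re (F (x0 +i* y0))
      - (p1 * (x - x0) + p2 * (y - y0))| <= e * (`|x - x0| + `|y - y0|) /\
    `|complex.Im (F (x +i* y)) - complex.Im (F (x0 +i* y0))
      - (q1 * (x - x0) + p1 * (y - y0))| <= e * (`|x - x0| + `|y - y0|).
Proof.
move=> Fe x0 y0; have [d Fd] := Fe (x0 +i* y0).
exists (complex.Re d), (- complex.Im d), (complex.Im d) => e e0.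
have [r r0 h] := Fd e e0; exists (r / 2); first by rewrite divr_gt0.
move=> x y xr yr.
pose k := (x - x0) +i* (y - y0).
have kle : normc k <= `|x - x0| + `|y - y0| by exact: normc_le_ReIm.
have kr : normc k < r by rewrite (le_lt_trans kle)// (splitr r) ltrD.
have zk : x0 +i* y0 + k = x +i* y by apply: complexP => /=; ring.
have := h k kr; rewrite zk; set E := _ - d * k => Ele.
have Ele' : normc E <= e * (`|x - x0| + `|y - y0|).
  by rewrite (le_trans Ele)// ler_wpM2l// ltW.
split.
  apply: le_trans Ele'; apply: le_trans (normr_Re_le _).
  rewrite /E !ReD !ReN ReM /= le_eqVlt; apply/orP; left; apply/eqP; congr `|_|; ring.
apply: le_trans Ele'; apply: le_trans (normr_Im_le _).
rewrite /E !ImD !ImN ImM /= le_eqVlt; apply/orP; left; apply/eqP; congr `|_|; ring.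
Qed.

Lemma centire_comp_exp F w : centire F -> centire (fun zeta => F (w * cexp zeta)).
Proof.
move=> Fe zeta; apply: (@cdiff_comp _ F (fun u => w * cexp u)) => //.
apply: (@cdiff_comp _ (fun u => w * u) (@cexp R)); first exact: cdiff_cexp.
by have := @cdiff_affine R w 0 (cexp zeta); under eq_fun do rewrite addr0.
Qed.

Lemma cexp_imag_periodic (x y : R) : cexp (x +i* (y + pi *+ 2)) = cexp (x +i* y) :> R[i].
Proof. by rewrite /cexp /= cosD2pi sinD2pi. Qed.

Lemma pi2_ge0 : 0 <= pi *+ 2 :> R.
Proof. by rewrite mulrn_wge0// pi_ge0. Qed.

(* In logarithmic coordinates the circle averages of [F] are the vertical sides of
   a rectangle whose horizontal sides cancel by periodicity. *)
Lemma circle_mean_Re F w : centire F ->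
  itv_int (fun t => complex.Re (F (w * cexp (0 +i* t)))) 0 (pi *+ 2) =
  complex.Re (F 0) * (pi *+ 2).
Proof.
move=> Fe; have Ge := centire_comp_exp w Fe.
pose p (x y : R) := complex.Re (F (w * cexp (x +i* y))).
pose q (x y : R) := complex.Im (F (w * cexp (x +i* y))).
have pq := cdiff_Re_Im Ge.
have [cp _ _ _] := goursat_cont (p := p) (q := q) pq.
have M (a : R) : a <= 0 -> itv_int (p 0) 0 (pi *+ 2) = itv_int (p a) 0 (pi *+ 2).
  move=> a0; have a0' : 0 <= - a by rewrite oppr_ge0.
  have := @bdry_eq0 _ p q pq a 0 (- a) (pi *+ 2) a0' pi2_ge0.
  have qE : q^~ (0 + pi *+ 2) = q^~ 0.
    by apply/funext => x; rewrite /q cexp_imag_periodic.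
  rewrite /bdry qE [a + - a]subrr [0 + pi *+ 2]add0r [X in _ - X]subrr subr0.
  by move/eqP; rewrite subr_eq0 => /eqP.
rewrite -[LHS]/(itv_int (p 0) 0 (pi *+ 2)).
apply/eqP; rewrite -subr_eq0 -normr_le0; apply/ler_addgt0Pr => e e0; rewrite add0r.
have P1 : 0 < pi *+ 2 + 1 :> R by rewrite ltr_wpDl// pi2_ge0.
have e1 : 0 < e / (pi *+ 2 + 1) by rewrite divr_gt0.
have [r r0 h] := cdiff_continuous (Fe 0) e1.
have w1 : 0 < normc w + 1 by rewrite ltr_wpDl ?normc_ge0.
(* So negative that the circle of radius [normc w * expR a] lies within [r] of 0, where [F] is close
   to [F 0]. The minimum with 0 ensures that the rectangle from abscissa [a] to abscissa 0 makes
   sense. *)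
pose a := Num.min 0 (ln (r / 2 / (normc w + 1))).
have a0 : a <= 0 by rewrite ge_min lexx.
have ea : (normc w + 1) * expR a < r.
  have : expR a <= r / 2 / (normc w + 1).
    rewrite -[leRHS]lnK ?posrE ?divr_gt0// ler_expR ge_min lexx orbT//.
  by rewrite ler_pdivlMr// mulrC => /le_lt_trans; apply; lra.
rewrite (M a a0) -[X in _ * X]subr0.
have := @itv_int_le _ (p a) 0 (pi *+ 2) (complex.Re (F 0)) (e / (pi *+ 2 + 1)) (cp a) pi2_ge0.
move=> /(_ _)/le_trans; apply.
  move=> t _; rewrite /p -ReN -ReD (le_trans (normr_Re_le _))//.
  have := h (w * cexp (a +i* t)); rewrite add0r; apply.
  rewrite normcM normc_cexp /= (le_lt_trans _ ea)//.
  by rewrite ler_wpM2r ?expR_ge0// lerDl.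
rewrite subr0 mulrAC ler_pdivrMr// ler_wpM2l ?(ltW e0)//.
by rewrite lerDl.
Qed.

Lemma itv_int_lebesgue_R (f : R -> R) a b : measurable_fun [set: R] f ->
  \int[@lebesgue_R R]_x (f x * \1_(`[a, b]) x) = itv_int f a b.
Proof.
move=> mf.
have mi : measurable_fun [set: R] (\1_(`[a, b]%classic) : R -> R).
  by apply: measurable_indic; exact: measurable_itv.
have mfi : measurable_fun [set: R] (fun x => (f x * \1_(`[a, b]) x)%:E).
  by apply/measurable_EFinP/measurable_funM.
rewrite /itv_int [RHS]Rintegral_mkcond /Rintegral; congr fine.
rewrite [LHS]integralE.
rewrite ge0_integral_lebesgue_R//; last exact: measurable_funepos.
rewrite ge0_integral_lebesgue_R//; last exact: measurable_funeneg.
rewrite -integralE; apply: eq_integral => x _.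
by rewrite patchE indicE; case: (x \in _); rewrite ?mulr1 ?mulr0.
Qed.

Lemma centireZ c F : centire F -> centire (fun z => c * F z).
Proof.
move=> Fe z; apply: (@cdiff_comp _ (fun u => c * u) F) => //.
by have := @cdiff_affine R c 0 (F z); under eq_fun do rewrite addr0.
Qed.

Lemma measurable_cexp_imag : measurable_fun [set: R] (fun t : R => cexp (0 +i* t)).
Proof. by apply: measurable_fun_cexp; exact: measurable_Complex. Qed.

(** [circle_mean_Re] controls real parts only; the imaginary part of [F] is the real part of
    [- 'i * F], which is entire as well. The indicator puts the integral on the whole line, ready
    for Fubini. *)
Lemma circle_mean F w : centire F -> measurable_fun [set: R[i]] F ->
  cintegral (@lebesgue_R R) (fun t => (\1_(`[0, pi *+ 2]) t)%:C * F (cexp (0 +i* t) * w)) =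
  (pi *+ 2)%:C * F 0.
Proof.
move=> Fe mF.
have mG : measurable_fun [set: R] (fun t : R => F (cexp (0 +i* t) * w)).
  by apply: (measurableT_comp mF); apply: measurable_funCM => //; exact: measurable_cexp_imag.
have /measurable_funCP[mr mi] := mG.
apply: complexP; rewrite /cintegral /= ?ReM ?ImM /= mul0r ?subr0 ?addr0.
  rewrite mulrC -(circle_mean_Re w Fe) -itv_int_lebesgue_R; last first.
    by under eq_fun do rewrite mulrC.
  by apply: eq_Rintegral => t _; rewrite ReM /= mul0r subr0 mulrC (mulrC w).
have ReNi (z : R[i]) : complex.Re (- 'i * z) = complex.Im z.
  by rewrite ReM /= oppr0 mul0r sub0r mulN1r opprK.
have := circle_mean_Re w (centireZ (- 'i) Fe); rewrite ReNi => E.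
rewrite [RHS]mulrC -E -itv_int_lebesgue_R; last first.
  by under eq_fun do rewrite ReNi (mulrC w); exact: mi.
by apply: eq_Rintegral => t _; rewrite ImM ReNi /= mul0r addr0 mulrC (mulrC w).
Qed.

Variables (k : R) (k0 : 0 < k).

(** By rotation invariance [F] may be replaced by its average over all rotations. Exchanging the
    integrals puts the average over the angle inside, and there it is the constant [F 0] by
    [circle_mean]. *)
Theorem gaussC_mean F : centire F -> cintegrable (gaussC k0) F ->
  cintegral (gaussC k0) F = F 0.
Proof.
move=> Fe Fi; have mF := cintegrable_measurable Fi.
pose f (p : R * R[i]) := (\1_(`[0, pi *+ 2]) p.1)%:C * F (cexp (0 +i* p.1) * p.2).
have m1 : measurable_fun [set: R] (\1_(`[0, pi *+ 2]%classic) : R -> R).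
  by apply: measurable_indic; exact: measurable_itv.
have mf : measurable_fun [set: R * R[i]] f.
  apply: measurable_funCM.
    by apply: measurable_fun_real; exact: (measurableT_comp m1 (@measurable_fst _ _ R R[i])).
  apply: (measurableT_comp mF); apply: measurable_funCM => //.
  exact: (measurableT_comp measurable_cexp_imag (@measurable_fst _ _ R R[i])).
have leb : @lebesgue_R R `[0, pi *+ 2]%classic = (pi *+ 2)%:E.
  have /= := @lebesgue_measure_itv R `[0, pi *+ 2]; rewrite /lebesgue_R => ->.
  by rewrite lte_fin pmulrn_lgt0// pi_gt0 sube0.
have indI : (\int[@lebesgue_R R]_t (\1_(`[0%R, (pi *+ 2)%R]) t)%:E = (pi *+ 2)%:E)%E.
  by rewrite integral_indic// setIT; exact: leb.
have rotF (t : R) : cintegrable (gaussC k0) (fun z => F (cexp (0 +i* t) * z)).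
  apply: (cintegrable_preserving (measurable_mulCl _) _ Fi) => A mA.
  by apply: gaussC_rotation => //; rewrite normc_cexp /= expR0.
have rotE (t : R) : cintegral (gaussC k0) (fun z => F (cexp (0 +i* t) * z)) =
    cintegral (gaussC k0) F.
  by apply: cintegral_gaussC_rotation => //; rewrite normc_cexp /= expR0.
have fi : cintegrable (@lebesgue_R R \x gaussC k0)%E f.
  apply/cintegrable_prod12P => //=.
  have E (t : R) : (\int[gaussC k0]_z (normc (f (t, z)))%:E =
      (\1_(`[0, pi *+ 2]) t)%:E * \int[gaussC k0]_z (normc (F z))%:E)%E.
    rewrite -(integral_preserving_ge0 (measurable_mulCl (cexp (0 +i* t)))
      (gaussC_rotation k0 _) (f := fun z => (normc (F z))%:E)).
    - rewrite -ge0_integralZl_EFin//.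
      + by apply: eq_integral => z _; rewrite /f /= normcM normc_real ger0_norm.
      + by move=> z _; rewrite lee_fin normc_ge0.
      + by apply/measurable_EFinP/measurable_fun_normc; have /cintegrable_measurable := rotF t.
    - by rewrite normc_cexp /= expR0.
    - exact/measurable_EFinP/measurable_fun_normc.
    - by move=> z; rewrite lee_fin normc_ge0.
  under eq_integral do rewrite E.
  have /cintegrableP[_ Foo] := Fi.
  have F0 : (0 <= \int[gaussC k0]_z (normc (F z))%:E)%E.
    by apply: integral_ge0 => z _; rewrite lee_fin normc_ge0.
  rewrite ge0_integralZr//; last exact/measurable_EFinP.
  by rewrite indI -(@fineK _ (\int[_]_z _)%E) -?EFinM ?ltry// ge0_fin_numE.
have := cfubini fi.
have -> : (fun y => cintegral (@lebesgue_R R) (fun x => f (x, y))) = (fun=> (pi *+ 2)%:C * F 0).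
  by apply/funext => w; rewrite /f /= circle_mean.
have -> : (fun x => cintegral (gaussC k0) (fun y => f (x, y))) =
    (fun t => cintegral (gaussC k0) F * (\1_(`[0, pi *+ 2]) t)%:C).
  by apply/funext => t; rewrite /f /= cintegralZ// rotE mulrC.
have ind : cintegrable (@lebesgue_R R) (fun t => (\1_(`[0, pi *+ 2]) t)%:C).
  apply/cintegrableP; split; first exact: measurable_fun_real.
  under eq_integral do rewrite normc_real ger0_norm//.
  by rewrite indI ltry.
rewrite cintegralZ//.
have -> : cintegral (@lebesgue_R R) (fun t => (\1_(`[0, pi *+ 2]) t)%:C) = (pi *+ 2)%:C.
  apply: complexP => /=; last by rewrite /Rintegral integral0_eq.
  by rewrite /Rintegral indI.
have -> : cintegral (gaussC k0) (fun=> (pi *+ 2)%:C * F 0) = (pi *+ 2)%:C * F 0.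
  apply: complexP; rewrite /cintegral /=.
    by rewrite Rintegral_cst// [X in fine X](@probability_setT _ _ R (gaussC k0)) mulr1.
  by rewrite Rintegral_cst// [X in fine X](@probability_setT _ _ R (gaussC k0)) mulr1.
rewrite mulrC; apply: mulfI; rewrite -normc_eq0 normc_real normr_eq0.
by rewrite gt_eqF// pmulrn_lgt0// pi_gt0.
Qed.

End circle_mean.

(** * The reproducing property, in one and in several variables *)

Section reproducing.
Context {R : realType}.
Implicit Types (H : R[i] -> R[i]) (a z w : R[i]).

Lemma centireM H G : centire H -> centire G -> centire (fun z => H z * G z).
Proof. by move=> He Ge z; exact: cdiffM. Qed.

Lemma centire_shift H a b : centire H -> centire (fun z => H (a * z + b)).
Proof.
move=> He z; apply: (@cdiff_comp _ H (fun z => a * z + b)) => //.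
exact: cdiff_affine.
Qed.

Lemma centire_cexp a b : centire (fun z => cexp (a * z + b)).
Proof. by apply: (@centire_shift (@cexp R)) => z; exact: cdiff_cexp. Qed.

Local Notation lam := (gaussC (@ltr01 R)).

Lemma gaussC1_pdfE z : (gaussC_pdf 1 z)%:C = (1 / pi)%:C * cexp (- (z * (z^*)%C)).
Proof. by rewrite mulcJ /gaussC_pdf -rmorphN cexp_real -rmorphM !mul1r. Qed.

Lemma measurable_conjC : measurable_fun [set: R[i]] (fun w => (w^*)%C).
Proof. by apply: measurable_funCJ; exact: measurable_id. Qed.

(* Translating by [a] turns the kernel into a holomorphic factor, to which the
   mean value property applies. *)
Theorem gaussC_reproducing H a : centire H ->
  cintegrable lam (fun w => H w * cexp (a * (w^*)%C)) ->
  cintegral lam (fun w => H w * cexp (a * (w^*)%C)) = H a.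
Proof.
move=> He fi; have mf := cintegrable_measurable fi.
pose g u := H (1 * u + a) * cexp (- (a^*)%C * u + 0).
have ge : centire g by apply: centireM; [exact: centire_shift|exact: centire_cexp].
have mt : measurable_fun [set: R[i]] (fun z => z + a).
  by apply: measurable_funCD => //; exact: measurable_id.
(* In [a conj(u + a) - |u + a|^2] the terms [a conj u] and [|a|^2] cancel, leaving
   [- conj a u - |u|^2]: a holomorphic exponent plus that of the Gaussian. *)
have ga u : H (u + a) * cexp (a * ((u + a)^*)%C) * (gaussC_pdf 1 (u + a))%:C =
    g u * (gaussC_pdf 1 u)%:C.
  rewrite /g mul1r addr0 -!mulrA; congr (_ * _); rewrite !gaussC1_pdfE !rmorphD /=.
  rewrite mulrCA [RHS]mulrCA; congr (_ * _); rewrite -!cexpD; congr cexp; ring.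
have mg : measurable_fun [set: R[i]] g.
  have mH : measurable_fun [set: R[i]] H.
    rewrite (_ : H = fun w => (H w * cexp (a * (w^*)%C)) * cexp (- (a * (w^*)%C))); last first.
      by apply/funext => w; rewrite -mulrA -cexpD subrr cexp0 mulr1.
    apply: measurable_funCM => //; apply: measurable_fun_cexp.
    rewrite (_ : (fun w => _) = fun w => - a * (w^*)%C).
      by apply: measurable_funCM => //; exact: measurable_conjC.
    by apply/funext => w; rewrite mulNr.
  apply: measurable_funCM.
    by rewrite (_ : (fun u => H (1 * u + a)) = H \o (fun u => u + a)); [exact: measurableT_comp|apply/funext => u; rewrite mul1r].
  apply: measurable_fun_cexp; apply: measurable_funCD => //.
  by apply: measurable_funCM => //; exact: measurable_id.
have fL := (cintegrable_density _ _ _ mf).1 fi.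
have gL := cintegrable_preserving mt (@lebesgue_C_translation R a) fL.
rewrite cintegral_density// -(cintegral_preserving mt (@lebesgue_C_translation R a) fL).
have E : (fun w => H w * cexp (a * (w^*)%C) * (gaussC_pdf 1 w)%:C) \o (fun z => z + a) =
    (fun u => g u * (gaussC_pdf 1 u)%:C).
  by apply/funext => u; exact: ga.
rewrite E in gL *.
have gi : cintegrable lam g by exact/(cintegrable_density _ _ _ mg).
rewrite -(cintegral_density (measurable_gaussC_pdf 1) (gaussC_pdf_ge0 ltr01) (integral_gaussC_pdf ltr01) mg).
by rewrite gaussC_mean// /g mulr0 add0r mulr0 addr0 cexp0 mulr1.
Qed.

End reproducing.

Section reproducing_n.
Context {R : realType}.
Local Notation lam := (gaussC (@ltr01 R)).

(** Holomorphy along complex lines only. It follows from [entire], is inherited by slices with fixed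
    coordinates, and can be checked with one-variable lemmas. *)
Definition lin_entire n (H : 'rV[R[i]]_n -> R[i]) :=
  forall v u, centire (fun t => H (v + t *: u)).

Lemma dotv_cons n (x y : R[i]) (v w : 'rV[R[i]]_n) :
  dotv (cons_rV (x, v)) (cons_rV (y, w)) = x * y + dotv v w.
Proof.
rewrite /dotv big_ord_recl; congr (_ + _); first by rewrite !mxE unlift_none.
by apply: eq_bigr => j _; rewrite !mxE liftK.
Qed.

Lemma conjv_cons n (x : R[i]) (v : 'rV[R[i]]_n) :
  conjv (cons_rV (x, v)) = cons_rV ((x^*)%C, conjv v).
Proof. by apply/rowP => j; rewrite !mxE; case: unliftP => [k|] //=; rewrite !mxE. Qed.

Lemma cons_rVD n (x y t : R[i]) (v w : 'rV[R[i]]_n) :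
  cons_rV (x, v) + t *: cons_rV (y, w) = cons_rV (x + t * y, v + t *: w).
Proof. by apply/rowP => j; rewrite !mxE; case: unliftP => [k|] //=; rewrite !mxE. Qed.

Lemma measurable_dotv_conjv n (a : 'rV[R[i]]_n) :
  measurable_fun [set: 'rV[R[i]]_n] (fun w => dotv a (conjv w)).
Proof.
apply: measurable_fun_csum => j; apply: measurable_funCM => //.
under eq_fun do rewrite mxE.
exact: (measurableT_comp measurable_conjC (measurable_coord _)).
Qed.

(** Induction on the dimension: for a fixed first coordinate the slice is reproduced by the
    induction hypothesis, which sets the other coordinates to [a']; the one-variable theorem then
    treats the first coordinate. *)
Theorem reproducing n (H : 'rV[R[i]]_n -> R[i]) a : lin_entire H ->
  cintegrable (power_measure lam n) (fun w => H w * cexp (dotv a (conjv w))) ->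
  cintegral (power_measure lam n) (fun w => H w * cexp (dotv a (conjv w))) = H a.
Proof.
elim: n H a => [|n IH] H a He fi; have mf := cintegrable_measurable fi.
  have [_ ->] := cintegral_power0 lam mf.
  rewrite /dotv big_ord0 cexp0 mulr1; congr H.
  by apply/rowP => -[].
(* The exponential factor never vanishes, so measurability of [H] is read off from that of the
   integrand by multiplying with its inverse. *)
have mH : measurable_fun [set: 'rV[R[i]]_n.+1] H.
  rewrite (_ : H = fun w => (H w * cexp (dotv a (conjv w))) * cexp (- dotv a (conjv w))); last first.
    by apply/funext => w; rewrite -mulrA -cexpD subrr cexp0 mulr1.
  apply: measurable_funCM => //; apply: measurable_fun_cexp.
  under eq_fun do rewrite -mulN1r.
  by apply: measurable_funCM => //; exact: measurable_dotv_conjv.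
rewrite -(uncons_rVK a) in fi mf *; case: (uncons_rV a) fi mf => a0 a' fi mf.
rewrite cintegral_powerS//.
have fi' := (cintegrable_powerSP _ mf).1 fi.
have [ae_i i1 <-] := cfubini1 fi'.
have E x (v : 'rV[R[i]]_n) : H (cons_rV (x, v)) *
    cexp (dotv (cons_rV (a0, a')) (conjv (cons_rV (x, v)))) =
    (H (cons_rV (x, v)) * cexp (a0 * (x^*)%C)) * cexp (dotv a' (conjv v)).
  by rewrite conjv_cons dotv_cons cexpD mulrA.
have IHx x : cintegrable (power_measure lam n) (fun v =>
      H (cons_rV (x, v)) * cexp (dotv (cons_rV (a0, a')) (conjv (cons_rV (x, v))))) ->
    cintegral (power_measure lam n) (fun v =>
      H (cons_rV (x, v)) * cexp (dotv (cons_rV (a0, a')) (conjv (cons_rV (x, v))))) =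
    H (cons_rV (x, a')) * cexp (a0 * (x^*)%C).
  under eq_fun do rewrite E.
  apply: (IH (fun v => H (cons_rV (x, v)) * cexp (a0 * (x^*)%C))) => v u.
  rewrite (_ : (fun t => _) = fun t => cexp (a0 * (x^*)%C) * H (cons_rV (x, v) + t *: cons_rV (0 : R[i], u : 'rV[R[i]]_n))).
    exact: centireZ.
  by apply/funext => t; rewrite cons_rVD mulr0 addr0 mulrC.
(* Fubini makes the slices integrable for almost every [x] only, so the induction hypothesis
   identifies the inner integral merely almost everywhere. *)
have [||gi ->] := @cintegral_ae _ _ _ _ _ (fun x => H (cons_rV (x, a')) * cexp (a0 * (x^*)%C)) i1.
- apply: measurable_funCM.
    apply: (measurableT_comp mH); apply: (measurableT_comp (measurable_cons_rV (n := n))).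
    exact: measurable_pair2.
  apply: measurable_fun_cexp; apply: measurable_funCM => //; exact: measurable_conjC.
- by apply: filterS ae_i => x /= xi; exact: IHx.
apply: (gaussC_reproducing (H := fun x => H (cons_rV (x, a')))) => //.
rewrite (_ : (fun x => _) = fun t => H (cons_rV (0 : R[i], a') + t *: cons_rV (1 : R[i], 0 : 'rV[R[i]]_n))); first exact: He.
by apply/funext => t; rewrite cons_rVD mulr1 add0r scaler0 addr0.
Qed.

End reproducing_n.

(** * The Laplace transform of the Gaussian on the line *)

Section characteristic_function.
Context {R : realType}.
Local Notation mu := (gaussR (@ltr0n R 2)).
Implicit Types u : R[i].

Lemma gaussR_exp_integrable (c : R) : mu.-integrable [set: R] (fun x => (expR (c * `|x|))%:E).
Proof.
have me : measurable_fun [set: R] (fun x : R => expR (c * `|x|)).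
  by apply: measurableT_comp => //; apply: measurable_funM => //; exact: measurableT_comp.
apply/(density_integrableP _ _ _ me).
have i1 := (density_integrableP (measurable_gaussR_pdf 1) (gaussR_pdf_ge0 ltr01)
  (integral_gaussR_pdf ltr01) (measurable_cst (1 : R))).1.
have {}i1 : (@lebesgue_R R).-integrable [set: R] (EFin \o (fun x => 1 * gaussR_pdf 1 x)).
  apply: i1; apply/integrableP; split; first exact/measurable_EFinP.
  under eq_integral do rewrite /= normr1.
  by rewrite integral_cst// mul1e [X in (X < _)%E](@probability_setT _ _ R (gaussR ltr01)) ltry.
(* Completing the square gives [c y - 2 y^2 <= c^2 / 4 - y^2]; the square roots exchange the
   normalization for [k = 1] with the one for [k = 2]. *)
pose K := expR (c ^+ 2 / 4) * (Num.sqrt (2 / pi) / Num.sqrt (1 / pi)).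
have := integrableZl measurableT K i1; apply: le_integrable => //.
  by apply/measurable_EFinP/measurable_funM => //; exact: measurable_gaussR_pdf.
move=> x _ /=; rewrite lee_fin [leLHS]ger0_norm ?[leRHS]ger0_norm; last 2 first.
- apply: mulr_ge0; last by rewrite mul1r gaussR_pdf_ge0.
  by apply: mulr_ge0; [exact: expR_ge0|rewrite divr_ge0// sqrtr_ge0].
- by apply: mulr_ge0; [exact: expR_ge0|apply: gaussR_pdf_ge0; rewrite ltr0n].
have s1 : 0 < Num.sqrt (1 / pi) :> R by rewrite sqrtr_gt0 divr_gt0// pi_gt0.
rewrite /gaussR_pdf mul1r /K.
rewrite [leRHS](_ : _ = Num.sqrt (2 / pi) * (expR (c ^+ 2 / 4) * expR (- (1 * x ^+ 2)))); last first.
  by field; rewrite gt_eqF.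
rewrite mulrCA ler_wpM2l ?sqrtr_ge0// -!expRD ler_expR.
have := sqr_ge0 (`|x| - c / 2); rewrite -(real_normK (num_real x)).
move: `|x| => y; nra.
Qed.

Lemma gaussR_cexp_integrable u : cintegrable mu (fun x => cexp (u * x%:C)).
Proof.
apply: (cintegrable_le _ (gaussR_exp_integrable (normc u))).
  apply: measurable_fun_cexp; apply: measurable_funCM => //; apply: measurable_fun_real.
  exact: measurable_id.
move=> x; rewrite normc_cexp ler_expR (le_trans (ler_norm _))//.
by rewrite (le_trans (normr_Re_le _))// normcM normc_real.
Qed.

Lemma lebesgue_R_translation (c : R) A : measurable A ->
  @lebesgue_R R ((fun x => x + c) @^-1` A) = @lebesgue_R R A.
Proof.
move=> mA.
have mt : measurable_fun [set: R] (fun x => x + c) by exact: measurable_funD.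
have E B : measurable B -> (\int[@lebesgue_R R]_x (\1_B x)%:E = @lebesgue_R R B)%E.
  by move=> mB; rewrite integral_indic// setIT.
rewrite -!E//; last by rewrite -[X in measurable X]setTI; exact: mt.
apply: (@ge0_integral_shift R (fun x => (\1_A x)%:E) c).
- exact/measurable_EFinP.
- by move=> x; rewrite lee_fin.
Qed.

Lemma cintegral_lebesgue_C (g : R[i] -> R[i]) : measurable_fun [set: R[i]] g ->
  cintegrable (@lebesgue_R R \x @lebesgue_R R)%E (g \o @complex_of R) ->
  cintegrable (@lebesgue_C R) g /\
  cintegral (@lebesgue_C R) g = cintegral (@lebesgue_R R \x @lebesgue_R R)%E (g \o @complex_of R).
Proof.
move=> mg gi; have [mr mi] := (measurable_funCP _).1 mg.
have gC : cintegrable (@lebesgue_C R) g.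
  apply/cintegrableP; split => //; rewrite ge0_integral_lebesgue_C12.
  - by have := (cintegrable_prod12P _ _ (cintegrable_measurable gi)).1 gi.
  - exact/measurable_EFinP/measurable_fun_normc.
  - by move=> z; rewrite lee_fin normc_ge0.
split => //; have [gr gim] := gC; have [gr' gim'] := gi.
apply: complexP => /=; rewrite /Rintegral; congr fine.
  transitivity (\int[pushforward (@lebesgue_R R \x @lebesgue_R R)%E (@complex_of R)]_z (complex.Re (g z))%:E)%E.
    by [].
  by rewrite (integral_pushforward (@measurable_complex_of R))//; exact/measurable_EFinP.
transitivity (\int[pushforward (@lebesgue_R R \x @lebesgue_R R)%E (@complex_of R)]_z (complex.Im (g z))%:E)%E.
  by [].
by rewrite (integral_pushforward (@measurable_complex_of R))//; exact/measurable_EFinP.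
Qed.

Let A (u : R[i]) : R[i] := cintegral mu (fun x => cexp (u * x%:C)).

Let measurable_cexp_lin u : measurable_fun [set: R] (fun x : R => cexp (u * x%:C)).
Proof.
apply: measurable_fun_cexp; apply: measurable_funCM => //; apply: measurable_fun_real.
exact: measurable_id.
Qed.

Let E u (x : R) := cexp (u * x%:C) * (gaussR_pdf 2 x)%:C.

Let Ei u : cintegrable (@lebesgue_R R) (E u).
Proof.
have [+ _] := cintegrable_density (measurable_gaussR_pdf 2) (gaussR_pdf_ge0 (ltr0n R 2))
  (integral_gaussR_pdf (ltr0n R 2)) (measurable_cexp_lin u).
by apply; exact: gaussR_cexp_integrable.
Qed.

Let AE u : A u = cintegral (@lebesgue_R R) (E u).
Proof. exact: cintegral_density. Qed.

(* The two-dimensional mean value property applied to [e^{uz}]. *)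
Let A_mul u : A u * A (u * 'i) = 1.
Proof.
pose F z := cexp (u * z + 0).
have mF : measurable_fun [set: R[i]] F.
  by apply: measurable_fun_cexp; apply: measurable_funCD => //; apply: measurable_funCM.
have mpdf : measurable_fun [set: R[i]] (fun z => (gaussC_pdf 2 z)%:C).
  by apply: measurable_fun_real; exact: measurable_gaussC_pdf.
have FE x y : F (x +i* y) * (gaussC_pdf 2 (x +i* y))%:C = E u x * E (u * 'i) y.
  rewrite gaussC_pdfE ?ltr0n// rmorphM /E mulrACA -cexpD; congr (cexp _ * _).
  by apply: complexP; rewrite /F addr0 !(ReD, ImD, ReM, ImM) /=; ring.
have FC x y : ((fun z => F z * (gaussC_pdf 2 z)%:C) \o @complex_of R) (x, y) =
    E u x * E (u * 'i) y by exact: FE.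
have prodi : cintegrable (@lebesgue_R R \x @lebesgue_R R)%E
    ((fun z => F z * (gaussC_pdf 2 z)%:C) \o @complex_of R).
  apply: (@cintegrable_prod_le _ _ _ _ _ (@lebesgue_R R) (@lebesgue_R R) _
    (fun x => normc (E u x)) (fun y => normc (E (u * 'i) y))).
  - apply: measurableT_comp; last exact: measurable_complex_of.
    exact: measurable_funCM.
  - exact: integrable_normc.
  - exact: integrable_normc.
  - by move=> x; exact: normc_ge0.
  - by move=> y; exact: normc_ge0.
  - by move=> x y; rewrite FC normcM.
have [Ci CE] := cintegral_lebesgue_C (measurable_funCM mF mpdf) prodi.
have [_ +] := cintegrable_density (measurable_gaussC_pdf 2) (gaussC_pdf_ge0 (ltr0n R 2))
  (integral_gaussC_pdf (ltr0n R 2)) mF.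
move=> /(_ Ci) Fi.
have := gaussC_mean (@centire_cexp R u 0) Fi.
rewrite mulr0 addr0 cexp0.
rewrite (cintegral_density (measurable_gaussC_pdf 2) (gaussC_pdf_ge0 (ltr0n R 2))
  (integral_gaussC_pdf (ltr0n R 2)) mF) CE => <-.
have [_ _ <-] := cfubini1 prodi.
under [RHS]eq_cintegral do (under eq_cintegral do rewrite FC; rewrite cintegralZ// mulrC).
by rewrite cintegralZ// !AE mulrC.
Qed.

(** Substituting [x + p / 4] for [x] turns [- 2 x^2] into [- 2 x^2 - p x - p^2 / 8], and the new
    linear term moves the argument [u] by [- p]. *)
Let A_shift u (p : R) : A u = cexp (u * (p / 4)%:C - (p ^+ 2 / 8)%:C) * A (u - p%:C).
Proof.
have mt : measurable_fun [set: R] (fun x => x + p / 4) by exact: measurable_funD.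
rewrite !AE -(cintegral_preserving mt (@lebesgue_R_translation (p / 4)) (Ei u)).
rewrite -cintegralZ//; apply: eq_cintegral => x /=.
have EE v y : E v y = (Num.sqrt (2 / pi))%:C * cexp (v * y%:C - (2 * y ^+ 2)%:C).
  rewrite /E /gaussR_pdf (_ : (_ * expR _)%:C = (Num.sqrt (2 / pi))%:C * (expR (- (2 * y ^+ 2)))%:C).
    by rewrite -cexp_real mulrCA -cexpD rmorphN.
  by rewrite rmorphM.
rewrite !EE [RHS]mulrCA -cexpD; congr (_ * cexp _).
by apply: complexP; rewrite !(ReD, ImD, ReM, ImM, ReN, ImN) /=; field.
Qed.

Let A0 : A 0 = 1.
Proof.
have E1 : (fun x : R => cexp (0 * x%:C)) = cst 1 by apply/funext => x; rewrite mul0r cexp0.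
rewrite /A E1; apply: complexP; rewrite /cintegral /=.
  by rewrite Rintegral_cst// [X in fine X](@probability_setT _ _ R mu) mulr1.
by rewrite Rintegral_cst// mul0r.
Qed.

(** [A_shift] by [u] itself settles real [u], [A_mul] then gives imaginary [u], and [A_shift] by the
    real part of [u] reduces the general case to the imaginary one. *)
Theorem gaussR_cexp u : cintegral mu (fun x => cexp (u * x%:C)) = cexp (u ^+ 2 / 8).
Proof.
have Ar (p : R) : A p%:C = cexp (p ^+ 2 / 8)%:C.
  rewrite (A_shift _ p) subrr A0 mulr1; congr cexp.
  by apply: complexP; rewrite !(ReD, ImD, ReM, ImM, ReN, ImN) /=; field.
have Ai (q : R) : A (q%:C * 'i) = cexp (- (q ^+ 2 / 8)%:C).
  have := A_mul q%:C; rewrite Ar => /(congr1 (fun z => cexp (- (q ^+ 2 / 8)%:C) * z)).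
  by rewrite mulrA -cexpD addNr cexp0 mul1r mulr1.
rewrite -/(A u) (A_shift _ (complex.Re u)).
rewrite (_ : u - _ = (complex.Im u)%:C * 'i); last first.
  by apply: complexP; rewrite !(ReD, ImD, ReM, ImM, ReN, ImN) /=; ring.
rewrite Ai -cexpD; congr cexp.
case: u => p q; rewrite expr2 -[8]/(8%:R) -(rmorph_nat (real_complex R)) -fmorphV.
by apply: complexP; rewrite !(ReD, ImD, ReM, ImM, ReN, ImN) /=; field.
Qed.

End characteristic_function.

(** * Density of trigonometric polynomials *)

Import HBNNSimple.

Section trigonometric_closure.
Variables (R : realType) (n : nat).
Implicit Types (f g : 'rV[R]_n -> R[i]) (s t : seq (R[i] * 'rV[R]_n)).

Definition trig s (x : 'rV[R]_n) : R[i] :=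
  \sum_(p <- s) p.1 * cexp ('i%C * (\sum_j p.2 ord0 j * x ord0 j)%:C).

(** An inductive predicate, because one passage to the limit does not suffice. Its induction
    principle extends to all bounded measurable functions any property of trigonometric polynomials
    that survives bounded pointwise limits. *)
Inductive trig_closure f : Prop :=
| trig_closure_trig s of f =1 trig s
| trig_closure_lim (f_ : nat -> 'rV[R]_n -> R[i]) (M : R) of
    (forall k, trig_closure (f_ k)) & (forall k x, normc (f_ k x) <= M) &
    (forall x, ccvg (f_^~ x) (f x)).

Lemma trig_cat s t x : trig (s ++ t) x = trig s x + trig t x.
Proof. exact: big_cat. Qed.

Lemma trigM s t x : trig s x * trig t x =
  trig [seq (p.1 * q.1, p.2 + q.2) | p <- s, q <- t] x.
Proof.
rewrite /trig big_allpairs_dep mulr_suml; apply: eq_bigr => p _.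
rewrite mulr_sumr; apply: eq_bigr => q _ /=.
rewrite mulrACA -cexpD -mulrDr -rmorphD -big_split/=.
by congr (_ * cexp ('i%C * (_)%:C)); apply: eq_bigr => j _; rewrite mxE mulrDl.
Qed.

Lemma normc_cexp_imag (y : R) : normc (cexp ('i%C * y%:C)) = 1.
Proof. by rewrite normc_cexp ReM /= mulr0 mul0r subrr expR0. Qed.

Lemma measurable_trig s : measurable_fun [set: 'rV[R]_n] (trig s).
Proof.
apply: measurable_fun_csum => p; apply: measurable_funCM => //.
apply: measurable_fun_cexp; apply: measurable_funCM => //.
apply: measurable_fun_real; apply: measurable_sum => j.
by apply: measurable_funM => //; exact: measurable_coord.
Qed.

Lemma trig_bounded s : exists M : R, forall x, normc (trig s x) <= M.
Proof.
exists (\sum_(p <- s) normc p.1) => x.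
apply: le_trans (normc_sum _ _ _) _; apply: ler_sum => p _.
by rewrite normcM normc_cexp_imag mulr1.
Qed.

Lemma trig_closure_bounded f : trig_closure f -> exists M : R, forall x, normc (f x) <= M.
Proof.
elim=> {f} [f s fs|f f_ M _ _ fM cf].
  by have [M sM] := trig_bounded s; exists M => x; rewrite fs.
by exists M => x; apply: ccvg_bounded (cf x) => k.
Qed.

Lemma trig_closure_measurable f : trig_closure f -> measurable_fun [set: 'rV[R]_n] f.
Proof.
elim=> {f} [f s fs|f f_ M _ mf fM cf]; last exact: measurable_fun_ccvg cf.
by rewrite (_ : f = trig s) ?funeqE//; exact: measurable_trig.
Qed.

(** Only one argument passes to the limit at a time: induction on [f], with an inner induction on
    [g] when [f] is a trigonometric polynomial. The function held fixed is bounded, which provides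
    the uniform bound for the limit clause. *)
Lemma trig_closureD f g : trig_closure f -> trig_closure g -> trig_closure (fun x => f x + g x).
Proof.
move=> df; elim: df g => {f} [f s fs g|f f_ M df IH fM cf g dg].
  elim=> {g} [g t gt|g g_ M dg IH gM cg].
    by apply: (@trig_closure_trig _ (s ++ t)) => x; rewrite fs gt trig_cat.
  have [Mf fM] := trig_bounded s.
  apply: (@trig_closure_lim _ (fun k x => f x + g_ k x) (Mf + M)) => //.
    by move=> k x; rewrite (le_trans (le_normcD _ _))// lerD// fs.
  by move=> x; apply: ccvgD => //; exact: ccvg_cst.
have [Mg gM] := trig_closure_bounded dg.
apply: (@trig_closure_lim _ (fun k x => f_ k x + g x) (M + Mg)) => //.
- by move=> k; exact: IH.
- by move=> k x; rewrite (le_trans (le_normcD _ _))// lerD.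
by move=> x; apply: ccvgD => //; exact: ccvg_cst.
Qed.

Lemma trig_closureM f g : trig_closure f -> trig_closure g -> trig_closure (fun x => f x * g x).
Proof.
move=> df; elim: df g => {f} [f s fs g|f f_ M df IH fM cf g dg].
  elim=> {g} [g t gt|g g_ M dg IH gM cg].
    by eapply trig_closure_trig => x; rewrite fs gt trigM.
  have [Mf fM] := trig_bounded s.
  apply: (@trig_closure_lim _ (fun k x => f x * g_ k x) (Mf * M)) => //.
    by move=> k x; rewrite normcM ler_pM ?normc_ge0// fs.
  by move=> x; apply: ccvgM => //; exact: ccvg_cst.
have [Mg gM] := trig_closure_bounded dg.
apply: (@trig_closure_lim _ (fun k x => f_ k x * g x) (M * Mg)) => //.
- by move=> k; exact: IH.
- by move=> k x; rewrite normcM ler_pM ?normc_ge0.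
by move=> x; apply: ccvgM => //; exact: ccvg_cst.
Qed.

Lemma trig_closure_cst c : trig_closure (fun=> c).
Proof.
apply: (@trig_closure_trig _ [:: (c, 0)]) => x.
rewrite /trig big_seq1 big1 ?rmorph0 ?mulr0 ?cexp0 ?mulr1// => j _.
by rewrite mxE mul0r.
Qed.

Lemma eq_trig_closure f g : f =1 g -> trig_closure f -> trig_closure g.
Proof. by move=> /funext ->. Qed.

Lemma trig_closureZ c f : trig_closure f -> trig_closure (fun x => c * f x).
Proof. exact: trig_closureM (trig_closure_cst c). Qed.

Lemma trig_closureX f k : trig_closure f -> trig_closure (fun x => f x ^+ k).
Proof.
move=> df; elim: k => [|k IH]; first exact: trig_closure_cst.
by apply: eq_trig_closure (trig_closureM df IH) => x; rewrite exprS.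
Qed.

Lemma trig_closure_sum I (r : seq I) (F : I -> 'rV[R]_n -> R[i]) :
  (forall i, trig_closure (F i)) -> trig_closure (fun x => \sum_(i <- r) F i x).
Proof.
move=> dF; elim: r => [|i r IH].
  by apply: eq_trig_closure (trig_closure_cst 0) => x; rewrite big_nil.
by apply: eq_trig_closure (trig_closureD (dF i) IH) => x; rewrite big_cons.
Qed.

(* The Newton-like iteration [u <- u + (y^2 - u^2) / 2] increases to [|y|] when [|y| <= 1]. *)
Fixpoint abs_iter (y : R) k : R :=
  if k is k'.+1 then abs_iter y k' + (y ^+ 2 - abs_iter y k' ^+ 2) / 2 else 0.

(** With [u] the current iterate, one step multiplies the gap [|y| - u] by [1 - (|y| + u) / 2],
    which is nonnegative since [|y| <= 1] and at most [1 - |y| / 2] since [u >= 0]. *)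
Lemma abs_iter_bound (y : R) k : `|y| <= 1 ->
  0 <= abs_iter y k <= `|y| /\ `|y| - abs_iter y k <= `|y| * (1 - `|y| / 2) ^+ k.
Proof.
move=> y1; have y0 := normr_ge0 y.
have E : forall k, abs_iter y k.+1 = abs_iter y k + (`|y| ^+ 2 - abs_iter y k ^+ 2) / 2.
  by move=> j /=; rewrite real_normK ?num_real.
elim: k => [|k [/andP[u0 uy] IH]]; first by rewrite /= lexx y0 subr0 expr0 mulr1 lexx.
rewrite E; set u := abs_iter y k in u0 uy IH *; set r : R := `|y| in y0 y1 uy IH *.
set e := (1 - r / 2) ^+ k in IH.
have h : r - (u + (r ^+ 2 - u ^+ 2) / 2) = (r - u) * (1 - (r + u) / 2) by field.
split.
  apply/andP; split; first by nra.
  rewrite -subr_ge0 h; apply: mulr_ge0; lra.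
rewrite h exprS mulrCA; apply: le_trans (_ : (r - u) * (1 - r / 2) <= _).
  by apply: ler_wpM2l; lra.
by rewrite mulrC; apply: ler_wpM2l => //; lra.
Qed.

Lemma trig_closure_abs (f : 'rV[R]_n -> R) : (forall x, `|f x| <= 1) ->
  trig_closure (fun x => (f x)%:C) -> trig_closure (fun x => `|f x|%:C).
Proof.
move=> f1 df.
apply: (@trig_closure_lim _ (fun k x => (abs_iter (f x) k)%:C) 1).
- elim=> [|k IH] /=; first exact: trig_closure_cst.
  apply: eq_trig_closure (trig_closureD IH (trig_closureZ ((2^-1)%:C)
    (trig_closureD (trig_closureX 2 df) (trig_closureZ (-1) (trig_closureX 2 IH))))) => x.
  by rewrite mulN1r -!rmorphXn -rmorphB -rmorphM -rmorphD mulrC.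
- move=> k x; have [/andP[u0 uy] _] := abs_iter_bound k (f1 x).
  by rewrite normc_real ger0_norm// (le_trans uy).
move=> x; apply: ccvg_real.
have h (k : nat) := abs_iter_bound k (f1 x).
have [->|fx0] := eqVneq (f x) 0.
  rewrite normr0; under eq_cvg => k.
    have -> : abs_iter 0 k = 0 :> R.
      by elim: k => //= k ->; rewrite expr0n /= subrr mul0r addr0.
    over.
  exact: cvg_cst.
have e0 : `|f x| * (1 - `|f x| / 2) ^+ k @[k --> \oo] --> (0 : R).
  rewrite -[X in _ --> X](mulr0 `|f x|); apply: cvgM; first exact: cvg_cst.
  have f0 : 0 < `|f x| by rewrite normr_gt0.
  have := f1 x => f1x; apply: cvg_expr; rewrite ger0_norm; lra.
have e1 : `|f x| - `|f x| * (1 - `|f x| / 2) ^+ k @[k --> \oo] --> `|f x|.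
  by rewrite -[X in _ --> X](subr0 `|f x|); apply: cvgB e0; exact: cvg_cst.
apply: (squeeze_cvgr _ e1 (cvg_cst `|f x|)).
apply: nearW => k; have [/andP[_ ->] h2] := h k; rewrite andbT.
by rewrite lerBlDr -lerBlDl.
Qed.

(* [1 - (1 - f^+)^k] tends to the indicator of [f > 0]. *)
Lemma trig_closure_indic_gt0 (f : 'rV[R]_n -> R) : (forall x, `|f x| <= 1) ->
  trig_closure (fun x => (f x)%:C) -> trig_closure (fun x => (0 < f x)%R%:R).
Proof.
move=> f1 df; have da := trig_closure_abs f1 df.
pose g x := (f x + `|f x|) / 2.
have dg : trig_closure (fun x => (g x)%:C).
  apply: eq_trig_closure (trig_closureZ ((2^-1)%:C) (trig_closureD df da)) => x.
  by rewrite -rmorphD -rmorphM mulrC.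
have gE x : g x = if 0 < f x then f x else 0.
  rewrite /g; case: ltP => h; first by rewrite gtr0_norm//; lra.
  by rewrite ler0_norm//; lra.
have g01 x : 0 <= g x <= 1.
  by rewrite gE; case: ltP => h; rewrite ?lexx ?ler01// ltW//= (le_trans (ler_norm _)).
apply: (@trig_closure_lim _ (fun k x => (1 - (1 - g x) ^+ k)%:C) 1).
- move=> k; apply: eq_trig_closure (trig_closureD (trig_closure_cst 1) (trig_closureZ (-1)
    (trig_closureX k (trig_closureD (trig_closure_cst 1) (trig_closureZ (-1) dg))))) => x.
  by rewrite !mulN1r -rmorphB -rmorphXn -rmorphB.
- move=> k x; rewrite normc_real ger0_norm.
    by rewrite gerBl exprn_ge0//; have := g01 x => /andP[? ?]; lra.
  by rewrite subr_ge0 exprn_ile1//; have := g01 x => /andP[? ?]; lra.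
move=> x; rewrite -(rmorph_nat (real_complex R)); apply: ccvg_real; rewrite gE; case: ltP => h /=.
  rewrite -[X in _ --> X](subr0 1); apply: cvgB; first exact: cvg_cst.
  apply: cvg_expr; have := f1 x; rewrite gtr0_norm// => f1x.
  by rewrite ger0_norm; lra.
under eq_cvg do rewrite subr0 expr1n subrr; exact: cvg_cst.
Qed.

Lemma trig_closure_sin (b : 'rV[R]_n) (c : R) :
  trig_closure (fun x : 'rV[R]_n => (sin (\sum_j b ord0 j * x ord0 j + c))%:C).
Proof.
pose s := [:: (cexp ('i%C * c%:C) / (2 * 'i%C), b); (- cexp ('i%C * (- c)%:C) / (2 * 'i%C), - b)].
apply: (@trig_closure_trig _ s) => x; rewrite /trig big_cons big_seq1 /=.
have -> : \sum_j (- b) ord0 j * x ord0 j = - \sum_j b ord0 j * x ord0 j.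
  by rewrite -sumrN; apply: eq_bigr => j _; rewrite mxE mulNr.
set y := \sum_j _; rewrite mulNr mulNr ![_ / _ * _]mulrAC -mulrBl -!cexpD -!mulrDr -!rmorphD.
rewrite -opprD addrC.
have i2 : 2 * 'i%C != 0 :> R[i] by rewrite mulf_neq0 ?pnatr_eq0// complexiE neq0Ci.
apply: (mulIf i2); rewrite divfK//.
set t := c + y.
have E (r : R) : cexp ('i%C * r%:C) = cos r +i* sin r.
  have -> : 'i%C * r%:C = 0 +i* r by apply: complexP; rewrite ?ReM ?ImM /=; ring.
  by rewrite /cexp /= expR0 !mul1r.
rewrite (E t) (E (- t)) cosN sinN.
by apply: complexP; rewrite !(ReD,ImD,ReM,ImM,ReN,ImN) /=; ring.
Qed.

(* For [t] small, [sin (t (x_j - al))] has the sign of [x_j - al]. *)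
Lemma trig_closure_gt (j : 'I_n) (al : R) :
  trig_closure (fun x : 'rV[R]_n => (al < x ord0 j)%R%:R).
Proof.
pose f (k : nat) (x : 'rV[R]_n) := sin (k.+1%:R^-1 * (x ord0 j - al)).
have df k : trig_closure (fun x => (f k x)%:C).
  apply: eq_trig_closure (trig_closure_sin (k.+1%:R^-1 *: delta_mx ord0 j) (- (k.+1%:R^-1 * al))) => x.
  congr (sin _)%:C; rewrite mulrBr; congr (_ - _).
  rewrite (bigD1 j)//= big1 => [|i ij]; first by rewrite !mxE !eqxx mulr1 addr0.
  by rewrite !mxE (negbTE ij) andbF mulr0 mul0r.
apply: (@trig_closure_lim _ (fun k x => (0 < f k x)%R%:R) 1).
- move=> k; apply: trig_closure_indic_gt0 => // x.
  by rewrite ler_norml sin_geN1 sin_le1.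
- by move=> k x; case: (_ < _); rewrite ?normc0 ?normc1.
move=> x; set y := x ord0 j - al.
have sgE (r : R) : `|r| <= 1 -> (0 < sin r) = (0 < r).
  rewrite ler_norml => /andP[r1 r2]; have p2 := pi_ge2 R.
  case: (ltrgt0P r) => [r0|r0|->]; last by rewrite sin0 ltxx.
    by apply: sin_gt0_pi; lra.
  apply/negbTE; rewrite -leNgt -oppr_ge0 -sinN; apply: sin_ge0_pi; lra.
apply: cvg_near_cst; near=> k.
rewrite /f -/y sgE; last first.
  rewrite normrM gtr0_norm ?invr_gt0// mulrC ler_pdivrMr// mul1r -natr1.
  rewrite ler_wpDr//; near: k; exact: nbhs_infty_ger.
by rewrite pmulr_rgt0 ?invr_gt0// subr_gt0 subrr normc0.
Unshelve. all: end_near. Qed.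

Lemma trig_closure_indicC (A : set 'rV[R]_n) :
  trig_closure (fun x => (\1_A x)%:C) -> trig_closure (fun x => (\1_(~` A) x)%:C).
Proof.
move=> dA; apply: eq_trig_closure (trig_closureD (trig_closure_cst 1) (trig_closureZ (-1) dA)) => x.
by rewrite mulN1r -rmorphB !indicE in_setC; case: (x \in A); rewrite ?subr0 ?subrr.
Qed.

Lemma trig_closure_indicI (A B : set 'rV[R]_n) :
  trig_closure (fun x => (\1_A x)%:C) -> trig_closure (fun x => (\1_B x)%:C) ->
  trig_closure (fun x => (\1_(A `&` B) x)%:C).
Proof.
move=> dA dB; apply: eq_trig_closure (trig_closureM dA dB) => x.
by rewrite -rmorphM indicI.
Qed.

Lemma trig_closure_indic0 : trig_closure (fun x => (\1_(set0 : set 'rV[R]_n) x)%:C).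
Proof.
by apply: eq_trig_closure (trig_closure_cst 0) => x; rewrite indic0.
Qed.

(** After complementation, the indicators of the finite intersections are eventually constant at
    every point, so they converge pointwise to the indicator of the countable intersection. *)
Lemma trig_closure_indic_bigcup (F : nat -> set 'rV[R]_n) :
  (forall k, trig_closure (fun x => (\1_(F k) x)%:C)) ->
  trig_closure (fun x => (\1_(\bigcup_k F k) x)%:C).
Proof.
move=> dF; rewrite -[\bigcup_k F k]setCK; apply: trig_closure_indicC.
rewrite setC_bigcup.
pose G k := \big[setI/setT]_(i < k) ~` F i.
apply: (@trig_closure_lim _ (fun k x => (\1_(G k) x)%:C) 1).
- elim=> [|k IH]; rewrite /G ?big_ord_recr ?big_ord0/=.
    by rewrite -setC0; apply: trig_closure_indicC; exact: trig_closure_indic0.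
  by apply: trig_closure_indicI => //; exact: trig_closure_indicC.
- by move=> k x; rewrite indicE; case: (_ \in _); rewrite ?normc0 ?normc1.
move=> x; apply: cvg_near_cst.
have [h|/existsNP[k hk]] := pselect (forall k, (~` F k) x).
  apply: nearW => k; rewrite !indicE !mem_set ?subrr ?normc0//.
  by rewrite /G -(bigcap_mkord _ (fun i => ~` F i)) => i _; exact: h.
near=> l.
rewrite !indicE !memNset ?subrr ?normc0//; first by move=> /(_ k Logic.I).
rewrite /G -(bigcap_mkord _ (fun i => ~` F i)) => /(_ k) h; apply: hk; apply: h.
near: l; exact: nbhs_infty_gt.
Unshelve. all: end_near. Qed.

(** The sets whose indicator lies in the closure form a sigma-algebra, and it contains the
    half-spaces [al < x_j], which generate the measurable sets. *)
Lemma trig_closure_indic (A : set 'rV[R]_n) : measurable A ->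
  trig_closure (fun x => (\1_A x)%:C).
Proof.
pose S := [set A : set 'rV[R]_n | trig_closure (fun x => (\1_A x)%:C)].
have sS : sigma_algebra setT S.
  split; first exact: trig_closure_indic0.
    by move=> B dB; rewrite setTD; exact: trig_closure_indicC.
  exact: trig_closure_indic_bigcup.
suff : measurable `<=` S by exact.
apply: smallest_sub => //.
move=> B; rewrite -bigcup_seq => -[j /= _ [C mC <-]]; rewrite setTI.
pose S' := [set C : set R | S ((fun v : 'rV[R]_n => v ord0 j) @^-1` C)].
suff : (@ocitv R).-sigma.-measurable `<=` S' by exact.
rewrite RGenOInfty.measurableE; apply: smallest_sub.
  split; first by rewrite /S'/= preimage_set0; exact: trig_closure_indic0.
    by move=> D SD; rewrite setTD /S'/= preimage_setC; exact: trig_closure_indicC.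
  by move=> D SD; rewrite /S'/= preimage_bigcup; exact: trig_closure_indic_bigcup.
move=> D [al ->]; apply: eq_trig_closure (trig_closure_gt j al) => x.
rewrite indicE (_ : (x \in _) = (al < x ord0 j)); first by case: (al < _).
by apply/idP/idP; rewrite inE /= in_itv /= andbT.
Qed.

(** The approximating simple functions increase to [f], hence stay below the same bound [M], as the
    limit clause requires. *)
Lemma trig_closure_measurable_ge0 (f : 'rV[R]_n -> R) (M : R) : measurable_fun [set: 'rV[R]_n] f ->
  (forall x, 0 <= f x <= M) -> trig_closure (fun x => (f x)%:C).
Proof.
move=> mf fM.
have mfE : measurable_fun [set: 'rV[R]_n] (EFin \o f) by exact/measurable_EFinP.
have f0 x : [set: 'rV[R]_n] x -> (0 <= (EFin \o f) x)%E.
  by move=> _; rewrite lee_fin; have /andP[] := fM x.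
pose g := nnsfun_approx measurableT mfE.
have cg x : g k x @[k --> \oo] --> f x.
  have := cvg_nnsfun_approx measurableT mfE f0 (x := x) Logic.I.
  by move=> /fine_cvg.
have gf k x : 0 <= g k x <= f x.
  apply/andP; split; first exact: fun_ge0.
  have nd : nondecreasing_seq (fun k => g k x).
    by move=> a b ab; have /lefP := nd_nnsfun_approx measurableT mfE ab; exact.
  rewrite -(cvg_lim _ (cg x))//; apply: nondecreasing_cvgn_le => //.
  by apply/cvg_ex; exists (f x).
apply: (@trig_closure_lim _ (fun k x => (g k x)%:C) M).
- move=> k; pose S : seq R := finmap.enum_fset (fset_set (range (g k))).
  have dS : trig_closure (fun x => \sum_(y <- S) y%:C * (\1_(g k @^-1` [set y]) x)%:C).
    by apply: trig_closure_sum => y; apply: trig_closureZ; exact: trig_closure_indic.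
  apply: eq_trig_closure dS => x.
  rewrite [in RHS]fimfunE fsbig_finite//= rmorph_sum/=.
  by apply: eq_bigr => y _; rewrite rmorphM.
- move=> k x; have /andP[g0 gfx] := gf k x; have /andP[_ fMx] := fM x.
  by rewrite normc_real ger0_norm// (le_trans gfx).
by move=> x; apply: ccvg_real.
Qed.

Theorem trig_closure_bounded_measurable (f : 'rV[R]_n -> R[i]) (M : R) :
  measurable_fun [set: 'rV[R]_n] f -> (forall x, normc (f x) <= M) -> trig_closure f.
Proof.
move=> /measurable_funCP[mr mi] fM.
have h (g : 'rV[R]_n -> R) : measurable_fun [set: 'rV[R]_n] g -> (forall x, `|g x| <= M) ->
    trig_closure (fun x => (g x)%:C).
  move=> mg gM.
  have mgM : measurable_fun [set: 'rV[R]_n] (fun x => g x + M) by apply: measurable_funD.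
  have gM0 x : 0 <= g x + M <= M + M.
    by have := gM x; rewrite ler_norml => /andP[? ?]; apply/andP; split; lra.
  have d := trig_closure_measurable_ge0 mgM gM0.
  apply: eq_trig_closure (trig_closureD d (trig_closure_cst (- M)%:C)) => x.
  by rewrite -rmorphD addrK.
have dr := h _ mr (fun x => le_trans (normr_Re_le _) (fM x)).
have di := h _ mi (fun x => le_trans (normr_Im_le _) (fM x)).
apply: eq_trig_closure (trig_closureD dr (trig_closureZ 'i%C di)) => x.
by apply: complexP; rewrite !(ReD,ImD,ReM,ImM) /=; ring.
Qed.

End trigonometric_closure.

(** * The Bargmann transform *)

Section entire_functions.
Variable R : realType.
Implicit Types (z w : R[i]).

Lemma gt0cE (e : R[i]) : 0 < e -> exists2 r : R, 0 < r & e = r%:C.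
Proof.
case: e => a b; rewrite ltcE /= => /andP[/eqP -> a0]; by exists a.
Qed.

Lemma ge0cE (e : R[i]) : 0 <= e -> exists2 r : R, 0 <= r & e = r%:C.
Proof.
case: e => a b; rewrite lecE /= => /andP[/eqP -> a0]; by exists a.
Qed.

Lemma normcEC z : `|z| = (normc z)%:C.
Proof. by []. Qed.

Lemma normc_le_mx_norm n (h : 'rV[(R[i])^o]_n) j : (normc (h ord0 j))%:C <= `|h|.
Proof.
rewrite -normcEC [leRHS]mx_normE -[leLHS]nngE num_le.
exact: (le_bigmax _ (fun k : 'I_1 * 'I_n => `|h k.1 k.2|%:nng) (ord0, j)).
Qed.

(** The differential is linear over [R[i]], hence multiplication by its value at 1. *)
Lemma differentiable_cdiff (F : R[i] -> R[i]) z :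
  differentiable (F : (R[i])^o -> (R[i])^o) (z : (R[i])^o) -> cdiff F z.
Proof.
move=> /diff_locallyP[_ dF].
pose L : {linear (R[i])^o -> (R[i])^o} := 'd (F : (R[i])^o -> (R[i])^o) (z : (R[i])^o).
exists (L 1) => e e0.
move/eqaddoP : dF => /(_ e%:C).
rewrite ltcR => /(_ e0) /nbhs_ballP[d /gt0cE[r r0 ->]] h.
exists r => // k kr.
have := h k; rewrite -ball_normE /= sub0r normrN normcEC ltcR => /(_ kr).
rewrite [X in `|X|](_ : _ = F (z + k) - F z - L 1 * k); last first.
  have Lk : L k = L 1 * k by rewrite -[k in LHS]mulr1 -[k * 1]/(k *: (1 : (R[i])^o)) linearZ mulrC.
  by rewrite -Lk /= !fctE /= opprD addrA [k + z]addrC.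
rewrite normcEC; by rewrite -rmorphM lecR.
Qed.

Lemma differentiable_quadratic n (F : 'rV[R[i]]_n -> R[i]) (v : 'rV[R[i]]_n) (c : 'rV[R[i]]_n) (K : R) :
  0 <= K ->
  (forall h : 'rV[R[i]]_n, \sum_j normc (h ord0 j) <= 1 ->
    normc (F (v + h) - F v - \sum_j c ord0 j * h ord0 j) <= K * (\sum_j normc (h ord0 j)) ^+ 2) ->
  differentiable (F : 'rV[(R[i])^o]_n -> (R[i])^o) (v : 'rV[(R[i])^o]_n).
Proof.
move=> K0 FK.
pose L (h : 'rV[(R[i])^o]_n) : (R[i])^o := \sum_j c ord0 j * h ord0 j.
have lL : linear L.
  move=> a h k; rewrite /L scaler_sumr -big_split/=; apply: eq_bigr => j _.
  by rewrite !mxE mulrDr; congr (_ + _); exact: mulrCA.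
pose LM := GRing.isLinear.Build _ _ _ _ _ lL.
pose LL : {linear _ -> _} := HB.pack L LM.
have cL : continuous LL.
  have cS (s : seq 'I_n) : continuous (fun h : 'rV[(R[i])^o]_n => \sum_(j <- s) c ord0 j *: (h ord0 j : (R[i])^o) : (R[i])^o).
    elim: s => [|j s IH] h.
      rewrite (_ : (fun _ => _) = cst 0); first exact: cst_continuous.
      by apply/funext => k; rewrite big_nil.
    rewrite (_ : (fun _ => _) = (fun h : 'rV[(R[i])^o]_n => c ord0 j *: (h ord0 j : (R[i])^o)) +
       (fun h => \sum_(j <- s) c ord0 j *: (h ord0 j : (R[i])^o))); last first.
      by apply/funext => k; rewrite big_cons.
    apply: continuousD; last exact: IH.
    exact: (@continuousZl_tmp _ _ _ _ (c ord0 j) _ (@coord_continuous _ _ _ _ _ _)).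
  exact: cS.
have oL : (F : 'rV[(R[i])^o]_n -> (R[i])^o) \o shift (v : 'rV[(R[i])^o]_n) = cst (F v : (R[i])^o) + LL +o_ (0 : 'rV[(R[i])^o]_n) id.
  apply/eqaddoP => e /gt0cE[r r0 ->].
  pose A := K * n%:R ^+ 2.
  have A0 : 0 <= A by rewrite mulr_ge0// exprn_ge0.
  (* The first bound makes the sum of the [n] moduli at most 1, so that [FK] applies; the second
     turns the quadratic error [A * t ^+ 2] into at most [r * t]. *)
  pose d := Num.min (n%:R + 1)^-1 (r / (A + 1)).
  have d0 : 0 < d by rewrite lt_min invr_gt0 ltr_wpDl//= divr_gt0// ltr_wpDl.
  apply/nbhs_ballP; exists d%:C; first by rewrite /= ltcR.
  move=> h; rewrite -ball_normE /= sub0r normrN => hd.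
  have [t t0 ht] := ge0cE (normr_ge0 h).
  move: hd; rewrite ht ltcR lt_min => /andP[t1 tr].
  have hj j : normc (h ord0 j) <= t by rewrite -lecR -ht normc_le_mx_norm.
  have hs : \sum_j normc (h ord0 j) <= n%:R * t.
    by apply: le_trans (ler_sum _ (fun j _ => hj j)) _; rewrite sumr_const card_ord mulr_natl.
  have n1 : 0 < n%:R + 1 :> R by rewrite ltr_wpDl.
  have h1 : \sum_j normc (h ord0 j) <= 1.
    apply: le_trans hs _; apply: (@le_trans _ _ ((n%:R + 1) * (n%:R + 1)^-1)); last by rewrite mulfV ?gt_eqF.
    by apply: ler_pM => //; [rewrite lerDl|exact: ltW].
  have s0 : 0 <= \sum_j normc (h ord0 j) by apply: sumr_ge0 => j _; exact: normc_ge0.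
  rewrite [X in `|X|](_ : _ = F (v + h) - F v - \sum_j c ord0 j * h ord0 j); last first.
    by rewrite !fctE /= opprD addrA [h + v]addrC.
  rewrite normcEC -rmorphM lecR (le_trans (FK h h1))//.
  have A1 : 0 < A + 1 by rewrite ltr_wpDl.
  rewrite ltr_pdivlMr// in tr.
  apply: (@le_trans _ _ (K * (n%:R * t) ^+ 2)).
    by apply: ler_wpM2l => //; rewrite lerXn2r// nnegrE mulr_ge0.
  rewrite (_ : K * (n%:R * t) ^+ 2 = t * A * t); last by rewrite /A; ring.
  by apply: ler_wpM2r => //; apply: le_trans (ltW tr); rewrite mulrDr mulr1 lerDl.
by apply/diff_locallyP; rewrite (diff_unique cL oL); split; [exact: cL|exact: oL].
Qed.

Lemma entire_continuous n (F : 'rV[R[i]]_n -> R[i]) (v : 'rV[R[i]]_n) (e : R) : entire F -> 0 < e ->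
  exists2 r : R, 0 < r & forall w : 'rV[R[i]]_n, (forall j, normc (v ord0 j - w ord0 j) < r) ->
    normc (F v - F w) < e.
Proof.
move=> /(_ v)/differentiable_continuous Fv e0.
move/cvgrPdist_lt : Fv => /(_ e%:C); rewrite ltcR => /(_ e0).
move=> /nbhs_ballP[d /gt0cE[r r0 ->]] h; exists r => // w vw.
have := h w; rewrite /= normcEC ltcR; apply.
by split; [rewrite ltcR|move=> i j; rewrite ord1 /ball /= normcEC ltcR].
Qed.

Lemma entire_lin_entire n (F : 'rV[R[i]]_n -> R[i]) : entire F -> lin_entire F.
Proof.
move=> eF v u z; apply: differentiable_cdiff.
apply: (@differentiable_comp _ _ _ _ (fun t : (R[i])^o => (v : 'rV[(R[i])^o]_n) + t *: (u : 'rV[(R[i])^o]_n)) (F : 'rV[(R[i])^o]_n -> (R[i])^o)); last exact: eF.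
by [].
Qed.

Lemma measurable_box n (A : 'I_n -> set R[i]) : (forall j, measurable (A j)) ->
  measurable [set v : 'rV[R[i]]_n | forall j, A j (v ord0 j)].
Proof.
move=> mA; rewrite (_ : mkset _ = \bigcap_(j in [set: 'I_n]) ((fun v : 'rV[R[i]]_n => v ord0 j) @^-1` A j)).
  apply: fin_bigcap_measurable => // j _.
  by rewrite -[X in measurable X]setTI; exact: measurable_coord.
by apply/seteqP; split => [v Av j _|v Av j]; [exact: Av|exact: (Av j)].
Qed.

(** The sigma-algebra of [C^n] is generated by the coordinates, so openness has to be converted into
    measurability: the set [f > a] is the union of the countably many boxes, with rational centres
    and radii [1 / (m + 1)], that it contains. *)
Lemma measurable_lower_semicontinuous n (f : 'rV[R[i]]_n -> R) :
  (forall (v : 'rV[R[i]]_n) (e : R), 0 < e -> exists2 r : R, 0 < r &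
    forall w : 'rV[R[i]]_n, (forall j, normc (v ord0 j - w ord0 j) < r) -> f v - e < f w) ->
  measurable_fun [set: 'rV[R[i]]_n] f.
Proof.
move=> fc; apply: (measurability _ (RGenOInfty.measurableE R)) => //= _ [_ [a ->] <-].
rewrite setTI.
pose c (q : rat * rat) : R[i] := ratr q.1 +i* ratr q.2.
pose box (p : 'rV[rat * rat]_n * nat) :=
  [set w : 'rV[R[i]]_n | forall j, normc (c (p.1 ord0 j) - w ord0 j) < p.2.+1%:R^-1].
have mbox p : measurable (box p).
  apply: (@measurable_box _ (fun j => [set x | normc (c (p.1 ord0 j) - x) < p.2.+1%:R^-1])) => j.
  have mn : measurable_fun [set: R[i]] (fun x => normc (c (p.1 ord0 j) - x)).
    apply: measurable_fun_normc; apply: measurable_funCD => //.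
    rewrite [X in measurable_fun _ X](_ : _ = fun z => -1 * z); first exact: measurable_mulCl.
    by apply/funext => z; rewrite mulN1r.
  rewrite (_ : mkset _ = (fun x => normc (c (p.1 ord0 j) - x)) @^-1` `]-oo, p.2.+1%:R^-1[).
    by rewrite -[X in measurable X]setTI; exact: mn.
  by apply/seteqP; split => x; rewrite /= in_itv.
pose S := f @^-1` `]a, +oo[.
(* [unpickle] enumerates the boxes; an index that codes no box, or a box not contained in [S],
   contributes the empty set. *)
pose boxS k := if @unpickle ('rV[rat * rat]_n * nat)%type k is Some p then
  (if pselect (box p `<=` S) then box p else set0) else set0.
suff -> : f @^-1` `]a, +oo[ = \bigcup_k boxS k.
  apply: bigcupT_measurable => k; rewrite /boxS; case: unpickle => // p.
  by case: pselect => ? /=; [exact: mbox|exact: measurable0].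
apply/seteqP; split => [v|v [k _]]; last first.
  by rewrite /boxS; case: unpickle => // p; case: pselect => //= bS; exact: bS.
rewrite /= in_itv /= andbT => av.
have [r r0 vr] := fc v (f v - a) ltac:(by rewrite subr_gt0).
(* Twice the radius must not exceed [r]: a point of the box is within [e] of the rational centre,
   which is itself within [e] of [v]. *)
pose m := Num.truncn (2 / r); pose e : R := m.+1%:R^-1.
have e0 : 0 < e by rewrite invr_gt0.
have er : 2 * e <= r.
  by rewrite ler_pdivrMr// -ler_pdivrMl// mulrC ltW// truncnS_gt.
have rat_near (x : R) : exists q : rat, `|ratr q - x| < e / 2.
  have [q] := rat_in_itvoo (ltac:(lra) : x - e / 2 < x + e / 2).
  rewrite in_itv /= => /andP[h1 h2]; exists q; rewrite ltr_norml; apply/andP; split; lra.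
have crat (z : R[i]) : exists q, normc (c q - z) < e.
  have [p hp] := rat_near (complex.Re z); have [q hq] := rat_near (complex.Im z).
  exists (p, q); apply: le_lt_trans (normc_le_ReIm _) _.
  by rewrite ReD ImD ReN ImN /= (splitr e) ltrD.
have [g hg] := choice (fun j : 'I_n => crat (v ord0 j)).
pose p := (\row_j g j, m).
exists (pickle p) => //; rewrite /boxS pickleK; case: pselect => [_ j|]; first by rewrite mxE.
move=> bS; exfalso; apply: bS => w wp; rewrite /S /= in_itv /= andbT.
have := vr w; rewrite subKr; apply => j.
apply: lt_le_trans er.
rewrite (_ : v ord0 j - _ = (v ord0 j - c (g j)) + (c (g j) - w ord0 j)); last by rewrite addrA subrK.
apply: le_lt_trans (le_normcD _ _) _; rewrite normcB mulr2n mulrDl mul1r ltrD//.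
by have := wp j; rewrite mxE.
Qed.

Lemma entire_measurable n (F : 'rV[R[i]]_n -> R[i]) : entire F ->
  measurable_fun [set: 'rV[R[i]]_n] F.
Proof.
move=> eF; apply/measurable_funCP; split; apply: measurable_lower_semicontinuous => v e e0;
    have [r r0 vr] := entire_continuous v eF e0; exists r => // w /vr h; rewrite ltrBlDr -ltrBlDl.
  by rewrite -ReN -ReD; apply: le_lt_trans h; apply: le_trans (normr_Re_le _); exact: ler_norm.
by rewrite -ImN -ImD; apply: le_lt_trans h; apply: le_trans (normr_Im_le _); exact: ler_norm.
Qed.

End entire_functions.

(** * The transform, its kernel and its holomorphy *)

Section bargmann_transform.
Context {R : realType}.
Variable n : nat.

Definition gaussRn := power_measure (gaussR (@ltr0n R 2)) n.
Definition gaussCn := power_measure (gaussC (@ltr01 R)) n.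
Local Notation mu := gaussRn.
Local Notation lam := gaussCn.
Implicit Types (x : 'rV[R]_n) (z a v w : 'rV[R[i]]_n) (f g : 'rV[R]_n -> R[i]).

Lemma gaussRn_setT : mu [set: 'rV[R]_n] = 1%E.
Proof. exact/power_measure_setT/(@probability_setT _ _ R). Qed.

Definition bargmann_kernel x z : R[i] :=
  cexp (\sum_j (2 * 'i%C * z ord0 j * (x ord0 j)%:C + z ord0 j ^+ 2 / 2)).

Definition bargmann f z : R[i] := cintegral mu (fun x => f x * bargmann_kernel x z).

Lemma measurable_bargmann_kernel z : measurable_fun [set: 'rV[R]_n] (bargmann_kernel^~ z).
Proof.
apply: measurable_fun_cexp; apply: measurable_fun_csum => j.
apply: measurable_funCD => //; apply: measurable_funCM => //.
by apply: measurable_fun_real; exact: measurable_coord.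
Qed.

(** In each coordinate the Gaussian Laplace transform at [2i (z - conj a)] contributes the exponent
    [- (z - conj a)^2 / 2]; together with the constant exponent [(z^2 + conj a^2) / 2] this leaves
    [z conj a]. *)
Lemma bargmann_kernel_ip z a :
  cintegrable mu (fun x => bargmann_kernel x z * ((bargmann_kernel x a)^*)%C) /\
  cintegral mu (fun x => bargmann_kernel x z * ((bargmann_kernel x a)^*)%C) =
  cexp (dotv z (conjv a)).
Proof.
pose c j := cexp ((z ord0 j ^+ 2 + ((a ord0 j)^*)%C ^+ 2) / 2).
pose u j := 2 * 'i%C * (z ord0 j - ((a ord0 j)^*)%C).
have E x : bargmann_kernel x z * ((bargmann_kernel x a)^*)%C =
    \prod_j (c j * cexp (u j * (x ord0 j)%:C)).
  rewrite /bargmann_kernel -cexpJ -cexpD (rmorph_sum (@conjc R)) -big_split/= cexp_sum.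
  apply: eq_bigr => j _; rewrite -cexpD; congr cexp; rewrite /u.
  have -> : 2^-1 = (2^-1)%:C :> R[i] by rewrite fmorphV rmorph_nat.
  move: (z ord0 j) (a ord0 j) (x ord0 j) => [p q] [r s] t.
  by rewrite !expr2; apply: complexP; rewrite !(ReD,ImD,ReJ,ImJ,ReM,ImM,ReN,ImN) /=; field.
have [] := @cintegral_power_prod _ _ _ (gaussR (@ltr0n R 2)) n
  (fun j t => c j * cexp (u j * t%:C)) _.
  by move=> j; apply: cintegrableZ; exact: gaussR_cexp_integrable.
move=> i1 i2; split; first by under eq_fun do rewrite E.
under eq_cintegral do rewrite E.
rewrite i2 /dotv cexp_sum; apply: eq_bigr => j _.
rewrite cintegralZ; last exact: gaussR_cexp_integrable.
rewrite gaussR_cexp /c -cexpD; congr cexp; rewrite /u mxE.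
have -> : (2 * 'i%C * (z ord0 j - ((a ord0 j)^*)%C)) ^+ 2 = - (4 * (z ord0 j - ((a ord0 j)^*)%C) ^+ 2).
  by rewrite exprMn exprMn sqr_i; ring.
by field.
Qed.

Lemma l2_bargmann_kernel z : l2 mu (bargmann_kernel^~ z).
Proof.
split; first exact: measurable_bargmann_kernel.
have /cintegrableP[_] := (bargmann_kernel_ip z z).1.
by under eq_integral do rewrite normcM normcJ -expr2.
Qed.

Lemma l2_bounded d (T : measurableType d) (nu : {measure set T -> \bar R}) (h : T -> R[i]) (M : R) :
  nu [set: T] = 1%E -> measurable_fun [set: T] h -> (forall t, normc (h t) <= M) -> l2 nu h.
Proof.
move=> nu1 mh hM; split => //; apply: (@le_lt_trans _ _ (\int[nu]_t (M ^+ 2)%:E)%E).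
  apply: ge0_le_integral => //.
  - by move=> x _; rewrite lee_fin sqr_ge0.
  - exact/measurable_EFinP/measurable_sqr_normc.
  - by move=> x _; rewrite lee_fin lerXn2r// nnegrE ?normc_ge0// (le_trans (normc_ge0 _) (hM x)).
by rewrite integral_cst// nu1 mule1 ltry.
Qed.

Lemma bargmann_cintegrable f z : l2 mu f -> cintegrable mu (fun x => f x * bargmann_kernel x z).
Proof. by move=> lf; apply: l2_cintegrable_mul => //; exact: l2_bargmann_kernel. Qed.

Lemma gaussRn_exp_integrable (c : R) :
  mu.-integrable [set: 'rV[R]_n] (fun x => (expR (c * \sum_j `|x ord0 j|))%:E).
Proof.
have [|i1 _] := @cintegral_power_prod _ _ _ (gaussR (@ltr0n R 2)) n
    (fun j t => (expR (c * `|t|))%:C) _.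
  move=> j; apply: (cintegrable_le _ (gaussR_exp_integrable c)).
    by apply: measurable_fun_real; apply: measurableT_comp => //; apply: measurable_funM => //; exact: measurableT_comp.
  by move=> t; rewrite normc_real ger0_norm// expR_ge0.
have := integrable_normc i1; apply: eq_integrable => // x _.
rewrite -rmorph_prod normc_real ger0_norm; last by apply: prodr_ge0 => j _; exact: expR_ge0.
by rewrite mulr_sumr expR_sum.
Qed.

Lemma l2_gaussRn_exp f (C c : R) : measurable_fun [set: 'rV[R]_n] f ->
  (forall x, normc (f x) <= C * expR (c * \sum_j `|x ord0 j|)) -> l2 mu f.
Proof.
move=> mf fC; split => //.
have /integrableP[mi] := integrableZl measurableT (C ^+ 2) (gaussRn_exp_integrable (2 * c)).
apply: le_lt_trans; apply: ge0_le_integral => //.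
- by move=> x _; rewrite lee_fin sqr_ge0.
- exact/measurable_EFinP/measurable_sqr_normc.
- exact: measurableT_comp.
move=> x _ /=; rewrite lee_fin ger0_norm; last by rewrite mulr_ge0 ?sqr_ge0 ?expR_ge0.
rewrite -mulrA expRM_natl -exprMn lerXn2r// nnegrE ?normc_ge0//.
exact: le_trans (normc_ge0 _) (fC x).
Qed.

Lemma normc_cintegral_le_Rintegral d (T : measurableType d) (nu : {measure set T -> \bar R})
    (h : T -> R[i]) (k : T -> R) : measurable_fun [set: T] h ->
  nu.-integrable [set: T] (EFin \o k) -> (forall t, normc (h t) <= k t) ->
  normc (cintegral nu h) <= \int[nu]_t k t.
Proof.
move=> mh ik hk; have ih := cintegrable_le mh ik hk.
apply: le_trans (normc_cintegral_le ih) _; apply: le_Rintegral => //.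
exact: integrable_normc.
Qed.

Lemma normc_2i : normc (2 * 'i%C : R[i]) = 2.
Proof.
rewrite normcM -(rmorph_nat (real_complex R)) normc_real ger0_norm//.
by rewrite [normc _](_ : _ = 1) ?mulr1// /normc /= expr0n expr1n add0r sqrtr1.
Qed.

Lemma normc_half (u : R[i]) : normc (u / 2) = normc u / 2.
Proof.
rewrite normcM -(rmorph_nat (real_complex R)) -fmorphV normc_real ger0_norm//.
Qed.

Lemma normc_bargmann_kernel_le z : exists c C : R, forall x,
  normc (bargmann_kernel x z) <= C * expR (c * \sum_j `|x ord0 j|).
Proof.
pose B := \sum_j normc (z ord0 j).
exists (2 * B), (expR (\sum_j normc (z ord0 j) ^+ 2)) => x.
rewrite /bargmann_kernel normc_cexp -expRD ler_expR.
apply: le_trans (ler_norm _) _; apply: le_trans (normr_Re_le _) _.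
apply: le_trans (normc_sum _ _ _) _; rewrite mulr_sumr -big_split/=.
apply: ler_sum => j _; rewrite addrC; apply: le_trans (le_normcD _ _) _; apply: lerD.
  rewrite normcM normcM normc_2i normc_real ler_wpM2r// ler_wpM2l// /B.
  by rewrite (bigD1 j)//= lerDl; apply: sumr_ge0 => k _; exact: normc_ge0.
rewrite normc_half normcX ler_pdivrMr// ler_peMr ?sqr_ge0//; lra.
Qed.

Lemma bargmann_kernelD x v w : bargmann_kernel x (v + w) = bargmann_kernel x v *
  cexp (\sum_j ((2 * 'i%C * (x ord0 j)%:C + v ord0 j) * w ord0 j + w ord0 j ^+ 2 / 2)).
Proof.
rewrite /bargmann_kernel -cexpD -big_split/=; congr cexp; apply: eq_bigr => j _.
by rewrite mxE; field.
Qed.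

(** Differentiation under the integral. The second-order remainder of the kernel is at most the
    square of the increment times an exponential in [|x|]; such exponentials are square integrable
    against the Gaussian, so the error is quadratic uniformly in the direction. *)
Lemma bargmann_entire f : l2 mu f -> entire (bargmann f).
Proof.
move=> lf v.
pose B := \sum_j normc (v ord0 j).
pose W x : R := 2 * \sum_j `|x ord0 j| + B + 1.
(* The remainder of [cexp] gives [3 * W x ^+ 2 * expR (W x)] and the squares of the increment give
   [1 / 2]; since [1 <= W x <= expR (W x)], both together are at most [G x]. *)
pose G x : R := 4 * expR (3 * W x).
have B0 : 0 <= B by apply: sumr_ge0 => j _; exact: normc_ge0.
have X0 x : 0 <= \sum_j `|x ord0 j| by apply: sumr_ge0.
have lG : l2 mu (fun x => bargmann_kernel x v * (G x)%:C).
  have [c [C cC]] := normc_bargmann_kernel_le v.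
  apply: (@l2_gaussRn_exp _ (C * (4 * expR (3 * (B + 1)))) (c + 6)).
    apply: measurable_funCM; first exact: measurable_bargmann_kernel.
    apply: measurable_fun_real; apply: measurable_funM => //; apply: measurableT_comp => //.
    apply: measurable_funM => //; apply: measurable_funD => //; apply: measurable_funD => //.
    apply: measurable_funM => //; apply: measurable_sum => j; apply: measurableT_comp => //.
    exact: measurable_coord.
  move=> x; rewrite normcM normc_real ger0_norm; last by rewrite mulr_ge0// expR_ge0.
  rewrite [leRHS](_ : _ = C * expR (c * \sum_j `|x ord0 j|) * G x); last first.
    rewrite /G (_ : 3 * W x = 3 * (B + 1) + 6 * \sum_j `|x ord0 j|); last by rewrite /W; ring.
    by rewrite [(c + 6) * _]mulrDl !expRD; ring.
  by apply: ler_wpM2r => //; rewrite mulr_ge0// expR_ge0.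
have iG := l2_cintegrable_mul lf lG.
(* The logarithmic derivative of the kernel in the j-th coordinate at [v]; integrating it against
   [f] times the kernel gives the partial derivatives collected in [c]. *)
pose D x j : R[i] := 2 * 'i%C * (x ord0 j)%:C + v ord0 j.
pose c := (\row_j cintegral mu (fun x => f x * (bargmann_kernel x v * D x j))) : 'rV[R[i]]_n.
pose K := \int[mu]_x normc (f x * (bargmann_kernel x v * (G x)%:C)).
have DW x j : normc (D x j) <= W x - 1.
  apply: le_trans (le_normcD _ _) _; rewrite /W addrK normcM normc_2i normc_real.
  apply: lerD; first apply: ler_wpM2l => //.
    by rewrite (bigD1 j)//= lerDl; apply: sumr_ge0 => k _.
  by rewrite /B (bigD1 j)//= lerDl; apply: sumr_ge0 => k _; exact: normc_ge0.
have W1 x : 1 <= W x by rewrite /W; have := X0 x; lra.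
have W3 x : expR (3 * W x) = expR (W x) ^+ 3.
  by rewrite expRM_natl.
have We x : W x <= expR (W x) by have := expR_ge1Dx (W x); lra.
have e1 x : 1 <= expR (W x) by have := W1 x; have := We x; lra.
have WG x : W x <= G x.
  rewrite /G W3; apply: le_trans (We x) _.
  have := e1 x; move: (expR (W x)) => y y1.
  have : y <= y ^+ 3 by rewrite exprS ler_peMr ?exprn_ege1//; lra.
  have y3 : 0 <= y ^+ 3 by rewrite exprn_ge0//; lra.
  lra.
have mD j : measurable_fun [set: 'rV[R]_n] (fun x => D x j).
  apply: measurable_funCD => //; apply: measurable_funCM => //.
  by apply: measurable_fun_real; exact: measurable_coord.
have mf : measurable_fun [set: 'rV[R]_n] f by case: lf.
have mk := measurable_bargmann_kernel v.
have G0 x : 0 <= G x by apply: le_trans (WG x); have := W1 x; lra.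
have iD j : cintegrable mu (fun x => f x * (bargmann_kernel x v * D x j)).
  apply: cintegrable_leC iG _; first by apply: measurable_funCM => //; exact: measurable_funCM.
  move=> x; rewrite !normcM normc_real (ger0_norm (G0 x)).
  apply: ler_wpM2l; first exact: normc_ge0.
  apply: ler_wpM2l; first exact: normc_ge0.
  by apply: le_trans (WG x); apply: le_trans (DW x j) _; rewrite gerBl.
apply: (@differentiable_quadratic _ _ _ v c K).
  by apply: Rintegral_ge0 => x _; exact: normc_ge0.
move=> h h1; set s := \sum_j normc (h ord0 j).
pose zeta x := \sum_j (D x j * h ord0 j + h ord0 j ^+ 2 / 2).
pose l x := \sum_j D x j * h ord0 j.
have s0 : 0 <= s by apply: sumr_ge0 => j _; exact: normc_ge0.
have hs j : normc (h ord0 j) <= s.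
  by rewrite /s (bigD1 j)//= lerDl; apply: sumr_ge0 => k _; exact: normc_ge0.
have -> : bargmann f (v + h) - bargmann f v - \sum_j c ord0 j * h ord0 j =
    cintegral mu (fun x => f x * bargmann_kernel x v * (cexp (zeta x) - 1 - l x)).
  have isum : cintegrable mu (fun x => \sum_j h ord0 j * (f x * (bargmann_kernel x v * D x j))).
    by apply: cintegrable_sum => j; exact: cintegrableZ.
  have i1 := bargmann_cintegrable (v + h) lf; have i2 := bargmann_cintegrable v lf.
  have -> : \sum_j c ord0 j * h ord0 j =
      cintegral mu (fun x => \sum_j h ord0 j * (f x * (bargmann_kernel x v * D x j))).
    rewrite cintegral_sum => [|j]; last exact: cintegrableZ.
    by apply: eq_bigr => j _; rewrite cintegralZ// mxE mulrC.
  rewrite /bargmann -cintegralB// -cintegralB//; last exact: cintegrableB.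
  apply: eq_cintegral => x; rewrite bargmann_kernelD -/(zeta x).
  rewrite (_ : \sum_j _ = f x * bargmann_kernel x v * l x); first by ring.
  by rewrite /l mulr_sumr; apply: eq_bigr => j _; ring.
have zW x : normc (zeta x) <= s * W x.
  apply: le_trans (normc_sum _ _ _) _; rewrite /s mulr_suml; apply: ler_sum => j _.
  apply: le_trans (le_normcD _ _) _; rewrite normcM normc_half normcX.
  rewrite [leLHS](_ : _ = normc (h ord0 j) * (normc (D x j) + normc (h ord0 j) / 2)); last by field.
  apply: ler_wpM2l; first exact: normc_ge0.
  have := DW x j; have := le_trans (hs j) h1; lra.
have bound x : normc (f x * bargmann_kernel x v * (cexp (zeta x) - 1 - l x)) <=
    s ^+ 2 * normc (f x * (bargmann_kernel x v * (G x)%:C)).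
  rewrite !normcM normc_real (ger0_norm (G0 x)).
  rewrite [leRHS](_ : _ = normc (f x) * normc (bargmann_kernel x v) * (s ^+ 2 * G x)); last by move: (normc (f x)) (G x) => p q; ring.
  apply: ler_wpM2l; first by rewrite mulr_ge0 ?normc_ge0.
  rewrite (_ : _ - l x = cexp (zeta x) - 1 - zeta x + \sum_j h ord0 j ^+ 2 / 2); last first.
    by rewrite /zeta big_split/= -/(l x); ring.
  apply: le_trans (le_normcD _ _) _.
  have q2 : normc (\sum_j h ord0 j ^+ 2 / 2) <= s ^+ 2 / 2.
    apply: le_trans (normc_sum _ _ _) _; rewrite expr2 {1}/s !mulr_suml; apply: ler_sum => j _.
    rewrite normc_half normcX ler_pM2r// expr2.
    by apply: ler_wpM2l; rewrite ?normc_ge0.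
  have q1 : normc (cexp (zeta x) - 1 - zeta x) <= 3 * (s * W x) ^+ 2 * expR (W x).
    apply: le_trans (cexp_sub1B_le _) _; apply: ler_pM.
    - by rewrite mulr_ge0// sqr_ge0.
    - exact: expR_ge0.
    - by apply: ler_wpM2l => //; rewrite lerXn2r// nnegrE ?normc_ge0// mulr_ge0//; have := W1 x; lra.
    - rewrite ler_expR; apply: le_trans (zW x) _; have := W1 x; rewrite -/s in h1; nra.
  apply: le_trans (lerD q1 q2) _; rewrite /G W3.
  have q3 : W x ^+ 2 <= expR (W x) ^+ 2 by rewrite lerXn2r// nnegrE ?expR_ge0//; have := W1 x; lra.
  have q4 : 1 <= expR (W x) ^+ 3 by rewrite exprn_ege1.
  have q5 : W x ^+ 2 * expR (W x) <= expR (W x) ^+ 3.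
    by rewrite [leRHS]exprSr; apply: ler_wpM2r => //; exact: expR_ge0.
  rewrite [leLHS](_ : _ = s ^+ 2 * (3 * (W x ^+ 2 * expR (W x)) + 2^-1)); last by field.
  by apply: ler_wpM2l; [exact: sqr_ge0|lra].
have mz : measurable_fun [set: 'rV[R]_n] zeta.
  by apply: measurable_fun_csum => j; apply: measurable_funCD => //; apply: measurable_funCM.
have ml : measurable_fun [set: 'rV[R]_n] l.
  by apply: measurable_fun_csum => j; apply: measurable_funCM.
have mF : measurable_fun [set: 'rV[R]_n]
    (fun x => f x * bargmann_kernel x v * (cexp (zeta x) - 1 - l x)).
  apply: measurable_funCM; first exact: measurable_funCM.
  rewrite (_ : (fun x => _) = (fun x => cexp (zeta x) + (- 1 + -1 * l x))); last first.
    by apply/funext => x; ring.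
  apply: measurable_funCD; first exact: measurable_fun_cexp.
  by apply: measurable_funCD => //; exact: measurable_funCM.
have iGn := integrable_normc iG.
apply: le_trans (normc_cintegral_le_Rintegral mF (integrableZl measurableT (s ^+ 2) iGn) bound) _.
by rewrite RintegralZl// mulrC.
Qed.

End bargmann_transform.

Section l2_convergence.
Context {R : realType} {d} {T : measurableType d}.
Variable mu : {measure set T -> \bar R}.
Implicit Types f g : T -> R[i].

Lemma nrm2_dominated (f_ : nat -> T -> R[i]) f g : (forall k, measurable_fun [set: T] (f_ k)) ->
  l2 mu g -> (forall k x, normc (f_ k x) <= normc (g x)) -> (forall x, ccvg (f_^~ x) (f x)) ->
  [/\ forall k, l2 mu (f_ k), l2 mu f &
      (nrm2 mu (fun x => f_ k x - f x)%R @[k --> \oo] --> 0)%E].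
Proof.
move=> mf_ lg fg cf; have mf := measurable_fun_ccvg mf_ cf.
have lf_ k : l2 mu (f_ k) by exact: l2_le lg (fg k).
have lf : l2 mu f by apply: l2_le lg _ => // x; exact: ccvg_bounded (cf x).
split => //; apply: (@integral_dominated_cvg0 _ _ _ _ _ (fun x => 4 * normc (g x) ^+ 2)).
- by move=> k; apply: measurable_sqr_normc; case: (l2B (lf_ k) lf).
- by have := integrableZl measurableT 4 (integrable_sqr lg).
- move=> k x; rewrite sqr_ge0/= (_ : 4 * _ = (2 * normc (g x)) ^+ 2); last by ring.
  by rewrite lerXn2r ?nnegrE ?mulr_ge0 ?normc_ge0//; exact: ccvg_sub_bounded (cf x) k.
- by move=> x; rewrite -[X in _ --> X](mulr0 0); apply: cvgM; exact: cf.
Qed.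

Lemma ip_suml I (s : seq I) (c : I -> R[i]) (F : I -> T -> R[i]) g :
  (forall i, l2 mu (F i)) -> l2 mu g ->
  ip mu (fun x => \sum_(i <- s) c i * F i x) g = \sum_(i <- s) c i * ip mu (F i) g.
Proof.
move=> lF lg; elim: s => [|i s IH].
  rewrite big_nil /ip (@eq_cintegral _ _ _ _ _ (fun=> 0)) ?cintegral0// => x.
  by rewrite big_nil mul0r.
rewrite big_cons -IH -ipZl//; under eq_fun do rewrite big_cons.
by rewrite ipDl//; [exact: l2Z|apply: l2_sum => j; exact: l2Z].
Qed.

Lemma ip_sum I (s : seq I) (c : I -> R[i]) (F : I -> T -> R[i]) : (forall i, l2 mu (F i)) ->
  ip mu (fun x => \sum_(i <- s) c i * F i x) (fun x => \sum_(i <- s) c i * F i x) =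
  \sum_(i <- s) \sum_(j <- s) c i * (c j)^*%C * ip mu (F i) (F j).
Proof.
move=> lF; have lS : l2 mu (fun x => \sum_(i <- s) c i * F i x).
  by apply: l2_sum => j; exact: l2Z.
rewrite ip_suml//; apply: eq_bigr => i _.
rewrite ipC// ip_suml// rmorph_sum mulr_sumr; apply: eq_bigr => j _.
by rewrite rmorphM mulrA [in RHS]ipC.
Qed.

End l2_convergence.

(** * Coherent states as reproducing kernels *)

Section coherent_states.
Context {R : realType}.
Variable n : nat.
Local Notation mu := (@gaussRn R n).
Local Notation lam := (@gaussCn R n).

Lemma gaussC_exp_integrable (c : R) :
  (gaussC (@ltr01 R)).-integrable [set: R[i]] (fun z => (expR (c * normc z))%:E).
Proof.
have h0 : 0 < 2^-1 :> R by rewrite invr_gt0.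
have me : measurable_fun [set: R[i]] (fun z : R[i] => expR (c * normc z)).
  apply: measurableT_comp => //; apply: measurable_funM => //.
  by apply: measurable_fun_normc.
apply/(density_integrableP _ _ _ me).
have i1 := (density_integrableP (measurable_gaussC_pdf 2^-1) (gaussC_pdf_ge0 h0)
  (integral_gaussC_pdf h0) (measurable_cst (1 : R))).1.
have {}i1 : (@lebesgue_C R).-integrable [set: R[i]] (EFin \o (fun z => 1 * gaussC_pdf 2^-1 z)).
  apply: i1; apply/integrableP; split; first exact/measurable_EFinP.
  under eq_integral do rewrite /= normr1.
  by rewrite integral_cst// mul1e [X in (X < _)%E](@probability_setT _ _ R (gaussC h0)) ltry.
(* Completing the square gives [c y - y^2 <= c^2 / 2 - y^2 / 2]; the factor 2 compensates the
   normalization [1 / (2 pi)] of the density with [k = 1 / 2]. *)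
pose K := 2 * expR (c ^+ 2 / 2).
have := integrableZl measurableT K i1; apply: le_integrable => //.
  by apply/measurable_EFinP/measurable_funM => //; exact: measurable_gaussC_pdf.
move=> z _ /=; rewrite lee_fin [leLHS]ger0_norm ?[leRHS]ger0_norm; last 2 first.
- by apply: mulr_ge0; [rewrite mulr_ge0 ?expR_ge0//|rewrite mul1r; exact: gaussC_pdf_ge0].
- by apply: mulr_ge0; [exact: expR_ge0|exact: (gaussC_pdf_ge0 ltr01)].
rewrite /gaussC_pdf mul1r /K.
have p0 : pi != 0 :> R by rewrite gt_eqF// pi_gt0.
rewrite [leRHS](_ : _ = 1 / pi * (expR (c ^+ 2 / 2) * expR (- (2^-1 * normc z ^+ 2)))); last first.
  by move: (expR _) (expR _) (@pi R) p0 => A B p p0; field.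
rewrite mulrCA ler_wpM2l ?divr_ge0 ?pi_ge0// -!expRD ler_expR.
have := sqr_ge0 (normc z - c); move: (normc z) => y; nra.
Qed.

Lemma gaussCn_exp_integrable (c : R) :
  lam.-integrable [set: 'rV[R[i]]_n] (fun w => (expR (c * \sum_j normc (w ord0 j)))%:E).
Proof.
have [|i1 _] := @cintegral_power_prod _ _ _ (gaussC (@ltr01 R)) n
    (fun j t => (expR (c * normc t))%:C) _.
  move=> j; apply: (cintegrable_le _ (gaussC_exp_integrable c)).
    by apply: measurable_fun_real; apply: measurableT_comp => //; apply: measurable_funM => //; exact: measurable_fun_normc.
  by move=> t; rewrite normc_real ger0_norm// expR_ge0.
have := integrable_normc i1; apply: eq_integrable => // x _.
rewrite -rmorph_prod normc_real ger0_norm; last by apply: prodr_ge0 => j _; exact: expR_ge0.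
by rewrite mulr_sumr expR_sum.
Qed.

Definition coherent a z : R[i] := cexp (@dotv R n z (conjv a)).

Lemma coherentC a z : coherent a z = ((coherent z a)^*)%C.
Proof.
rewrite /coherent -cexpJ; congr cexp; rewrite /dotv rmorph_sum; apply: eq_bigr => j _.
rewrite !mxE; move: (z ord0 j) (a ord0 j) => [p q] [r s].
by apply: complexP; rewrite /=; ring.
Qed.

Lemma measurable_coherent a : measurable_fun [set: 'rV[R[i]]_n] (coherent a).
Proof.
apply: measurable_fun_cexp; apply: measurable_fun_csum => j; apply: measurable_funCM => //.
exact: measurable_coord.
Qed.

Lemma coherent_lin_entire a : lin_entire (coherent a).
Proof.
move=> v u.
rewrite (_ : (fun t => _) = fun t => cexp (dotv u (conjv a) * t + dotv v (conjv a))).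
  exact: centire_cexp.
apply/funext => t; congr cexp; rewrite /dotv addrC mulr_suml -big_split/=.
by apply: eq_bigr => j _; rewrite !mxE mulrDl; congr (_ + _); ring.
Qed.

Lemma normc_coherent_le a z : normc (coherent a z) <=
  expR ((\sum_j normc (a ord0 j)) * \sum_j normc (z ord0 j)).
Proof.
rewrite normc_cexp ler_expR (le_trans (ler_norm _))// (le_trans (normr_Re_le _))//.
apply: le_trans (normc_sum _ _ _) _; rewrite mulr_sumr; apply: ler_sum => j _.
rewrite mxE normcM normcJ mulrC ler_wpM2r ?normc_ge0//.
by rewrite (bigD1 j)//= lerDl; apply: sumr_ge0 => k _; exact: normc_ge0.
Qed.

Lemma l2_coherent a : l2 lam (coherent a).
Proof.
pose c := \sum_j normc (a ord0 j); split; first exact: measurable_coherent.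
have /integrableP[mi] := gaussCn_exp_integrable (2 * c).
apply: le_lt_trans; apply: ge0_le_integral => //.
- by move=> x _; rewrite lee_fin sqr_ge0.
- by apply/measurable_EFinP; apply: measurable_sqr_normc; exact: measurable_coherent.
- exact: measurableT_comp.
move=> x _ /=; rewrite lee_fin ger0_norm ?expR_ge0//.
rewrite -mulrA expRM_natl lerXn2r// ?nnegrE ?normc_ge0 ?expR_ge0//.
exact: normc_coherent_le.
Qed.

Lemma ip_coherent F a : lin_entire F -> l2 lam F -> ip lam F (coherent a) = F a.
Proof.
move=> eF lF; rewrite -[RHS](reproducing eF).
  by apply: eq_cintegral => w; rewrite -coherentC.
have := ip_cintegrable lF (l2_coherent a).
by under eq_fun do rewrite -coherentC.
Qed.

End coherent_states.

(** * The transform is isometric *)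

Section bargmann_isometry.
Context {R : realType}.
Variable n : nat.
Local Notation mu := (@gaussRn R n).
Local Notation lam := (@gaussCn R n).
Local Notation V := (@bargmann R n).
Local Notation E := (@bargmann_kernel R n).
Implicit Types (f g : 'rV[R]_n -> R[i]) (s : seq (R[i] * 'rV[R]_n)).

(** At the real point [- b / 2] the conjugate kernel is [exp(i b.x + |b|^2 / 8)]. Hence every
    character is a multiple of a conjugate kernel, and [trig_coef] absorbs the factor
    [exp(- |b|^2 / 8)]. *)
Definition trig_point (b : 'rV[R]_n) : 'rV[R[i]]_n := complexv (- 2^-1 *: b).

Definition trig_coef (p : R[i] * 'rV[R]_n) : R[i] :=
  p.1 * cexp (- (\sum_j p.2 ord0 j ^+ 2 / 8)%:C).

Lemma trigE s x : trig s x = \sum_(p <- s) trig_coef p * ((E x (trig_point p.2))^*)%C.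
Proof.
apply: eq_bigr => p _; rewrite /trig_coef /bargmann_kernel -mulrA -cexpJ -cexpD; congr (_ * cexp _).
rewrite !rmorph_sum mulr_sumr -sumrN -big_split/=; apply: eq_bigr => j _.
rewrite /trig_point !mxE; move: (p.2 ord0 j) (x ord0 j) => u t.
have -> : 2^-1 = (2^-1)%:C :> R[i] by rewrite fmorphV rmorph_nat.
by rewrite !expr2; apply: complexP; rewrite !(ReD,ImD,ReJ,ImJ,ReM,ImM,ReN,ImN) /=; field.
Qed.

Lemma bargmann_kernelJ a z : V (fun x => ((E x a)^*)%C) z = coherent a z.
Proof.
rewrite /bargmann; under eq_cintegral do rewrite mulrC.
by have [_ ->] := bargmann_kernel_ip z a.
Qed.

Lemma l2_trig s : l2 mu (trig s).
Proof.
have [M sM] := trig_bounded s.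
apply: (@l2_bounded _ _ _ _ _ M) => //; [exact: gaussRn_setT|exact: measurable_trig].
Qed.

Lemma bargmannD f g : l2 mu f -> l2 mu g -> V (fun x => f x + g x) = (fun z => V f z + V g z).
Proof.
move=> lf lg; apply/funext => z; rewrite /bargmann -cintegralD; try exact: bargmann_cintegrable.
by apply: eq_cintegral => x; rewrite mulrDl.
Qed.

Lemma bargmannZ c f : l2 mu f -> V (fun x => c * f x) = (fun z => c * V f z).
Proof.
move=> lf; apply/funext => z; rewrite /bargmann -cintegralZ; try exact: bargmann_cintegrable.
by apply: eq_cintegral => x; rewrite mulrA.
Qed.

Lemma bargmannB f g : l2 mu f -> l2 mu g -> V (fun x => f x - g x) = (fun z => V f z - V g z).
Proof.
move=> lf lg; apply/funext => z; rewrite /bargmann -cintegralB; try exact: bargmann_cintegrable.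
by apply: eq_cintegral => x; rewrite mulrBl.
Qed.

Lemma bargmann_sum I (r : seq I) (c : I -> R[i]) (F : I -> 'rV[R]_n -> R[i]) z :
  (forall i, l2 mu (F i)) ->
  V (fun x => \sum_(i <- r) c i * F i x) z = \sum_(i <- r) c i * V (F i) z.
Proof.
move=> lF; rewrite /bargmann.
under eq_cintegral do rewrite mulr_suml.
rewrite cintegral_sum => [|i].
  apply: eq_bigr => i _; rewrite -cintegralZ; last exact: bargmann_cintegrable.
  by apply: eq_cintegral => x; rewrite mulrA.
under eq_fun do rewrite -mulrA; apply: cintegrableZ; exact: bargmann_cintegrable.
Qed.

Lemma l2_kernelJ a : l2 mu (fun x => ((E x a)^*)%C).
Proof. exact/l2J/l2_bargmann_kernel. Qed.

Lemma bargmann_trig s z : V (trig s) z = \sum_(p <- s) trig_coef p * coherent (trig_point p.2) z.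
Proof.
rewrite (_ : trig s = fun x => \sum_(p <- s) trig_coef p * ((E x (trig_point p.2))^*)%C); last first.
  by apply/funext => x; rewrite trigE.
rewrite (@bargmann_sum _ s trig_coef (fun p x => ((E x (trig_point p.2))^*)%C)).
  by apply: eq_bigr => p _; rewrite bargmann_kernelJ.
by move=> p; exact: l2_kernelJ.
Qed.

(** Both norms expand into the same double sum: the inner products of the conjugate kernels are
    given by [bargmann_kernel_ip], those of the coherent states by the reproducing property, and the
    two agree. *)
Lemma nrm2_bargmann_trig s : l2 lam (V (trig s)) /\ nrm2 lam (V (trig s)) = nrm2 mu (trig s).
Proof.
have e1 : trig s = (fun x => \sum_(p <- s) trig_coef p * ((E x (trig_point p.2))^*)%C).
  by apply/funext => x; rewrite trigE.
have e2 : V (trig s) = (fun z => \sum_(p <- s) trig_coef p * coherent (trig_point p.2) z).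
  by apply/funext => z; rewrite bargmann_trig.
have lV : l2 lam (V (trig s)).
  by rewrite e2; apply: l2_sum => p; apply: l2Z; exact: l2_coherent.
split => //.
rewrite -(fineK (nrm2_fin_num lV)) -(fineK (nrm2_fin_num (l2_trig s))); congr EFin.
apply: (@complexI R); rewrite -!ip_self//; last exact: l2_trig.
rewrite e2 e1 !ip_sum; last 2 first.
- by move=> p; exact: l2_kernelJ.
- by move=> p; exact: l2_coherent.
apply: eq_bigr => p _; apply: eq_bigr => q _; congr (_ * _).
rewrite ip_coherent; [|exact: coherent_lin_entire|exact: l2_coherent].
rewrite /ip; under eq_cintegral do rewrite conjcK mulrC.
by have [_ ->] := bargmann_kernel_ip (trig_point q.2) (trig_point p.2).
Qed.

Lemma bargmann_cvg (f_ : nat -> 'rV[R]_n -> R[i]) f g : (forall k, measurable_fun [set: 'rV[R]_n] (f_ k)) ->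
  l2 mu g -> (forall k x, normc (f_ k x) <= normc (g x)) -> (forall x, ccvg (f_^~ x) (f x)) ->
  forall z, ccvg (fun k => V (f_ k) z) (V f z).
Proof.
move=> mf_ lg fg cf z.
have ig := integrable_normc (bargmann_cintegrable z lg).
have [] := @cintegral_dominated _ _ _ mu (fun k x => f_ k x * E x z) (fun x => f x * E x z) _ _ ig => //.
- by move=> k; apply: measurable_funCM => //; exact: measurable_bargmann_kernel.
- by move=> k x; rewrite !normcM ler_wpM2r ?normc_ge0.
by move=> x; apply: ccvgM => //; exact: ccvg_cst.
Qed.

Lemma measurable_bargmann f : l2 mu f -> measurable_fun [set: 'rV[R[i]]_n] (V f).
Proof. by move=> lf; apply: entire_measurable; exact: bargmann_entire. Qed.

(** At this stage [V (f_ k)] is only known to converge pointwise, so Fatou's lemma yields an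
    inequality and not yet an equality. *)
Lemma nrm2_bargmann_lim (f_ : nat -> 'rV[R]_n -> R[i]) f g :
  (forall k, measurable_fun [set: 'rV[R]_n] (f_ k)) ->
  l2 mu g -> (forall k x, normc (f_ k x) <= normc (g x)) -> (forall x, ccvg (f_^~ x) (f x)) ->
  (forall k, (nrm2 lam (V (f_ k)) <= nrm2 mu (f_ k))%E) ->
  (nrm2 lam (V f) <= nrm2 mu f)%E.
Proof.
move=> mf_ lg fg cf IH.
have [lf_ lf f0] := nrm2_dominated mf_ lg fg cf.
apply: (@nrm2_fatou _ _ _ lam (fun k => V (f_ k)) (V f) (fun k => nrm2 mu (f_ k))) => //.
- by move=> k; exact: measurable_bargmann.
- exact: (bargmann_cvg mf_ lg fg cf).
rewrite -(fineK (nrm2_fin_num lf)).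
rewrite (_ : (fun k => nrm2 mu (f_ k)) = (fun k => (fine (nrm2 mu (f_ k)))%:E)); last first.
  by apply/funext => k; rewrite fineK// nrm2_fin_num.
apply: cvg_EFin; first exact: nearW.
exact: nrm2_cvg f0.
Qed.

Lemma l2_cst (M : R) : l2 mu (fun=> M%:C).
Proof. by apply: (@l2_bounded _ _ _ _ _ `|M|) => //; [exact: gaussRn_setT|move=> t; rewrite normc_real]. Qed.

Lemma l2_truncation f : l2 mu f -> exists f_ : nat -> 'rV[R]_n -> R[i],
  [/\ forall k, measurable_fun [set: 'rV[R]_n] (f_ k), forall k x, normc (f_ k x) <= k%:R,
      forall k x, normc (f_ k x) <= normc (f x) & forall x, ccvg (f_^~ x) (f x)].
Proof.
move=> [mf _].
pose A (k : nat) := [set x | normc (f x) <= k%:R].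
have mA k : measurable (A k).
  rewrite (_ : A k = (fun x => normc (f x)) @^-1` `]-oo, k%:R]).
    by rewrite -[X in measurable X]setTI; apply: (measurable_fun_normc mf).
  by apply/seteqP; split => x; rewrite /A /= in_itv.
exists (fun k x => f x * (\1_(A k) x)%:C); split.
- by move=> k; apply: measurable_funCM => //; apply: measurable_fun_real.
- move=> k x; rewrite normcM indicE; have [/set_mem xA|_] := boolP (x \in A k).
    by rewrite normc1 mulr1.
  by rewrite normc0 mulr0.
- move=> k x; rewrite normcM indicE; case: (x \in A k); first by rewrite normc1 mulr1.
  by rewrite normc0 mulr0 normc_ge0.
move=> x; apply: cvg_near_cst; near=> k.
rewrite indicE mem_set ?mulr1 ?subrr ?normc0// /A /=.
near: k; exact: nbhs_infty_ger.
Unshelve. all: end_near. Qed.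

Theorem bargmann_contraction f : l2 mu f -> (nrm2 lam (V f) <= nrm2 mu f)%E.
Proof.
move=> lf.
have bdd g : trig_closure g -> (nrm2 lam (V g) <= nrm2 mu g)%E.
  elim=> {g} [g s gs|g g_ M dg IH gM cg].
    by rewrite (_ : g = trig s) ?funeqE//; have [_ ->] := nrm2_bargmann_trig s.
  apply: (@nrm2_bargmann_lim g_ g (fun=> `|M|%:C)) => //.
  - by move=> k; exact: trig_closure_measurable.
  - exact: l2_cst.
  - by move=> k x; rewrite normc_real normr_id (le_trans (gM k x))// ler_norm.
have [f_ [mf_ fk ff cf]] := l2_truncation lf.
apply: (nrm2_bargmann_lim mf_ lf ff cf) => k; apply: bdd.
exact: trig_closure_bounded_measurable (fk k).
Qed.

Lemma l2_bargmann f : l2 mu f -> l2 lam (V f).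
Proof.
move=> lf; split; first exact: measurable_bargmann.
by apply: le_lt_trans (bargmann_contraction lf) _; case: lf.
Qed.

(** The contraction property, applied to [f_ k - f], upgrades pointwise convergence of [V (f_ k)] to
    convergence in norm. The norms on both sides then converge, and equality passes to the limit. *)
Lemma bargmann_isometry_lim (f_ : nat -> 'rV[R]_n -> R[i]) f g :
  (forall k, measurable_fun [set: 'rV[R]_n] (f_ k)) ->
  l2 mu g -> (forall k x, normc (f_ k x) <= normc (g x)) -> (forall x, ccvg (f_^~ x) (f x)) ->
  (forall k, nrm2 lam (V (f_ k)) = nrm2 mu (f_ k)) ->
  nrm2 lam (V f) = nrm2 mu f.
Proof.
move=> mf_ lg fg cf IH.
have [lf_ lf f0] := nrm2_dominated mf_ lg fg cf.
rewrite -(fineK (nrm2_fin_num lf)) -(fineK (nrm2_fin_num (l2_bargmann lf))); congr EFin.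
have c1 := nrm2_cvg lf_ lf f0.
have c2 : fine (nrm2 lam (V (f_ k))) @[k --> \oo] --> fine (nrm2 lam (V f)).
  apply: nrm2_cvg => [k||]; try exact: l2_bargmann.
  apply: (@squeeze_cvge _ _ _ _ (fun=> 0%E) _ (fun k => nrm2 mu (fun x => f_ k x - f x)%R)) => //.
    apply: nearW => k; rewrite nrm2_ge0/= -bargmannB//.
    by apply: bargmann_contraction; exact: l2B.
  exact: cvg_cst.
rewrite (_ : (fun k => fine (nrm2 lam (V (f_ k)))) = fun k => fine (nrm2 mu (f_ k))) in c2.
  exact: cvg_unique c2 c1.
by apply/funext => k; rewrite IH.
Qed.

Theorem bargmann_isometry f : l2 mu f -> nrm2 lam (V f) = nrm2 mu f.
Proof.
move=> lf.
have bdd g : trig_closure g -> nrm2 lam (V g) = nrm2 mu g.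
  elim=> {g} [g s gs|g g_ M dg IH gM cg].
    by rewrite (_ : g = trig s) ?funeqE//; have [_ ->] := nrm2_bargmann_trig s.
  apply: (@bargmann_isometry_lim g_ g (fun=> `|M|%:C)) => //.
  - by move=> k; exact: trig_closure_measurable.
  - exact: l2_cst.
  - by move=> k x; rewrite normc_real normr_id (le_trans (gM k x))// ler_norm.
have [f_ [mf_ fk ff cf]] := l2_truncation lf.
apply: (bargmann_isometry_lim mf_ lf ff cf) => k; apply: bdd.
exact: trig_closure_bounded_measurable (fk k).
Qed.

Theorem bargmann_ip f g : l2 mu f -> l2 mu g -> ip lam (V f) (V g) = ip mu f g.
Proof.
move=> lf lg; apply: isometry_ip => //.
- exact: l2_bargmann.
- exact: bargmann_isometry.
- by move=> *; exact: bargmannD.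
- by move=> *; exact: bargmannZ.
Qed.

End bargmann_isometry.

(** * Completeness of L2 *)

Section riesz_fischer.
Context {R : realType} {d} {T : measurableType d}.
Variable mu : {measure set T -> \bar R}.
Hypothesis mu1 : mu [set: T] = 1%E.
Implicit Types f g : T -> R[i].

Lemma ae_nrm2 f g : measurable_fun [set: T] f -> measurable_fun [set: T] g ->
  (\forall x \ae mu, f x = g x) -> nrm2 mu f = nrm2 mu g.
Proof.
move=> mf mg fg; apply: ae_eq_integral => //.
- exact/measurable_EFinP/measurable_sqr_normc.
- exact/measurable_EFinP/measurable_sqr_normc.
- by apply: filterS fg => x /= -> _.
Qed.

Lemma ccvg_summable (u : nat -> R[i]) (M : R) :
  (forall k, \sum_(i < k) normc (u i.+1 - u i) <= M) -> exists l, ccvg u l.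
Proof.
move=> uM.
have cn : cvgn (series (fun i => normc (u i.+1 - u i))).
  apply: nondecreasing_is_cvgn; first by apply: nondecreasing_series => i _ _; exact: normc_ge0.
  by exists M => _ [k _ <-]; rewrite seriesEord; exact: uM.
have part (h : {additive R[i] -> R}) : (forall z, `|h z| <= normc z) -> cvgn (fun k => h (u k)).
  move=> hn.
  have : cvgn (series (telescope (fun k => h (u k)))).
    apply: normed_cvg; apply: series_le_cvg cn => k //=; first exact: normc_ge0.
    by rewrite [telescope _ _](_ : _ = h (u k.+1 - u k)) ?hn// raddfB.
  rewrite telescopeK => c1.
  rewrite (_ : (fun k => h (u k)) = (fun k => h (u k) - h (u 0%N)) \+ (fun=> h (u 0%N))).
    by apply: is_cvgD => //; exact: is_cvg_cst.
  by apply/funext => k /=; rewrite subrK.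
exists (limn (fun k => complex.Re (u k)) +i* limn (fun k => complex.Im (u k))).
apply/ccvgP; split; apply: part; [exact: normr_Re_le|exact: normr_Im_le].
Qed.

Lemma measurable_fun_sub f g : measurable_fun [set: T] f -> measurable_fun [set: T] g ->
  measurable_fun [set: T] (fun x => f x - g x).
Proof.
move=> mf mg; under eq_fun do rewrite -[X in _ + X]mulN1r.
by apply: measurable_funCD => //; exact: measurable_funCM.
Qed.

(** The rate [8 ^+ k] makes the L1 norms of consecutive differences summable, so these differences
    are absolutely summable at almost every point. Fatou's lemma then bounds the distance to the
    pointwise limit. *)
Theorem l2_complete (u : nat -> T -> R[i]) (C : R) : 0 <= C -> (forall k, l2 mu (u k)) ->
  (forall k l, (k <= l)%N -> (nrm2 mu (fun x => u l x - u k x)%R <= (C / 8 ^+ k)%:E)%E) ->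
  exists2 f, l2 mu f & (nrm2 mu (fun x => u k x - f x)%R @[k --> \oo] --> 0)%E.
Proof.
move=> C0 lu uC.
pose h k x : R := normc (u k.+1 x - u k x).
have mh k : measurable_fun [set: T] (h k).
  by apply: measurable_fun_normc; case: (l2B (lu k.+1) (lu k)).
(* [r / 2 ^ (k + 1)] is [(1 + C) / 2 ^ k], written as a term of the series of halves whose sum is
   [r]. *)
pose r : R := 2 * (1 + C).
have lB k l : l2 mu (fun x => u l x - u k x) by exact: l2B.
have mhE k : measurable_fun [set: T] (fun x => (h k x)%:E) by apply/measurable_EFinP.
have ih k : (\int[mu]_x (h k x)%:E <= (r / (2 ^ (k + 1))%:R)%:E)%E.
  pose a : R := (2 ^+ k)^-1.
  have a0 : 0 < a by rewrite invr_gt0 exprn_gt0.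
  (* [t <= 2^-k + 2^k t^2] replaces the Cauchy-Schwarz inequality *)
  apply: (@le_trans _ _ (\int[mu]_x (a + 2 ^+ k * h k x ^+ 2)%:E)%E).
    apply: ge0_le_integral => //.
    - by move=> x _; rewrite lee_fin normc_ge0.
    - by apply/measurable_EFinP; apply: measurable_funD => //; apply: measurable_funM => //; exact: measurable_funX.
    move=> x _; rewrite lee_fin; move: (h k x) => t.
    have ab : 2 ^+ k * a = 1 by rewrite /a mulfV// expf_neq0.
    have b0 : 0 < 2 ^+ k :> R by rewrite exprn_gt0.
    move: (2 ^+ k) ab b0 => b ab b0; rewrite -subr_ge0.
    rewrite (_ : _ - t = b * ((t - a / 2) ^+ 2 + 3 / 4 * a ^+ 2)); last first.
      rewrite [RHS](_ : _ = b * t ^+ 2 - (b * a) * t + (b * a) * a); last by field.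
      by rewrite ab; ring.
    by apply: mulr_ge0; [exact: ltW|apply: addr_ge0; [exact: sqr_ge0|apply: mulr_ge0; [lra|exact: sqr_ge0]]].
  have -> : (\int[mu]_x (a + 2 ^+ k * h k x ^+ 2)%:E = a%:E + (2 ^+ k)%:E * nrm2 mu (fun x => u k.+1 x - u k x)%R)%E.
    under eq_integral do rewrite EFinD EFinM.
    rewrite ge0_integralD//; last 3 first.
    - by move=> x _; rewrite lee_fin ltW.
    - by move=> x _; rewrite -EFinM lee_fin; apply: mulr_ge0; [exact: exprn_ge0|exact: sqr_ge0].
    - by apply/measurable_EFinP; apply: measurable_funM => //; exact: measurable_funX.
    rewrite integral_cst// mu1 mule1 ge0_integralZl_EFin ?exprn_ge0//.
    - by move=> x _; rewrite lee_fin sqr_ge0.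
    - by apply/measurable_EFinP; exact: measurable_funX.
  apply: (@le_trans _ _ (a%:E + (2 ^+ k)%:E * (C / 8 ^+ k)%:E)%E).
    by rewrite leeD2l// lee_wpmul2l ?lee_fin ?exprn_ge0//; exact: uC.
  rewrite -EFinM -EFinD lee_fin natrX addn1 exprS.
  rewrite [leRHS](_ : _ = (1 + C) * a); last by rewrite /r /a; field; rewrite expf_neq0.
  rewrite mulrDl mul1r lerD2l mulrCA; apply: ler_wpM2l => //.
  rewrite -[8]/(8%:R) (_ : 8%:R = 2 ^+ 3 :> R); last by ring.
  rewrite /a -exprM mulnC exprM -[2 ^+ k * _]divr1 ler_pdivrMr// mulr1.
  have y1 : 1 <= 2 ^+ k :> R by rewrite exprn_ege1// ler1n.
  move: (2 ^+ k) y1 => y y1.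
  have y0 : 0 < y by lra.
  rewrite ler_pdivrMr ?exprn_gt0//.
  rewrite (_ : y^-1 * y ^+ 3 = y ^+ 2); last by field; lra.
  by rewrite expr2 ler_peMr// ltW.
pose S x := (\sum_(k <oo) (h k x)%:E)%E.
have h0 k x : (0 <= (h k x)%:E)%E by rewrite lee_fin normc_ge0.
have iS : (\int[mu]_x S x <= r%:E)%E.
  rewrite integral_nneseries//.
  have := @cvg_geometric_eseries_half R r 0; rewrite expr0 divr1 => /cvg_lim <-//.
  apply: lee_nneseries => [k _ _|k _]; first exact: integral_ge0.
  exact: ih.
have S0 x : (0 <= S x)%E by apply: nneseries_ge0 => k _ _.
have mS : measurable_fun [set: T] S.
  rewrite (_ : S = fun x => (\sum_(k <oo | k \in xpredT) (h k x)%:E)%E).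
    by apply: ge0_emeasurable_sum => // k x _ _.
  by apply/funext => x; apply: eq_eseriesl.
have integrableS : mu.-integrable [set: T] S.
  apply/integrableP; split => //.
  under eq_integral do rewrite gee0_abs//.
  by apply: le_lt_trans iS _; rewrite ltry.
pose B := [set x | S x < +oo]%E.
have mB : measurable B.
  rewrite (_ : B = ~` (S @^-1` [set +oo%E])).
    by apply: measurableC; rewrite -[X in measurable X]setTI; apply: mS => //; exact: emeasurable_set1.
  by apply/seteqP; split => x; rewrite /B /= ltey => /eqP.
have aeB : \forall x \ae mu, B x.
  have := integrable_ae measurableT integrableS.
  by apply: filterS => x /(_ Logic.I); rewrite ge0_fin_numE.
have cB x : B x -> exists l, ccvg (u ^~ x) l.
  move=> Bx; apply: (@ccvg_summable _ (fine (S x))) => k.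
  rewrite -lee_fin fineK ?ge0_fin_numE// -sumEFin -(big_mkord xpredT (fun i => (h i x)%:E)).
  by apply: nneseries_lim_ge => i _ _.
(* Cutting off outside [B] makes the sequence converge at every point, so that its limit is
   measurable; on [B], hence almost everywhere, nothing changes. *)
pose v k x := u k x * (\1_B x)%:C.
have cv x : exists l, ccvg (v ^~ x) l.
  have [Bx|nBx] := pselect (B x).
    have [l ul] := cB x Bx; exists l; rewrite /v.
    by under eq_fun do rewrite indicE mem_set// mulr1.
  exists 0; rewrite /v; under eq_fun do rewrite indicE memNset// mulr0.
  exact: ccvg_cst.
have [f vf] := choice cv.
have mv k : measurable_fun [set: T] (v k).
  by apply: measurable_funCM; [case: (lu k)|apply: measurable_fun_real].
have vu k l x : normc (v l x - v k x) <= normc (u l x - u k x).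
  rewrite /v -mulrBl normcM indicE; case: (x \in B); first by rewrite normc1 mulr1.
  by rewrite normc0 mulr0 normc_ge0.
have lv k : l2 mu (v k).
  apply: l2_le (lu k) _ => // x; rewrite /v normcM indicE; case: (x \in B).
    by rewrite normc1 mulr1.
  by rewrite normc0 mulr0 normc_ge0.
have mf := measurable_fun_ccvg mv vf.
have fv k : (nrm2 mu (fun x => f x - v k x)%R <= (C / 8 ^+ k)%:E)%E.
  apply: (@nrm2_fatou _ _ _ mu (fun l x => v (l + k)%N x - v k x) _ (fun=> (C / 8 ^+ k)%:E)).
  - by move=> l; case: (l2B (lv (l + k)%N) (lv k)).
  - move=> x; apply: ccvgD; last exact: ccvg_cst.
    by have := vf x; rewrite /ccvg -(cvg_shiftn k).
  - move=> l; apply: le_trans (uC k (l + k)%N _); last exact: leq_addl.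
    by apply: le_nrm2 => //; [case: (l2B (lv (l + k)%N) (lv k))|case: (lB k (l + k)%N)].
  - exact: cvg_cst.
have fu k : nrm2 mu (fun x => u k x - f x)%R = nrm2 mu (fun x => f x - v k x)%R.
  rewrite [RHS](@eq_nrm2 _ _ _ mu _ (fun x => v k x - f x)) => [|x]; last exact: normcB.
  apply: ae_nrm2.
  - by apply: measurable_fun_sub; [case: (lu k)|].
  - by apply: measurable_fun_sub.
  - by apply: filterS aeB => x Bx; rewrite /v indicE mem_set// mulr1.
have lf : l2 mu f.
  rewrite (_ : f = fun x => (f x - v 0%N x) + v 0%N x); last by apply/funext => x; rewrite subrK.
  apply: l2D (lv 0%N); split; first exact: measurable_fun_sub.
  by apply: le_lt_trans (fv 0%N) _; rewrite ltry.
exists f => //.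
apply: (@squeeze_cvge _ _ _ _ (fun=> 0%E) _ (fun k => (C / 8 ^+ k)%:E)).
- by apply: nearW => k; rewrite nrm2_ge0 fu fv.
- exact: cvg_cst.
apply: cvg_EFin; first exact: nearW.
rewrite -[X in _ --> X](mulr0 C); apply: cvgM; first exact: cvg_cst.
under eq_cvg do rewrite -exprVn.
by apply: cvg_expr; rewrite ger0_norm ?invr_ge0// invf_lt1// ltr1n.
Qed.

End riesz_fischer.

Section square_norm.
Context {R : realType} {d} {T : measurableType d}.
Variable mu : {measure set T -> \bar R}.
Implicit Types f g : T -> R[i].

Definition sqn f : R := fine (nrm2 mu f).

Lemma sqn_ge0 f : 0 <= sqn f.
Proof. by rewrite fine_ge0// nrm2_ge0. Qed.

Lemma sqnZ c f : l2 mu f -> sqn (fun x => c * f x) = normc c ^+ 2 * sqn f.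
Proof. by move=> lf; rewrite /sqn nrm2Z ?fineM//; [exact: nrm2_fin_num|case: lf]. Qed.

Lemma sqnD f g : l2 mu f -> l2 mu g ->
  sqn (fun x => f x + g x) = sqn f + sqn g + 2 * complex.Re (ip mu f g).
Proof. exact: nrm2D. Qed.

Lemma sqn_parallelogram f g : l2 mu f -> l2 mu g ->
  sqn (fun x => f x - g x) = 2 * sqn f + 2 * sqn g - sqn (fun x => f x + g x).
Proof.
move=> lf lg; have lNg := l2Z (-1) lg.
have -> : (fun x => f x - g x) = (fun x => f x + -1 * g x) by apply/funext => x; rewrite mulN1r.
rewrite !sqnD// ipZr// sqnZ//.
rewrite normcN normc1 expr1n mul1r rmorphN rmorph1 mulN1r ReN; ring.
Qed.

Lemma sqn_sub f g : l2 mu f -> l2 mu g ->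
  sqn (fun x => f x - g x) = sqn f + sqn g - 2 * complex.Re (ip mu f g).
Proof.
move=> lf lg; have lNg := l2Z (-1) lg.
have -> : (fun x => f x - g x) = (fun x => f x + -1 * g x) by apply/funext => x; rewrite mulN1r.
rewrite !sqnD// ipZr// sqnZ//.
rewrite normcN normc1 expr1n mul1r rmorphN rmorph1 mulN1r ReN; ring.
Qed.

(** Testing with [t = s * c] gives [2 s |c|^2 <= s^2 |c|^2 sqn g]. As [s] is the inverse of
    [sqn g + 1], [s * sqn g] is at most 1 and [c] must vanish; the added 1 covers [sqn g = 0]. *)
Lemma orthogonal_of_minimal f g : l2 mu f -> l2 mu g ->
  (forall t : R[i], sqn f <= sqn (fun x => f x - t * g x)) -> ip mu f g = 0.
Proof.
move=> lf lg fmin; set c := ip mu f g.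
pose s := (sqn g + 1)^-1.
have N0 := sqn_ge0 g.
have s0 : 0 < s by rewrite invr_gt0 ltr_wpDl.
have := fmin (s%:C * c); rewrite sqn_sub//; last exact: l2Z.
rewrite ipZr// -/c sqnZ// normcM normc_real gtr0_norm// rmorphM.
have -> : complex.Re (conjc s%:C * (c^*)%C * c) = s * normc c ^+ 2.
  rewrite sqr_normc_ReIm; case: (c) => p q /=; ring.
move=> h; apply/eqP; rewrite -normc_eq0 -sqrf_eq0.
have sN : s * sqn g <= 1.
  by rewrite /s mulrC ler_pdivrMr ?mul1r ?lerDl// ltr_wpDl.
have c0 := sqr_ge0 (normc c).
rewrite eq_le c0 andbT.
have : 2 * normc c ^+ 2 <= (s * sqn g) * normc c ^+ 2.
  rewrite -(ler_pM2l s0).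
  move: h; rewrite exprMn; move: (sqn f) (normc c ^+ 2) (sqn g) => A B D; nra.
move: (normc c ^+ 2) (s * sqn g) c0 sN => A B; nra.
Qed.

End square_norm.

(** * The transform maps onto the Fock space *)

Section bargmann_surjective.
Context {R : realType}.
Variable n : nat.
Local Notation mu := (@gaussRn R n).
Local Notation lam := (@gaussCn R n).
Local Notation V := (@bargmann R n).
Local Notation E := (@bargmann_kernel R n).

(* Among the [V g], the one closest to [F] differs from [F] by a function orthogonal to
   every coherent state, hence by [0] according to the reproducing property. *)
Theorem bargmann_surjective F : lin_entire F -> l2 lam F ->
  exists2 g, l2 mu g & forall z, V g z = F z.
Proof.
move=> eF lF.
pose D g := sqn lam (fun z => F z - V g z).
have lD g : l2 mu g -> l2 lam (fun z => F z - V g z).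
  by move=> lg; apply: l2B => //; exact: l2_bargmann.
pose S := [set D g | g in l2 mu].
have Sinf : has_inf S.
  split; first by exists (D (fun=> 0)), (fun=> 0) => //; exact: l2_0.
  by exists 0 => _ [g _ <-]; exact: sqn_ge0.
have Dinf g : l2 mu g -> inf S <= D g.
  by move=> lg; apply: (ge_inf Sinf.2); exists g.
(* The tolerance [(8 ^+ k)^-1] is the rate that [l2_complete] asks for. *)
have ex k : exists g, l2 mu g /\ D g <= inf S + (8 ^+ k)^-1.
  have e0 : 0 < (8 ^+ k)^-1 :> R by rewrite invr_gt0 exprn_gt0.
  have [_ [g lg <-] h] := inf_adherent e0 Sinf.
  by exists g; split => //; exact: ltW.
have [u hu] := choice ex.
have lu k : l2 mu (u k) by have [] := hu k.
(* Parallelogram law: the midpoint of [u k] and [u l] cannot do better than the infimum, so the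
   images are at squared distance at most [2 / 8 ^+ k + 2 / 8 ^+ l]. The isometry carries this back
   to [u k] and [u l]. *)
have uu k l : (k <= l)%N -> (nrm2 mu (fun x => u l x - u k x)%R <= (4 / 8 ^+ k)%:E)%E.
  move=> kl.
  have luB : l2 mu (fun x => u l x - u k x) by exact: l2B.
  rewrite -bargmann_isometry// -(fineK (nrm2_fin_num (l2_bargmann luB))) lee_fin.
  rewrite bargmannB//.
  have -> : fine (nrm2 lam (fun z => V (u l) z - V (u k) z)%R) =
     sqn lam (fun z => (F z - V (u k) z) - (F z - V (u l) z)).
    by congr (fine (nrm2 _ _)); apply/funext => z; ring.
  rewrite sqn_parallelogram; try exact: lD.
  have lm : l2 mu (fun x => 2^-1 * (u k x + u l x)) by apply: l2Z; exact: l2D.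
  have -> : (fun z => F z - V (u k) z + (F z - V (u l) z)) =
      (fun z => 2 * (F z - V (fun x => 2^-1 * (u k x + u l x)) z)).
    apply/funext => z; rewrite bargmannZ; last exact: l2D.
    by rewrite bargmannD//; field.
  rewrite sqnZ; last exact: lD.
  have n2 : normc (2 : R[i]) = 2 by rewrite -(rmorph_nat (real_complex R)) normc_real ger0_norm.
  have [_ h1] := hu k; have [_ h2] := hu l; have h3 := Dinf _ lm.
  have h4 : (8 ^+ l)^-1 <= (8 ^+ k)^-1 :> R.
    by rewrite lef_pV2 ?posrE ?exprn_gt0// ler_weXn2l// ler1n.
  rewrite n2; rewrite /D in h1 h2 h3.
  set a := sqn lam (fun z => F z - V (u l) z) in h2 *.
  set b := sqn lam (fun z => F z - V (u k) z) in h1 *.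
  set c := sqn lam _ in h3 *.
  move: a b c (inf S) ((8 ^+ k)^-1) ((8 ^+ l)^-1) h1 h2 h3 h4 => a b c e p q; nra.
have [g lg ug] := l2_complete (@gaussRn_setT R n) (ler0n R 4) lu uu.
have Vug : (nrm2 lam (fun z => (F z - V (u k) z) - (F z - V g z))%R @[k --> \oo] --> 0)%E.
  rewrite (_ : (fun k => _) = fun k => nrm2 mu (fun x => u k x - g x)%R)//.
  apply/funext => k; rewrite -bargmann_isometry ?bargmannB//; last exact: l2B.
  by apply: eq_nrm2 => z; rewrite normcB; congr normc; ring.
have Dg : D g <= inf S.
  have c1 : D (u k) @[k --> \oo] --> D g.
    by apply: (nrm2_cvg _ _ Vug) => [k|]; exact: lD.
  have c2 : inf S + (8 ^+ k)^-1 @[k --> \oo] --> inf S.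
    rewrite -[X in _ --> X]addr0; apply: cvgD; first exact: cvg_cst.
    under eq_cvg do rewrite -exprVn.
    by apply: cvg_expr; rewrite ger0_norm ?invr_ge0// invf_lt1// ltr1n.
  by apply: (ler_cvg_to c1 c2); apply: nearW => k; have [] := hu k.
exists g => // a.
have la : l2 mu (fun x => ((E x a)^*)%C) by exact: l2_kernelJ.
have : ip lam (fun z => F z - V g z) (coherent a) = 0.
  apply: orthogonal_of_minimal; [exact: lD|exact: l2_coherent|].
  move=> t; apply: (le_trans Dg).
  have lt : l2 mu (fun x => t * ((E x a)^*)%C) by exact: l2Z.
  have -> : (fun z => F z - V g z - t * coherent a z) =
      (fun z => F z - V (fun x => g x + t * ((E x a)^*)%C) z).
    apply/funext => z; rewrite bargmannD// bargmannZ// bargmann_kernelJ; ring.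
  by apply: Dinf; exact: l2D.
rewrite /ip; under eq_cintegral do rewrite mulrBl.
rewrite cintegralB; last 2 first.
- by apply: ip_cintegrable => //; exact: l2_coherent.
- by apply: ip_cintegrable; [exact: l2_bargmann|exact: l2_coherent].
rewrite -/(ip _ _ _) -/(ip _ _ _) !ip_coherent//; last 2 first.
- by apply: entire_lin_entire; exact: bargmann_entire.
- exact: l2_bargmann.
by move/eqP; rewrite subr_eq0 => /eqP.
Qed.

End bargmann_surjective.

(** * The operators [S_phi] *)

Section symbol.
Context {R : realType}.
Variable n : nat.
Local Notation mu := (@gaussRn R n).
Local Notation lam := (@gaussCn R n).
Local Notation V := (@bargmann R n).
Local Notation E := (@bargmann_kernel R n).
Implicit Types (m f g : 'rV[R]_n -> R[i]) (phi : 'rV[R[i]]_n -> R[i]) (z w a : 'rV[R[i]]_n).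

Lemma mulcC (u v : R[i]) : ((u * v)^*)%C = (u^*)%C * (v^*)%C.
Proof. exact: rmorphM. Qed.

(** The cross term [- z.conj w] of [(z - conj w)^2 / 2] cancels the exponential factor, so for fixed
    [x] the variables [z] and [w] separate. This is what turns [S_phi] into a multiplication in
    [x]. *)
Lemma bargmann_kernel_conj x z w :
  cexp (dotv z (conjv w)) * E x (z - conjv w) = E x z * ((E x w)^*)%C.
Proof.
rewrite /bargmann_kernel -cexpJ -!cexpD /dotv (rmorph_sum (@conjc R)) -!big_split/=.
congr cexp; apply: eq_bigr => j _; rewrite !mxE.
have -> : 2^-1 = (2^-1)%:C :> R[i] by rewrite fmorphV rmorph_nat.
move: (z ord0 j) (w ord0 j) (x ord0 j) => [p q] [r s] t.
by rewrite !expr2; apply: complexP; rewrite !(ReD,ImD,ReJ,ImJ,ReM,ImM,ReN,ImN) /=; field.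
Qed.

Lemma symbol_kernel m z w : l2 mu m ->
  cexp (dotv z (conjv w)) * V m (z - conjv w) =
  cintegral mu (fun x => m x * (E x z * ((E x w)^*)%C)).
Proof.
move=> lm; rewrite /bargmann -cintegralZ; last exact: bargmann_cintegrable.
by apply: eq_cintegral => x; rewrite mulrCA bargmann_kernel_conj.
Qed.

(** For fixed [z] the integrand is [V g] times the conjugate of [V h], where [h] is the conjugate of
    [m * E(., z)]; boundedness of [m] keeps [h] in L2. The integral is thus an inner product, which
    the isometry moves back to [R^n]. *)
Theorem bounded_symbol m (M : R) g z : measurable_fun [set: 'rV[R]_n] m ->
  (forall x, normc (m x) <= M) -> l2 mu g ->
  cintegrable lam (S_integrand (V m) (V g) z) /\
  cintegral lam (S_integrand (V m) (V g) z) = V (fun x => m x * g x) z.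
Proof.
move=> mm mM lg.
have lm : l2 mu m by apply: l2_bounded mM => //; exact: gaussRn_setT.
have lmE : l2 mu (fun x => ((m x * E x z)^*)%C).
  apply: l2J; under eq_fun do rewrite mulrC.
  exact: l2_mul_bounded (l2_bargmann_kernel z) mm mM.
have Se w : S_integrand (V m) (V g) z w = V g w * ((V (fun x => ((m x * E x z)^*)%C) w)^*)%C.
  rewrite /S_integrand -mulrA symbol_kernel// /bargmann -cintegralJ; last first.
    by apply: l2_cintegrable_mul => //; exact: l2_bargmann_kernel.
  by congr (_ * _); apply: eq_cintegral => x; rewrite [RHS]mulcC conjcK mulrA.
split.
  by rewrite (funext Se); apply: ip_cintegrable; exact: l2_bargmann.
rewrite (funext Se).
rewrite -/(ip lam _ _) bargmann_ip// /ip /bargmann.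
by apply: eq_cintegral => x; rewrite conjcK mulrA (mulrC (g x)).
Qed.

(** The factor depends on [w] only through [conj w], holomorphically; conjugating its value makes it
    holomorphic in [w]. *)
Lemma symbol_lin_entire m z : l2 mu m ->
  lin_entire (fun w => ((cexp (dotv z (conjv w)) * V m (z - conjv w))^*)%C).
Proof.
move=> lm v u.
pose W (s : R[i]) := cexp (dotv z (conjv u) * s + dotv z (conjv v)) *
  V m ((z - conjv v) + s *: (- conjv u)).
have cW : centire W.
  apply: centireM; first exact: centire_cexp.
  exact: (entire_lin_entire (bargmann_entire lm)).
rewrite (_ : (fun t => _) = fun t => ((W (t^*)%C)^*)%C).
  by move=> t; apply: cdiff_conjJ; exact: cW.
apply/funext => t; rewrite /W.
have -> : conjv (v + t *: u) = conjv v + (t^*)%C *: conjv u.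
  by apply/rowP => j; rewrite !mxE; apply: complexP; rewrite !(ReD,ImD,ReJ,ImJ,ReM,ImM) /=; ring.
have -> : z - (conjv v + (t^*)%C *: conjv u) = z - conjv v + (t^*)%C *: - conjv u.
  by rewrite scalerN opprD addrA.
rewrite (_ : dotv z _ = dotv z (conjv u) * (t^*)%C + dotv z (conjv v))//.
rewrite /dotv addrC mulr_suml -big_split/=; apply: eq_bigr => j _.
by rewrite !mxE; ring.
Qed.

(* The integrand is the conjugate of an entire function of [w] times a coherent state,
   so the reproducing property evaluates the integral at [w = a]. *)
Lemma symbol_coherent m a z : l2 mu m -> cintegrable lam (S_integrand (V m) (coherent a) z) ->
  cintegral lam (S_integrand (V m) (coherent a) z) =
  cintegral mu (fun x => m x * (E x z * ((E x a)^*)%C)).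
Proof.
move=> lm iS.
pose H w := ((cexp (dotv z (conjv w)) * V m (z - conjv w))^*)%C.
have SE w : S_integrand (V m) (coherent a) z w = ((H w * cexp (dotv a (conjv w)))^*)%C.
  rewrite /S_integrand -mulrA mulcC /H conjcK mulrC; congr (_ * _).
  by rewrite coherentC.
have iH : cintegrable lam (fun w => H w * cexp (dotv a (conjv w))).
  have := cintegrableJ iS; rewrite (funext SE); under eq_fun do rewrite conjcK; exact.
rewrite (funext SE).
rewrite cintegralJ// reproducing//; last exact: symbol_lin_entire.
by rewrite /H conjcK symbol_kernel.
Qed.

Lemma coherent_entire a : entire (coherent a).
Proof.
rewrite (_ : coherent a = V (fun x => ((E x a)^*)%C)).
  by apply: bargmann_entire; exact: l2_kernelJ.
by apply/funext => z; rewrite bargmann_kernelJ.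
Qed.

(** At a real point the kernel is a constant times a character, hence bounded in [x]. This makes the
    product of [m], a kernel and such a conjugate kernel integrable although [m] is only in L2. *)
Lemma normc_bargmann_kernel_trig_point x (b : 'rV[R]_n) :
  normc (((E x (trig_point b))^*)%C) <= expR (\sum_j b ord0 j ^+ 2 / 8).
Proof.
rewrite normcJ normc_cexp ler_expR (raddf_sum (@complex.Re R)).
apply: ler_sum => j _; rewrite /trig_point !mxE.
have -> : 2^-1 = (2^-1)%:C :> R[i] by rewrite fmorphV rmorph_nat.
move: (b ord0 j) (x ord0 j) => u t.
rewrite expr2 [leLHS](_ : _ = u ^+ 2 / 8)//.
etransitivity; first exact: ReD.
by rewrite !(ReM,ImM) /=; field.
Qed.

Lemma symbol_trig m s z : l2 mu m ->
  (forall a, cintegrable lam (S_integrand (V m) (coherent a) z)) ->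
  cintegral lam (S_integrand (V m) (V (trig s)) z) = V (fun x => m x * trig s x) z.
Proof.
move=> lm iS.
have SE w : S_integrand (V m) (V (trig s)) z w =
    \sum_(p <- s) trig_coef p * S_integrand (V m) (coherent (trig_point p.2)) z w.
  rewrite /S_integrand bargmann_trig !mulr_suml; apply: eq_bigr => p _.
  by rewrite !mulrA.
rewrite (funext SE).
rewrite cintegral_sum => [|p]; last exact: cintegrableZ.
have iE p : cintegrable mu (fun x => m x * (E x z * ((E x (trig_point p.2))^*)%C)).
  have := l2_cintegrable_mul (l2_mul_bounded lm (measurable_funCJ (measurable_bargmann_kernel (trig_point p.2)))
    (fun x => _)) (l2_bargmann_kernel z).
  move=> /(_ _ (fun x => normc_bargmann_kernel_trig_point x p.2)).
  by under eq_fun do rewrite -mulrA [((E _ _)^*)%C * _]mulrC.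
transitivity (\sum_(p <- s) trig_coef p * cintegral mu (fun x => m x * (E x z * ((E x (trig_point p.2))^*)%C))).
  by apply: eq_bigr => p _; rewrite cintegralZ// symbol_coherent.
under eq_bigr do rewrite -cintegralZ//.
rewrite -cintegral_sum => [|p]; last exact: cintegrableZ.
apply: eq_cintegral => x; rewrite trigE mulr_sumr mulr_suml; apply: eq_bigr => p _; ring.
Qed.

Theorem symbol_trig_bound m (A : R) s : l2 mu m ->
  (forall F, entire F -> l2 lam F -> forall z, cintegrable lam (S_integrand (V m) F z)) ->
  (forall F, entire F -> l2 lam F ->
    (nrm2 lam (fun z => cintegral lam (S_integrand (V m) F z)) <= (A ^+ 2)%:E * nrm2 lam F)%E) ->
  (nrm2 mu (fun x => m x * trig s x)%R <= (A ^+ 2)%:E * nrm2 mu (trig s))%E.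
Proof.
move=> lm iS bS.
have [M sM] := trig_bounded s.
have lms : l2 mu (fun x => m x * trig s x) by exact: l2_mul_bounded lm (measurable_trig s) sM.
have ls := l2_trig s.
rewrite -(bargmann_isometry lms) -(bargmann_isometry ls).
apply: le_trans (bS _ (bargmann_entire ls) (l2_bargmann ls)).
rewrite (_ : (fun z => _) = V (fun x => m x * trig s x))//.
apply/funext => z; apply: symbol_trig => // a.
by apply: iS; [exact: coherent_entire|exact: l2_coherent].
Qed.

(** Induction on [trig_closure]: in a bounded pointwise limit the left side is controlled by Fatou's
    lemma, since [m * f_ k] need not be dominated by a function known beforehand to satisfy the
    bound, while the right side converges. *)
Theorem multiplier_bound m (A : R) : l2 mu m ->
  (forall s, nrm2 mu (fun x => m x * trig s x)%R <= (A ^+ 2)%:E * nrm2 mu (trig s))%E ->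
  forall (f : 'rV[R]_n -> R[i]) (M : R), measurable_fun [set: 'rV[R]_n] f -> (forall x, normc (f x) <= M) ->
  (nrm2 mu (fun x => m x * f x)%R <= (A ^+ 2)%:E * nrm2 mu f)%E.
Proof.
move=> lm mA f M mf fM; have := trig_closure_bounded_measurable mf fM.
elim=> {mf fM f M} [f s fs|f f_ M df IH fM cf].
  by rewrite (_ : f = trig s) ?funeqE//.
have mf_ k : measurable_fun [set: 'rV[R]_n] (f_ k) by exact: trig_closure_measurable.
have fM' k x : normc (f_ k x) <= normc (`|M|%:C : R[i]).
  by rewrite normc_real normr_id (le_trans (fM k x))// ler_norm.
have [lf_ lf f0] := nrm2_dominated mf_ (@l2_cst R n `|M|) fM' cf.
apply: (@nrm2_fatou _ _ _ mu (fun k x => m x * f_ k x) _ (fun k => (A ^+ 2)%:E * nrm2 mu (f_ k))%E).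
- by move=> k; apply: measurable_funCM => //; case: lm.
- by move=> x; apply: ccvgM => //; exact: ccvg_cst.
- by move=> k; exact: IH.
rewrite -(fineK (nrm2_fin_num lf)) -EFinM.
rewrite (_ : (fun k => (A ^+ 2)%:E * nrm2 mu (f_ k))%E = (fun k => (A ^+ 2 * fine (nrm2 mu (f_ k)))%:E)); last first.
  by apply/funext => k; rewrite [RHS]EFinM fineK// nrm2_fin_num.
apply: cvg_EFin; first exact: nearW.
by apply: cvgM; [exact: cvg_cst|exact: nrm2_cvg f0].
Qed.

(** Tested on the indicator of [S], the hypothesis gives [B^2 mu S <= A^2 mu S]. Since [mu S] is
    finite and [A < B], it is 0. *)
Theorem multiplier_essential_bound m (A B : R) : l2 mu m -> 0 <= A < B ->
  (forall (f : 'rV[R]_n -> R[i]) (M : R), measurable_fun [set: 'rV[R]_n] f -> (forall x, normc (f x) <= M) ->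
    (nrm2 mu (fun x => m x * f x)%R <= (A ^+ 2)%:E * nrm2 mu f)%E) ->
  mu [set x | B < normc (m x)] = 0%E.
Proof.
move=> lm /andP[A0 AB] mA; set S := [set x | _].
have mS : measurable S.
  rewrite (_ : S = (fun x => normc (m x)) @^-1` `]B, +oo[).
    by rewrite -[X in measurable X]setTI; apply: measurable_fun_normc => //; case: lm.
  by apply/seteqP; split => x; rewrite /S /= in_itv /= andbT.
have B0 : 0 < B by lra.
have m1 : measurable_fun [set: 'rV[R]_n] (fun x => (\1_S x)%:C : R[i]) by apply: measurable_fun_real.
have := mA (fun x => (\1_S x)%:C) 1 m1.
have -> : nrm2 mu (fun x => (\1_S x)%:C) = mu S.
  rewrite /nrm2 -[in RHS](setIT S) -integral_indic//; apply: eq_integral => x _.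
  by rewrite normc_real indicE; case: (x \in S); rewrite ?normr1 ?normr0 ?expr1n ?expr0n.
have i1 x : normc ((\1_S x)%:C : R[i]) <= 1.
  by rewrite normc_real indicE; case: (x \in S); rewrite ?normr1 ?normr0.
move=> /(_ i1) h.
have : ((B ^+ 2)%:E * mu S <= (A ^+ 2)%:E * mu S)%E.
  apply: le_trans h; rewrite -[in leLHS](setIT S) -integral_indic//.
  rewrite -ge0_integralZl_EFin//; last 2 first.
  - by apply/measurable_EFinP.
  - exact: sqr_ge0.
  apply: ge0_le_integral => //.
  - by move=> x _; rewrite -EFinM lee_fin mulr_ge0 ?sqr_ge0.
  - by apply/measurable_EFinP; apply: measurable_funM.
  - by apply/measurable_EFinP; apply: measurable_sqr_normc; apply: measurable_funCM => //; case: lm.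
  move=> x _; rewrite -EFinM lee_fin normcM normc_real indicE.
  have [/set_mem xS|_] := boolP (x \in S); last by rewrite normr0 !mulr0 expr0n.
  by rewrite normr1 !mulr1 lerXn2r ?nnegrE ?normc_ge0 ?ltW.
have mSfin : mu S \is a fin_num.
  rewrite ge0_fin_numE//; apply: (@le_lt_trans _ _ (mu [set: 'rV[R]_n])).
    by apply: le_measure; rewrite ?inE.
  by rewrite gaussRn_setT ltry.
rewrite -(fineK mSfin) -!EFinM lee_fin => h'; congr EFin.
have m0 : 0 <= fine (mu S) by rewrite fine_ge0.
have : A ^+ 2 < B ^+ 2 by rewrite ltrXn2r// ?nnegrE// ltW.
move: (fine _) h' m0 => t; move: (A ^+ 2) (B ^+ 2) => p q; nra.
Qed.

End symbol.

(** * Passage between the product Gaussians and the measures of the statement *)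

Section eq_measure.
Context {R : realType} {d} {T : measurableType d}.
Variables mu nu : {measure set T -> \bar R}.
Hypothesis munu : forall A, measurable A -> mu A = nu A.
Implicit Type f : T -> R[i].

Lemma eq_measure_cintegral f : cintegral mu f = cintegral nu f.
Proof.
by apply: complexP; rewrite /= /Rintegral; congr fine; apply: eq_measure_integral => A mA _; exact: munu.
Qed.

Lemma eq_measure_nrm2 f : nrm2 mu f = nrm2 nu f.
Proof. by apply: eq_measure_integral => A mA _; exact: munu. Qed.

Lemma eq_measure_cintegrable f : cintegrable mu f <-> cintegrable nu f.
Proof.
have E : (\int[mu]_x (normc (f x))%:E = \int[nu]_x (normc (f x))%:E)%E.
  by apply: eq_measure_integral => A mA _; exact: munu.
by split=> /cintegrableP[mf fi]; apply/cintegrableP; split => //; rewrite ?E// -E.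
Qed.

End eq_measure.

Section gaussian_bridge.
Context {R : realType}.
Variable n : nat.
Local Notation mu := (@gaussRn R n).
Local Notation lam := (@gaussCn R n).
Local Notation leb := (@lebesgue_Rn R n).
Local Notation V := (@bargmann R n).

Lemma gauss_measureE A : measurable A -> gauss_measure A = lam A.
Proof.
move=> mA; rewrite /gauss_measure /gaussCn power_densityE//.
apply: eq_integral => z _; congr EFin.
rewrite /gauss_pdf /gaussC_pdf big_split/= prodr_const card_ord -expR_sum; congr (_ * expR _).
  by rewrite mul1r exprVn.
by rewrite sqnormE -sumrN; apply: eq_bigr => j _; rewrite mul1r sqr_normc_ReIm.
Qed.

Definition gaussRn_pdf (x : 'rV[R]_n) : R := \prod_j gaussR_pdf 2 (x ord0 j).

Lemma gaussRn_pdf_gt0 x : 0 < gaussRn_pdf x.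
Proof. by apply: prodr_gt0 => j _; apply: gaussR_pdf_gt0. Qed.

Lemma gaussRnE A : measurable A -> mu A = (\int[leb]_(x in A) (gaussRn_pdf x)%:E)%E.
Proof. by move=> mA; rewrite /gaussRn power_densityE. Qed.

Lemma measurable_gaussRn_pdf : measurable_fun [set: 'rV[R]_n] gaussRn_pdf.
Proof. by apply: measurable_prod_rho; exact: measurable_gaussR_pdf. Qed.

Lemma integral_gaussRn_pdf : (\int[leb]_x (gaussRn_pdf x)%:E = 1)%E.
Proof. by rewrite -gaussRnE// gaussRn_setT. Qed.

Let dens := density measurable_gaussRn_pdf (fun x => ltW (gaussRn_pdf_gt0 x)) integral_gaussRn_pdf.

(** The density is strictly positive, so a set on which it integrates to 0 is null. This lets the
    essential supremum be computed with either measure. *)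
Lemma gaussRn_null A : measurable A -> mu A = 0%E <-> leb A = 0%E.
Proof.
move=> mA; rewrite gaussRnE//.
have mp : measurable_fun A (fun x => (gaussRn_pdf x)%:E).
  by apply/measurable_EFinP; exact: measurable_funTS measurable_gaussRn_pdf.
split=> [h|h]; last exact: null_set_integral.
have := (ae_eq_integral_abs leb mA mp).1.
under eq_integral do rewrite gee0_abs ?lee_fin ?(ltW (gaussRn_pdf_gt0 _))//.
move=> /(_ h)[N [mN N0 AN]].
apply/eqP; rewrite -measure_le0 -N0; apply: le_measure; rewrite ?inE//.
move=> x Ax; apply: AN => /= /(_ Ax)/eqP.
by rewrite eqe gt_eqF// gaussRn_pdf_gt0.
Qed.

Lemma gaussRn_pdfE x :
  gaussRn_pdf x = (2 / pi) `^ (n%:R / 2) * expR (- (2 * \sum_j x ord0 j ^+ 2)).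
Proof.
rewrite /gaussRn_pdf /gaussR_pdf big_split/= prodr_const card_ord -expR_sum; congr (_ * expR _).
  rewrite -powR12_sqrt ?divr_ge0 ?pi_ge0// -powR_mulrn ?powR_ge0// -powRrM.
  by congr (_ `^ _); exact: mulrC.
by rewrite mulr_sumr -sumrN.
Qed.

Lemma gauss_transformE m z : l2 mu m -> gauss_transform m z = V m z.
Proof.
move=> lm; have im := bargmann_cintegrable z lm.
have mmE := cintegrable_measurable im.
have E A : measurable A -> mu A = dens A by move=> mA; rewrite gaussRnE.
rewrite /bargmann (eq_measure_cintegral E) cintegral_density//.
have := (eq_measure_cintegrable E _).1 im.
move/(cintegrable_density _ _ _ mmE).
set c : R := (2 / pi) `^ (n%:R / 2).
have c0 : c != 0 by rewrite gt_eqF// powR_gt0// divr_gt0// pi_gt0.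
have K x : m x * bargmann_kernel x z * (gaussRn_pdf x)%:C =
    c%:C * (m x * cexp (- 2 * sqv (complexv x - ('i%C / 2) *: z))).
  have K2 : bargmann_kernel x z * (expR (- (2 * \sum_j x ord0 j ^+ 2)))%:C =
      cexp (- 2 * sqv (complexv x - ('i%C / 2) *: z)).
    rewrite -cexp_real -cexpD mulr_sumr -sumrN rmorph_sum /sqv mulr_sumr -big_split/=.
    congr cexp; apply: eq_bigr => j _; rewrite !mxE.
    have -> : 2^-1 = (2^-1)%:C :> R[i] by rewrite fmorphV rmorph_nat.
    have -> : 2 = 2%:C :> R[i] by rewrite rmorph_nat.
    move: (z ord0 j) (x ord0 j) => [p q] t.
    by rewrite !expr2; apply: complexP; rewrite !(ReD,ImD,ReM,ImM,ReN,ImN) /=; field.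
  by rewrite -K2 gaussRn_pdfE -/c rmorphM; ring.
rewrite (funext K) => iK.
rewrite /gauss_transform cintegralZ//.
have := cintegrableZ (c^-1)%:C iK.
by under eq_fun do rewrite mulrA -rmorphM mulVf// rmorph1 mul1r.
Qed.

End gaussian_bridge.

(** * Fock norms, essential suprema and the resulting operator bounds *)

Section norms.
Context {R : realType}.
Variable n : nat.
Local Notation mu := (@gaussRn R n).
Local Notation lam := (@gaussCn R n).
Local Notation leb := (@lebesgue_Rn R n).
Local Notation V := (@bargmann R n).
Implicit Types (F : 'rV[R[i]]_n -> R[i]) (m : 'rV[R]_n -> R[i]).

Lemma fock_normE F : fock_norm F = (nrm2 lam F `^ 2^-1)%E.
Proof.
rewrite /fock_norm /cLnorm unlock -(eq_measure_nrm2 (@gauss_measureE R n)); congr (_ `^ _)%E.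
apply: eq_integral => z _; rewrite abse_EFin ger0_norm ?normc_ge0//.
by rewrite poweR_EFin powR_mulrn ?normc_ge0.
Qed.

Lemma fock_norm_l2 F : l2 lam F -> fock_norm F = (Num.sqrt (sqn lam F))%:E.
Proof.
move=> lF; rewrite fock_normE -(fineK (nrm2_fin_num lF)) poweR_EFin powR12_sqrt//.
exact: sqn_ge0.
Qed.

Lemma fock_norm_lty F : (fock_norm F < +oo)%E = (nrm2 lam F < +oo)%E.
Proof.
rewrite fock_normE; have := nrm2_ge0 lam F; case: (nrm2 lam F) => [r| |]//=.
  by rewrite !ltry.
by move=> _; rewrite invr_eq0 pnatr_eq0.
Qed.

Lemma fockP F : fock F <-> entire F /\ l2 lam F.
Proof.
split=> [[eF]|[eF [_ lF]]]; rewrite /fock /= fock_norm_lty => //.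
by move=> lF; split => //; split => //; exact: entire_measurable.
Qed.

Lemma fock_norm_leM F G (M : R) : 0 <= M -> l2 lam F -> l2 lam G ->
  (fock_norm F <= M%:E * fock_norm G)%E = (nrm2 lam F <= (M ^+ 2)%:E * nrm2 lam G)%E.
Proof.
move=> M0 lF lG; rewrite !fock_norm_l2// -(fineK (nrm2_fin_num lF)) -(fineK (nrm2_fin_num lG)).
rewrite -!EFinM !lee_fin -!/(sqn _ _) -[in LHS](ger0_norm M0) -sqrtr_sqr -sqrtrM ?sqr_ge0//.
by rewrite ler_sqrt// mulr_ge0 ?sqr_ge0 ?sqn_ge0.
Qed.

(** The norm of exponent [+oo] is the essential supremum only under this positivity; otherwise it
    takes a default value. *)
Lemma lebesgue_Rn_setT_gt0 : (0 < leb [set: 'rV[R]_n])%E.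
Proof.
rewrite lt0e measure_ge0 andbT; apply/eqP => /(gaussRn_null measurableT) h.
by have := @gaussRn_setT R n; rewrite h => /eqP; rewrite eqe eq_sym oner_eq0.
Qed.

Lemma measurable_normc_gt m (B : R) : measurable_fun [set: 'rV[R]_n] m ->
  measurable [set x | B < normc (m x)].
Proof.
move=> mm; rewrite (_ : mkset _ = (fun x => normc (m x)) @^-1` `]B, +oo[).
  by rewrite -[X in measurable X]setTI; apply: (measurable_fun_normc mm).
by apply/seteqP; split => x; rewrite /= in_itv /= andbT.
Qed.

Lemma Linfty_norm_leP m (B : R) : measurable_fun [set: 'rV[R]_n] m ->
  (Linfty_norm m <= B%:E)%E <-> mu [set x | B < normc (m x)] = 0%E.
Proof.
move=> mm; set S := [set x | _].
have mS : measurable S by exact: measurable_normc_gt.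
have SE : S = ~` [set x | (`|(normc (m x))%:E| <= B%:E)%E].
  apply/seteqP; split => x; rewrite /S /= lee_fin ger0_norm ?normc_ge0//.
    by rewrite ltNge => /negP.
  by move/negP; rewrite -ltNge.
rewrite /Linfty_norm /cLnorm unlock lebesgue_Rn_setT_gt0 gaussRn_null//.
split=> [/ess_supP h|h].
  apply/(negligibleP _ mS); rewrite SE; exact: h.
by apply/ess_supP; exists S; split => // x /=; rewrite SE.
Qed.

Lemma Linfty_norm_ge0 m : (0 <= Linfty_norm m)%E.
Proof. exact: Lnorm_ge0. Qed.

Lemma Linfty_norm_fin m : Linfty m -> exists2 k : R, 0 <= k & Linfty_norm m = k%:E.
Proof.
rewrite /Linfty /cLfun /= => -[_]; rewrite -/(Linfty_norm m).
have := Linfty_norm_ge0 m; case: (Linfty_norm m) => [k| |]//= k0 _.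
by exists k.
Qed.

(** Writing [F] as [V g] makes the multiple [V (c * g)], which is entire and square integrable like
    every transform. *)
Lemma fockZ c F : fock F -> fock (fun z => c * F z).
Proof.
move=> /fockP[eF lF].
have [g lg gF] := bargmann_surjective (entire_lin_entire eF) lF.
rewrite (_ : (fun z => _) = V (fun x => c * g x)).
  by apply/fockP; split; [apply: bargmann_entire|apply: l2_bargmann]; exact: l2Z.
by apply/funext => z; rewrite bargmannZ// gF.
Qed.

Lemma fock0 : fock (fun _ : 'rV[R[i]]_n => 0 : R[i]) /\
  fock_norm (fun _ : 'rV[R[i]]_n => 0 : R[i]) = 0%E.
Proof.
have V0 : V (fun=> 0) = fun=> 0.
  by apply/funext => z; rewrite /bargmann; under eq_cintegral do rewrite mul0r; rewrite cintegral0.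
split; last first.
  rewrite fock_norm_l2; last exact: l2_0.
  rewrite /sqn /nrm2 integral0_eq ?sqrtr0// => x _; by rewrite normc0 expr0n.
by apply/fockP; split; [rewrite -V0; apply: bargmann_entire|]; exact: l2_0.
Qed.

(** An element of L-infinity is bounded only almost everywhere, whereas [bounded_symbol] asks for a
    bound at every point. Setting [m] to 0 on the exceptional null set changes neither its Gaussian
    transform nor its essential bounds. *)
Lemma Linfty_bounded_repr m (k : R) : 0 <= k -> measurable_fun [set: 'rV[R]_n] m ->
  (Linfty_norm m <= k%:E)%E ->
  exists m', [/\ measurable_fun [set: 'rV[R]_n] m', forall x, normc (m' x) <= k,
    forall B : R, mu [set x | B < normc (m' x)] = 0%E -> (Linfty_norm m <= B%:E)%E &
    forall z, gauss_transform m z = V m' z].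
Proof.
move=> k0 mm mk; have S0 := (Linfty_norm_leP k mm).1 mk.
pose S := [set x | k < normc (m x)].
have mS : measurable S by exact: measurable_normc_gt.
pose m' x : R[i] := m x * (\1_(~` S) x)%:C.
have mm' : measurable_fun [set: 'rV[R]_n] m'.
  by apply: measurable_funCM => //; apply: measurable_fun_real; apply: measurable_indic; exact: measurableC.
have mE x : ~ S x -> m x = m' x by move=> Sx; rewrite /m' indicE mem_set// mulr1.
have aem : \forall x \ae mu, m x = m' x.
  exists S; split => // x /= h; apply: contrapT => /mE; exact: h.
have m'k x : normc (m' x) <= k.
  rewrite /m' normcM indicE; have [/set_mem /negP|_] := boolP (x \in ~` S).
    by rewrite -leNgt normc1 mulr1.
  by rewrite normc0 mulr0.
have lm' : l2 mu m' by apply: l2_bounded m'k => //; exact: gaussRn_setT.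
have lm : l2 mu m.
  split => //; rewrite (ae_nrm2 mm mm' aem); by case: lm'.
exists m'; split => //.
  move=> B B0; apply/(Linfty_norm_leP B mm).
  have mB := measurable_normc_gt B mm; have mB' := measurable_normc_gt B mm'.
  apply/eqP; rewrite -measure_le0 -[leRHS]B0 -(measureU0 mB' mS S0).
  apply: le_measure; rewrite ?inE//; first exact: measurableU.
  move=> x /= Bx; have [Sx|/mE mx] := pselect (S x); first by right.
  by left; rewrite -mx.
move=> z; rewrite gauss_transformE//.
have aemE : \forall x \ae mu, m x * bargmann_kernel x z = m' x * bargmann_kernel x z.
  by apply: filterS aem => x /= ->.
by have [] := cintegral_ae (bargmann_cintegrable z lm)
  (cintegrable_measurable (bargmann_cintegrable z lm')) aemE.
Qed.

Theorem bounded_symbol_op m (k : R) phi F : measurable_fun [set: 'rV[R]_n] m ->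
  (forall x, normc (m x) <= k) -> phi = V m -> fock F ->
  [/\ forall z, cintegrable (@gauss_measure R n) (S_integrand phi F z),
      fock (S_op phi F) & (nrm2 lam (S_op phi F) <= (k ^+ 2)%:E * nrm2 lam F)%E].
Proof.
move=> mm mk -> /fockP[eF lF].
have [g lg gF] := bargmann_surjective (entire_lin_entire eF) lF.
have {gF} FE : F = V g by apply/funext => z; rewrite gF.
subst F.
have lmg : l2 mu (fun x => m x * g x).
  by under eq_fun do rewrite mulrC; exact: l2_mul_bounded lg mm mk.
have SE : S_op (V m) (V g) = V (fun x => m x * g x).
  apply/funext => z; rewrite /S_op (eq_measure_cintegral (@gauss_measureE R n)).
  by have [_ ->] := bounded_symbol z mm mk lg.
rewrite SE; split.
- move=> z; apply/(eq_measure_cintegrable (@gauss_measureE R n)).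
  by have [] := bounded_symbol z mm mk lg.
- by apply/fockP; split; [exact: bargmann_entire|exact: l2_bargmann].
rewrite !bargmann_isometry// -ge0_integralZl_EFin//; last 3 first.
- by move=> x _; rewrite lee_fin sqr_ge0.
- by apply/measurable_EFinP; apply: measurable_sqr_normc; case: lg.
- exact: sqr_ge0.
apply: ge0_le_integral => //.
- by move=> x _; rewrite lee_fin sqr_ge0.
- by apply/measurable_EFinP; apply: measurable_sqr_normc; case: lmg.
- by apply/measurable_EFinP; apply: measurable_funM => //; apply: measurable_sqr_normc; case: lg.
move=> x _; rewrite -EFinM lee_fin normcM exprMn.
apply: ler_wpM2r; first exact: sqr_ge0.
by rewrite lerXn2r ?nnegrE ?normc_ge0// (le_trans (normc_ge0 _) (mk x)).
Qed.

Theorem symbol_essential_bound m phi (A : R) : l2 mu m -> phi = V m -> 0 <= A ->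
  (forall F, fock F -> forall z, cintegrable (@gauss_measure R n) (S_integrand phi F z)) ->
  (forall F, fock F -> (nrm2 lam (S_op phi F) <= (A ^+ 2)%:E * nrm2 lam F)%E) ->
  forall B : R, A < B -> mu [set x | B < normc (m x)] = 0%E.
Proof.
move=> lm -> A0 iS bS B AB.
apply: (multiplier_essential_bound lm (A := A)); first by rewrite A0 AB.
apply: multiplier_bound => // s; apply: symbol_trig_bound => // F eF lF.
  move=> z; apply/(eq_measure_cintegrable (@gauss_measureE R n)).
  by apply: iS; apply/fockP.
have := bS F ((fockP F).2 (conj eF lF)).
rewrite (_ : S_op _ _ = fun z => cintegral lam (S_integrand (V m) F z))//.
by apply/funext => z; rewrite /S_op (eq_measure_cintegral (@gauss_measureE R n)).
Qed.

End norms.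

Theorem theorem1p1 (R : realType) (n : nat) (n_ge1 : (1 <= n)%N)
    (phi : 'rV[R[i]]_n -> R[i]) (phi_fock : fock phi) :
  (S_bounded phi <->
    exists m : 'rV[R]_n -> R[i],
      Linfty m /\ forall z, phi z = gauss_transform m z) /\
  (forall m : 'rV[R]_n -> R[i],
    Linfty m -> (forall z, phi z = gauss_transform m z) ->
    fock_opnorm (S_op phi) = Linfty_norm m).
Proof.
split; first split.
- move=> [iS [fS _ [M bM]]].
  have [eP lP] := (fockP phi).1 phi_fock.
  have [m lm mP] := bargmann_surjective (entire_lin_entire eP) lP.
  have mE : phi = bargmann m by apply/funext => z; rewrite mP.
  (* The constant [M] may be negative, and squaring the norm inequality requires a nonnegative
     one. *)
  pose A := Num.max M 0.
  have A0 : 0 <= A by rewrite le_max lexx orbT.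
  have bA F : fock F -> (nrm2 (gaussCn n) (S_op phi F) <= (A ^+ 2)%:E * nrm2 (gaussCn n) F)%E.
    move=> fF; have [_ lF] := (fockP F).1 fF; have [_ lSF] := (fockP _).1 (fS F fF).
    rewrite -fock_norm_leM//; apply: le_trans (bM F fF) _.
    by apply: lee_wpmul2r; [exact: Lnorm_ge0|rewrite lee_fin le_max lexx].
  have mm : measurable_fun [set: 'rV[R]_n] m by case: lm.
  (* The essential bound holds for every number above [A]; any such number puts [m] in L-infinity,
     and the exact norm is the second claim. *)
  have mA : (Linfty_norm m <= (A + 1)%:E)%E.
    apply/(Linfty_norm_leP _ mm).
    by apply: (symbol_essential_bound lm mE A0 iS bA); rewrite ltrDl.
  exists m; split; first by split => //; apply: le_lt_trans mA _; rewrite ltry.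
  by move=> z; rewrite gauss_transformE// mP.
- move=> [m [Lm mP]]; have [k k0 mk] := Linfty_norm_fin Lm.
  have mkle : (Linfty_norm m <= k%:E)%E by rewrite mk.
  have [m' [mm' m'k _ m'P]] := Linfty_bounded_repr k0 Lm.1 mkle.
  have phiE : phi = bargmann m' by apply/funext => z; rewrite mP m'P.
  have bS F (fF : fock F) := bounded_symbol_op mm' m'k phiE fF.
  have iS F : fock F -> forall z, cintegrable (@gauss_measure R n) (S_integrand phi F z).
    by move=> fF; have [] := bS F fF.
  split=> //; split.
  + by move=> F fF; have [] := bS F fF.
  + move=> a F G fF fG z; rewrite /S_op.
    rewrite (_ : S_integrand phi _ z = fun w => a * S_integrand phi F z w + S_integrand phi G z w); last first.
      by apply/funext => w; rewrite /S_integrand !mulrDl !mulrA.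
    by rewrite cintegralD ?cintegralZ//; [exact: iS| apply: cintegrableZ; exact: iS|exact: iS].
  + exists k => F fF; have [_ fSF bF] := bS F fF.
    by rewrite fock_norm_leM//; [have [_] := (fockP _).1 fSF|have [_] := (fockP _).1 fF].
move=> m Lm mP; have [k k0 mk] := Linfty_norm_fin Lm.
have mkle : (Linfty_norm m <= k%:E)%E by rewrite mk.
have [m' [mm' m'k m'B m'P]] := Linfty_bounded_repr k0 Lm.1 mkle.
have phiE : phi = bargmann m' by apply/funext => z; rewrite mP m'P.
have bS F (fF : fock F) := bounded_symbol_op mm' m'k phiE fF.
have le_k F : fock F -> (fock_norm (S_op phi F) <= k%:E * fock_norm F)%E.
  move=> fF; have [_ fSF bF] := bS F fF.
  by rewrite fock_norm_leM//; [have [_] := (fockP _).1 fSF|have [_] := (fockP _).1 fF].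
have opk : (fock_opnorm (S_op phi) <= k%:E)%E.
  apply: ge_ereal_sup => _ [F [fF F1] <-]; apply: le_trans (le_k F fF) _.
  by rewrite -[leRHS]mule1; apply: lee_wpmul2l.
have [f0 n0] := @fock0 R n.
have op0 : (0 <= fock_opnorm (S_op phi))%E.
  apply: (@le_trans _ _ (fock_norm (S_op phi (fun=> 0)))); first exact: Lnorm_ge0.
  by apply: ereal_sup_ubound; exists (fun=> 0) => //; split => //; rewrite n0.
(* The supremum is finite: the zero function lies in the unit ball and bounds it from below, [k]
   bounds it from above. *)
have [A A0 opA] : exists2 A : R, 0 <= A & fock_opnorm (S_op phi) = A%:E.
  move: op0 opk; case: (fock_opnorm _) => [A| |]//; by exists A.
(* For the remaining inequality the essential bound is available only strictly above [A], hence the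
   slack [e]. *)
apply/eqP; rewrite eq_le mk opk /= -mk opA; apply/lee_addgt0Pr => e e0.
rewrite -EFinD; apply: m'B.
have lm' : l2 (gaussRn n) m' by apply: l2_bounded m'k => //; exact: gaussRn_setT.
apply: (symbol_essential_bound lm' phiE A0) => [F fF|F fF|]; last by rewrite ltrDl.
  by have [] := bS F fF.
have [_ fSF bF] := bS F fF.
have [eF lF] := (fockP F).1 fF; have [_ lSF] := (fockP _).1 fSF.
rewrite -(fineK (nrm2_fin_num lF)) in bF *; rewrite -/(sqn (gaussCn n) F) in bF *.
(* A function of norm 0 cannot be normalized, but [bF] already shows that its image has norm 0. *)
have [N0|N0] := eqVneq (sqn (gaussCn n) F) 0; first by rewrite N0 !mule0 in bF *.
have Npos : 0 < sqn (gaussCn n) F by rewrite lt0r N0 sqn_ge0.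
(* [fock_opnorm] tests the unit ball only, so [F] is rescaled to norm 1 and the estimate is scaled
   back. *)
pose c : R := (Num.sqrt (sqn (gaussCn n) F))^-1.
have c2 : c ^+ 2 = (sqn (gaussCn n) F)^-1 by rewrite /c exprVn sqr_sqrtr// ltW.
have nc : normc (c%:C : R[i]) ^+ 2 = c ^+ 2 by rewrite normc_real real_normK ?num_real.
have fG := fockZ c%:C fF.
have SG : S_op phi (fun z => c%:C * F z) = (fun z => c%:C * S_op phi F z).
  apply/funext => z; rewrite /S_op -cintegralZ; last by have [] := bS F fF.
  by apply: eq_cintegral => w; rewrite /S_integrand !mulrA.
have : (fock_norm (S_op phi (fun z => (c%:C * F z)%R)) <= A%:E)%E.
  rewrite -opA; apply: ereal_sup_ubound; exists (fun z => c%:C * F z) => //; split => //.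
  rewrite fock_norm_l2; last exact: l2Z.
  by rewrite sqnZ// nc c2 mulVf// sqrtr1.
rewrite SG fock_norm_l2; last exact: l2Z.
rewrite sqnZ// nc c2 lee_fin => h.
rewrite -(fineK (nrm2_fin_num lSF)) -/(sqn _ _) -EFinM lee_fin.
have : Num.sqrt ((sqn (gaussCn n) F)^-1 * sqn (gaussCn n) (S_op phi F)) ^+ 2 <= A ^+ 2.
  by rewrite lerXn2r// nnegrE sqrtr_ge0.
by rewrite sqr_sqrtr ?mulr_ge0 ?invr_ge0 ?sqn_ge0// ler_pdivrMl// mulrC.
Qed.
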